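(* Let $G$ be a finite simple graph such that each block of $G$ is either a cycle or a clique (complete graph), let $\mathbb{K}$ be a field, let $S=\mathbb{K}[x_v,y_v : v\in V(G)]$, and let $J_G\subset S$ be the binomial edge ideal of $G$. Then \[ \operatorname{reg}(S/J_G)\leq c'(G)+\sum_{k\geq 4}(k-2)\,c_k(G), \] where $c_k(G)$ is the number of induced cycles of length $k$ in $G$ (equivalently, for $k\ge 4$, the number of blocks of $G$ that are cycles of length $k$), and $c'(G)$ is the number of maximal cliques of $G$ other than the edges of induced cycles of length $\geq 4$ in $G$.
   Context: For a graph $G$ on $[n]=\{1,\dots,n\}$, the binomial edge ideal is $J_G=\langle x_iy_j-x_jy_i : \{i,j\}\in E(G)\rangle\subset S=\mathbb{K}[x_1,\dots,x_n,y_1,\dots,y_n]$, where $S$ is standard graded and $\mathbb{K}$ is an arbitrary field. For a finitely generated graded $S$-module $M$ with graded Betti numbers $\beta_{i,j}(M)=\dim_{\mathbb{K}}\operatorname{Tor}_i^S(M,\mathbb{K})_j$, the Castelnuovo–Mumford regularity is $\operatorname{reg}(M)=\max\{j:\beta_{i,i+j}(M)\neq 0 \text{ for some } i\}$. A block of a graph $G$ is a maximal connected subgraph of $G$ that has no cut vertex (of its own). A clique is a set of vertices inducing a complete graph (or that complete graph itself); maximal cliques are maximal with respect to inclusion. *)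

(* Defs.v *)
From HB Require Import structures.
From mathcomp Require Import all_boot all_order all_algebra.
From mathcomp.multinomials Require Import mpoly.
From Stdlib Require Import ClassicalEpsilon.

Set Implicit Arguments.
Unset Strict Implicit.
Unset Printing Implicit Defensive.

Import Order.TTheory GRing.Theory Num.Theory.
Local Open Scope ring_scope.

(** * Graphs

    A simple graph on the finite type [V] is a symmetric irreflexive
    [e : rel V].  A subgraph is a vertex set together with a set of ordered
    pairs which contains both orientations of each of its edges. *)

Definition subgraph (V : finType) : Type := ({set V} * {set V * V})%type.
Definition verts (V : finType) (H : subgraph V) : {set V} := H.1.
Definition adj (V : finType) (H : subgraph V) : rel V :=
  fun x y => (x, y) \in H.2.

Definition subgraph_of (V : finType) (e : rel V) (H : subgraph V) : Prop :=
  ssrbool.symmetric (adj H) /\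
  (forall x y, adj H x y -> [&& x \in verts H, y \in verts H & e x y]).

Definition subgraph_le (V : finType) (H H' : subgraph V) : bool :=
  (H.1 \subset H'.1) && (H.2 \subset H'.2).

Definition induced (V : finType) (e : rel V) (W : {set V}) : subgraph V :=
  (W, [set p | [&& p.1 \in W, p.2 \in W & e p.1 p.2]]).

Definition del_vertex (V : finType) (H : subgraph V) (v : V) : subgraph V :=
  (H.1 :\ v, [set p in H.2 | (p.1 != v) && (p.2 != v)]).

(* The empty graph does not count as connected. *)
Definition connected (V : finType) (H : subgraph V) : Prop :=
  verts H != set0 /\
  {in verts H &, forall x y, connect (adj H) x y}.

(* [v] separates two vertices of its component, i.e. removing it increases the
   number of connected components. *)
Definition cut_vertex (V : finType) (H : subgraph V) (v : V) : Prop :=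
  v \in verts H /\
  exists x y : V,
    [/\ x \in verts H :\ v, y \in verts H :\ v, connect (adj H) x y
      & ~~ connect (adj (del_vertex H v)) x y].

Definition connected_no_cut (V : finType) (H : subgraph V) : Prop :=
  connected H /\ forall v, ~ cut_vertex H v.

Definition block (V : finType) (e : rel V) (H : subgraph V) : Prop :=
  [/\ subgraph_of e H, connected_no_cut H
    & forall H' : subgraph V, subgraph_of e H' -> connected_no_cut H' ->
        subgraph_le H H' -> H' = H].

(* The edges are exactly the pairs of cyclically consecutive entries of a
   duplicate-free enumeration of the vertices. *)
Definition is_cycle (V : finType) (k : nat) (H : subgraph V) : bool :=
  (2 < k)%N &&
  [exists c : k.-tuple V,
     [&& uniq c, verts H == [set x in c] &
         [forall x in verts H, forall y in verts H,
            adj H x y == ((y == next c x) || (x == next c y))]]].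

Definition is_complete (V : finType) (H : subgraph V) : bool :=
  [forall x in verts H, forall y in verts H, (x != y) ==> adj H x y].

Definition clique (V : finType) (e : rel V) (W : {set V}) : bool :=
  (W != set0) && is_complete (induced e W).

Definition maximal_clique (V : finType) (e : rel V) (W : {set V}) : bool :=
  maxset (clique e) W.

(* An induced cycle is determined by its vertex set. *)
Definition num_induced_cycles (V : finType) (e : rel V) (k : nat) : nat :=
  #|[set W : {set V} | is_cycle k (induced e W)]|.

Definition edge_of_long_induced_cycle (V : finType) (e : rel V)
    (W : {set V}) : bool :=
  [exists U : {set V},
     [&& (3 < #|U|)%N, is_cycle #|U| (induced e U) &
         [exists x, exists y, adj (induced e U) x y && (W == [set x; y])]]].

Definition c' (V : finType) (e : rel V) : nat :=
  #|[set W : {set V} | maximal_clique e W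
                       && ~~ edge_of_long_induced_cycle e W]|.

(** * Graded Betti numbers and regularity of a cyclic module [S/I]

    [S = {mpoly K[m]}] with its standard grading; [I] is (the membership
    predicate of) a homogeneous ideal of [S]. *)

(* Homogeneity of integer degree: zero is the only element of negative
   degree. *)
Definition zhomog (K : fieldType) (m : nat) (d : int) (p : {mpoly K[m]}) : bool :=
  if d is Posz k then p \is k.-homog else p == 0.

(* A sequence  ... -> F_1 -> F_0 -> S/I  of finitely generated graded free
   modules: [F_i] has basis indexed by ['I_(rk i)], the [k]-th basis element
   having degree [deg i k].  Elements are row vectors, the map
   [F_(i+1) -> F_i] is [u |-> u *m diff i], and [F_0 -> S/I] is
   [u |-> u *m aug] modulo [I]. *)
Record free_seq (K : fieldType) (m : nat) : Type := FreeSeq {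
  rk : nat -> nat;
  deg : forall i : nat, 'I_(rk i) -> int;
  diff : forall i : nat, 'M[{mpoly K[m]}]_(rk i.+1, rk i);
  aug : 'cV[{mpoly K[m]}]_(rk 0)
}.

Arguments deg {K m} f i k.

Record graded_free_resolution (K : fieldType) (m : nat)
    (I : {mpoly K[m]} -> Prop) (F : free_seq K m) : Prop := {
  aug_homog : forall k, zhomog (deg F 0 k) (aug F k 0);
  diff_homog : forall i k l, zhomog (deg F i.+1 k - deg F i l) (diff F i k l);
  aug_surj : exists u : 'rV_(rk F 0), I ((u *m aug F) 0 0 - 1);
  exact_aug : forall u : 'rV_(rk F 0),
    I ((u *m aug F) 0 0) <-> exists w : 'rV_(rk F 1), u = w *m diff F 0;
  exact_diff : forall i (u : 'rV_(rk F i.+1)),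
    u *m diff F i = 0 <-> exists w : 'rV_(rk F i.+2), u = w *m diff F i.+1
}.

(* The differential of [F ⊗_S K], where [K = S/(variables)]: entries are
   replaced by their constant coefficients. *)
Definition diffK (K : fieldType) (m : nat) (F : free_seq K m) (i : nat) :
    'M[K]_(rk F i.+1, rk F i) :=
  map_mx (mcoeff 0%MM) (diff F i).

(* Row space: the degree [j] component of [F_i ⊗_S K]. *)
Definition degK (K : fieldType) (m : nat) (F : free_seq K m) (i : nat)
    (j : int) : 'M[K]_(rk F i) :=
  diag_mx (\row_k (deg F i k == j)%:R).

Definition cycK (K : fieldType) (m : nat) (F : free_seq K m) (i : nat) :
    'M[K]_(rk F i) :=
  match i return 'M[K]_(rk F i) with
  | 0%N => 1%:M
  | i'.+1 => kermx (diffK F i')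
  end.

(* [dim_K H_i(F ⊗_S K)_j], the dimension of cycles minus that of boundaries. *)
Definition dim_homologyK (K : fieldType) (m : nat) (F : free_seq K m)
    (i : nat) (j : int) : nat :=
  (\rank (degK F i j :&: cycK F i)%MS - \rank (degK F i.+1 j *m diffK F i))%N.

Definition empty_free_seq (K : fieldType) (m : nat) : free_seq K m :=
  @FreeSeq K m (fun _ => 0%N) (fun _ _ => 0) (fun _ => 0) 0.

(* A graded free resolution of [S/I] by modules of finite rank exists by
   Hilbert's theorem, and [Tor] does not depend on it; so we choose one. *)
Definition resolution (K : fieldType) (m : nat) (I : {mpoly K[m]} -> Prop) :
    free_seq K m :=
  epsilon (inhabits (empty_free_seq K m)) (graded_free_resolution I).

(* [betti I i j = dim_K Tor_i^S(S/I, K)_j]. *)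
Definition betti (K : fieldType) (m : nat) (I : {mpoly K[m]} -> Prop)
    (i : nat) (j : int) : nat :=
  dim_homologyK (resolution I) i j.

Definition is_reg (K : fieldType) (m : nat) (I : {mpoly K[m]} -> Prop)
    (r : int) : Prop :=
  (exists i : nat, betti I i (i%:Z + r) <> 0%N) /\
  (forall (i : nat) (j : int), betti I i (i%:Z + j) <> 0%N -> j <= r).

(* [reg (S/I)]: the maximum, which exists whenever [I] is a proper homogeneous
   ideal; unspecified otherwise. *)
Definition reg_quot (K : fieldType) (m : nat) (I : {mpoly K[m]} -> Prop) : int :=
  epsilon (inhabits 0) (is_reg I).

(** * Binomial edge ideals

    The polynomial ring has [n + n] variables: first the [x]'s, then the
    [y]'s. *)

Definition varx (K : fieldType) (n : nat) (i : 'I_n) : {mpoly K[n + n]} :=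
  'X_(lshift n i).
Definition vary (K : fieldType) (n : nat) (i : 'I_n) : {mpoly K[n + n]} :=
  'X_(rshift n i).

Definition ideal_gen (R : comNzRingType) (A : R -> Prop) (p : R) : Prop :=
  exists s : seq (R * R),
    (forall q, q \in s -> A q.2) /\ p = \sum_(q <- s) q.1 * q.2.

Definition binomial_edge_ideal (K : fieldType) (n : nat) (e : rel 'I_n) :
    {mpoly K[n + n]} -> Prop :=
  ideal_gen (fun f => exists i j : 'I_n,
    e i j /\ f = varx K i * vary K j - varx K j * vary K i).

Arguments binomial_edge_ideal K {n} e p.

(* Main.v *)
(** [reg (S/I) <= r] means that the Koszul homology [H_k(S/I)] vanishes in internal
    degrees above [k + r]; this form makes the behaviour of regularity in short exact
    sequences a chase of elements of [S].  Shifting dimension along an arbitrary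
    graded free resolution [F] of [S/I] identifies [H_i(F ⊗ K)] with [H_i(S/I)], and
    the same shift bounds the degrees of the generators of syzygies, so that a
    resolution by modules of finite rank exists.

    For a vertex [v], let [G_v] be [G] with the neighbours of [v] joined pairwise.
    Then [J_G = J_{G_v} ∩ ((x_v, y_v) + J_{G-v})] (Ohtani), whence
    [reg G <= max (reg G_v, reg (G-v), reg (G_v-v) + 1)].  The induction runs over
    graphs with marked induced cycles, each attached to the rest of the graph only
    through cliques and any two sharing at most one vertex.  Completing at a vertex
    [v] of a marked [k]-cycle leaves a marked [(k-1)]-cycle, and the regularity is at
    most the largest size of a set of edges no two of which lie in a common clique
    and at most [k - 2] of which lie on each marked [k]-cycle: an edge set of this
    kind for [G_v] (for [G_v - v]) is turned into one for [G] which is at least as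
    large (larger), by trading the at most one edge inside the neighbourhood of [v]
    for one (two) edges at [v].  In a disjoint union of cliques, [x_v] is a
    nonzerodivisor and [(J_G, x_v) : y_v] is generated by variables and by the
    binomials of the other cliques.

    When all blocks are cycles or cliques, the long induced cycles can be marked, and
    the edges of the set lying on none of them inject into the maximal cliques that
    are not edges of such cycles. *)

From HB Require Import structures.
Require Import Defs.
From mathcomp Require Import all_boot all_order all_algebra.
From mathcomp.multinomials Require Import ssrcomplements mpoly.
From mathcomp Require Import ring zify.
From Stdlib Require Import Classical ClassicalEpsilon.

Set Implicit Arguments.
Unset Strict Implicit.
Unset Printing Implicit Defensive.

Import Order.TTheory GRing.Theory Num.Theory.
Local Open Scope ring_scope.

(** Completing a vertex of a cycle block usually creates a block that is neither a cycle nor a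
    clique, so the hypothesis on blocks is not inductive. What survives is how a cycle sits in the
    graph: each component outside it is attached to a clique of the cycle. A map [kappa] records
    this attachment and can be updated after every completion. The number of maximal cliques is not
    inductive either and is replaced by the largest size of an admissible edge set. The limit
    [#|C| - 2] is the regularity of the quotient for the cycle itself; it is 1 for a triangle, as
    for every complete graph with an edge, and it drops by exactly one when the cycle is shortened.
    Since [reg_quot] goes through two choice operators, a bound on it takes a resolution of finite
    rank, some nonzero Betti number, and an upper bound for all nonzero ones. Koszul homology yields
    the first and the third. *)

Section LinearExtension.
Variables (K : fieldType) (m : nat).
Local Notation S := {mpoly K[m]}.

Section MonomialMap.
Variables (V : lmodType K) (f : 'X_{1..m} -> V).

Definition mlin (p : S) : V := \sum_(u <- msupp p) p@_u *: f u.

Lemma mlinwE k p : (msize p <= k)%N ->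
  mlin p = \sum_(u : 'X_{1..m < k}) p@_u *: f u.
Proof.
move=> le_pk; pose I : subFinType _ := 'X_{1..m < k}.
rewrite /mlin (big_mksub I) //=; first last.
- by move=> u /msize_mdeg_lt /leq_trans; apply.
- exact: msupp_uniq.
by rewrite big_rmcond //= => u /memN_msupp_eq0 ->; rewrite scale0r.
Qed.

Lemma mlin_is_linear : linear mlin.
Proof.
move=> c p q; set k := maxn (msize (c *: p + q)) (maxn (msize p) (msize q)).
rewrite !(@mlinwE k) ?leq_max ?leqnn ?orbT // scaler_sumr -big_split /=.
by apply: eq_bigr => u _; rewrite mcoeffD mcoeffZ scalerDl scalerA.
Qed.

HB.instance Definition _ :=
  GRing.isLinear.Build K S V _ mlin mlin_is_linear.

Lemma mlinX u : mlin 'X_[u] = f u.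
Proof. by rewrite /mlin msuppX big_seq1 mcoeffX eqxx scale1r. Qed.

End MonomialMap.

(** Reduces identities between linear operators to monomials. Linearity is a plain hypothesis, so
    that composite expressions can be used without declaring them as linear maps. *)
Lemma linear_mpolyP (V : lmodType K) (f g : S -> V) :
  linear f -> linear g -> (forall u, f 'X_[u] = g 'X_[u]) -> f =1 g.
Proof.
move=> lf lg fg p.
have lin0 (h : S -> V) : linear h -> h 0 = 0.
  by move=> /(_ (-1) 0 0); rewrite scaler0 addr0 scaleN1r addNr.
rewrite (mpolyE p); elim: (msupp p) => [|u s IHs].
  by rewrite !big_nil !lin0.
by rewrite !big_cons lf lg fg IHs.
Qed.

(** The quotient of division by ['X_i] with a remainder free of ['X_i]. It contracts the Koszul
    complex of the variables, and it shows that a variable occurring in no generator of an ideal is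
    a nonzerodivisor. *)
Definition mquo (i : 'I_m) : S -> S :=
  mlin (fun u => if (0 < u i)%N then 'X_[u - U_(i)] else 0).

HB.instance Definition _ i := GRing.Linear.on (mquo i).

Lemma mquoK i p : mquo i ('X_i * p) = p.
Proof.
move: p; apply: linear_mpolyP => [c p q|c p q|u] //.
  by rewrite mulrDr linearD -scalerAr linearZ.
rewrite -mpolyXD /mquo mlinX mnmDE mnm1E eqxx /=; congr 'X_[_].
by rewrite addmC addmK.
Qed.

Lemma mquoM i j p : i != j -> mquo i ('X_j * p) = 'X_j * mquo i p.
Proof.
move=> nij; move: p; apply: linear_mpolyP => [c p q|c p q|u].
- by rewrite mulrDr linearD -scalerAr linearZ.
- by rewrite linearD mulrDr linearZ -scalerAr.
rewrite -mpolyXD /mquo !mlinX mnmDE mnm1E (eq_sym j) (negbTE nij) add0n.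
case: ifP => [u_gt0|_]; last by rewrite mulr0.
rewrite -mpolyXD; congr 'X_[_]; apply/mnmP => k.
rewrite !(mnmDE, mnmBE, mnm1E).
by case: (i =P k) => [<-|_]; [rewrite (eq_sym j) (negbTE nij)|rewrite !subn0].
Qed.

(** Degrees are integers because the twists of free modules lead to degrees such as [d - dl k],
    which may be negative. *)
Definition hcomp (d : int) : S -> S :=
  mlin (fun u => if (mdeg u)%:Z == d then 'X_[u] else 0).

HB.instance Definition _ d := GRing.Linear.on (hcomp d).

Lemma hcomp_id d p : hcomp d (hcomp d p) = hcomp d p.
Proof.
move: p; apply: linear_mpolyP => [c p q|c p q|u].
- by rewrite !linearP.
- by rewrite !linearP.
by rewrite /hcomp mlinX; case: ifP => [du|_]; rewrite ?raddf0 // mlinX du.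
Qed.

Lemma hcompMX d i p : hcomp (d + 1) ('X_i * p) = 'X_i * hcomp d p.
Proof.
move: p; apply: linear_mpolyP => [c p q|c p q|u].
- by rewrite mulrDr linearD -scalerAr linearZ.
- by rewrite linearD mulrDr linearZ -scalerAr.
rewrite -mpolyXD /hcomp !mlinX mdegD mdeg1 addnC PoszD.
by rewrite (inj_eq (addIr _)); case: ifP => _; rewrite ?mulr0 // mpolyXD.
Qed.

Lemma mcoeff_hcomp d p u : (hcomp d p)@_u = if (mdeg u)%:Z == d then p@_u else 0.
Proof.
move: p; apply: (@linear_mpolyP K^o) => [c p q|c p q|v] /=.
- by rewrite linearP mcoeffD mcoeffZ.
- by case: ifP => _; rewrite ?mcoeffD ?mcoeffZ // scaler0 addr0.
rewrite /hcomp mlinX mcoeffX; case: eqP => [<-|ne].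
  rewrite mcoeffX; case: (v =P u) => [->|_]; first by rewrite eqxx.
  by case: ifP.
rewrite mcoeff0; case: (v =P u) => [<-|_]; last by case: ifP.
by case: eqP.
Qed.

Lemma hcomp_lt0 d p : d < 0 -> hcomp d p = 0.
Proof.
move=> d_lt0; apply/mpolyP => u; rewrite mcoeff_hcomp mcoeff0.
by case: eqP => // du; move: d_lt0; rewrite -du.
Qed.

Lemma zhomogP d p : reflect (hcomp d p = p) (zhomog d p).
Proof.
rewrite /zhomog; case: d => [d|d]; last first.
  by rewrite hcomp_lt0 //; apply: (iffP eqP) => [->|<-].
apply: (iffP idP) => [/dhomogP dp|<-].
  apply/mpolyP => u; rewrite mcoeff_hcomp; case: eqP => // ndu.
  rewrite memN_msupp_eq0 //; apply/negP => /dp /= du; apply: ndu.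
  by rewrite -du.
apply/dhomogP => u; rewrite mcoeff_msupp mcoeff_hcomp.
by case: ((mdeg u)%:Z =P d) => [[<-]|_]; rewrite ?eqxx.
Qed.

Lemma zhomog_hcomp d p : zhomog d (hcomp d p).
Proof. by apply/zhomogP; rewrite hcomp_id. Qed.

Lemma hcompM d e p q : zhomog e q -> hcomp (d + e) (p * q) = hcomp d p * q.
Proof.
move=> /zhomogP <-; move: q; apply: linear_mpolyP => [c q r|c q r|v].
- by rewrite linearP mulrDr linearD -scalerAr linearZ.
- by rewrite linearP mulrDr -scalerAr.
rewrite /(hcomp e) !mlinX; case: eqP => [<-|_]; last by rewrite !mulr0 raddf0.
move: p; apply: linear_mpolyP => [c p r|c p r|u].
- by rewrite mulrDl linearD -scalerAl linearZ.
- by rewrite linearD mulrDl linearZ -scalerAl.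
rewrite -mpolyXD /hcomp !mlinX mdegD PoszD (inj_eq (addIr _)).
by case: ifP => _; rewrite ?mul0r // mpolyXD.
Qed.

End LinearExtension.

(** * Koszul complexes *)

(* [kos V n] is the Koszul complex of [z 0, ..., z (n - 1)] with coefficients in
   [V], all homological degrees together; the pair [(a, b)] stands for
   [a + e_n /\ b]. *)
Fixpoint kos (R : comNzRingType) (V : lmodType R) (n : nat) : lmodType R :=
  if n is n'.+1 then (kos V n' * kos V n')%type else V.

Section Koszul.
Variables (R : comNzRingType) (z : nat -> R).
Implicit Types V W : lmodType R.

Lemma kosP V n (c d : kos V n.+1) : c.1 = d.1 -> c.2 = d.2 -> c = d.
Proof. by case: c d => [a b] [a' b'] /= -> ->. Qed.

(** The sign comes from writing [e_n] on the left: the differential of [e_n /\ b] is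
    [z_n b - e_n /\ d b]. *)
Fixpoint kd V n : kos V n -> kos V n :=
  match n with
  | 0 => fun=> 0
  | n'.+1 => fun c => (kd c.1 + z n' *: c.2, - kd c.2)
  end.

Lemma kd_is_linear V n : linear (@kd V n).
Proof.
elim: n => [|n IHn] a c d /=; first by rewrite scaler0 addr0.
apply: kosP => /=; rewrite IHn; last by rewrite opprD scalerN.
by rewrite scalerDr scalerDr !scalerA mulrC addrACA.
Qed.

HB.instance Definition _ V n :=
  GRing.isLinear.Build R (kos V n) (kos V n) _ (@kd V n) (@kd_is_linear V n).

Lemma kd_fst V n (c : kos V n.+1) : (kd c).1 = kd c.1 + z n *: c.2.
Proof. by []. Qed.

Lemma kd_snd V n (c : kos V n.+1) : (kd c).2 = - kd c.2.
Proof. by []. Qed.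

Lemma kdd V n (c : kos V n) : kd (kd c) = 0.
Proof.
elim: n c => [|n IHn] // c; apply: kosP; rewrite !(kd_fst, kd_snd).
  by rewrite linearD linearZ /= IHn add0r scalerN subrr.
by rewrite linearN /= IHn !oppr0.
Qed.

(* Exterior multiplication by [e_i], a homotopy between [0] and multiplication by
   [z i]. *)
Fixpoint kext V (i : nat) n : kos V n -> kos V n :=
  match n with
  | 0 => fun=> 0
  | n'.+1 => fun c =>
      if n' == i then (0, c.1) else (kext i c.1, - kext i c.2)
  end.

Lemma kext_is_linear V i n : linear (@kext V i n).
Proof.
elim: n => [|n IHn] a c d /=; first by rewrite scaler0 addr0.
case: ifP => _; apply: kosP => /=; rewrite ?scaler0 ?addr0 ?IHn //.
by rewrite opprD scalerN.
Qed.

HB.instance Definition _ V i n :=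
  GRing.isLinear.Build R (kos V n) (kos V n) _ (@kext V i n)
    (@kext_is_linear V i n).

Lemma kd_kext V i n (c : kos V n) : (i < n)%N ->
  kd (kext i c) + kext i (kd c) = z i *: c.
Proof.
elim: n c => [|n IHn] //= [a b]; rewrite ltnS leq_eqVlt => i_n.
have [ei|ne] := eqVneq n i; last first.
  move: i_n; rewrite eq_sym (negbTE ne) /= => lt_in.
  apply: kosP => /=; last by rewrite !linearN /= !opprK IHn.
  rewrite linearD linearZ /= scalerN addrACA IHn //.
  by rewrite addNr addr0.
subst i; apply: kosP => /=; first by rewrite raddf0 add0r addr0.
by rewrite addrA addNr add0r.
Qed.

Fixpoint kmap V W (f : V -> W) n : kos V n -> kos W n :=
  match n with
  | 0 => f
  | n'.+1 => fun c => (kmap f c.1, kmap f c.2)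
  end.

Lemma kmap_id V n (c : kos V n) : kmap id c = c.
Proof. by elim: n c => [|n IHn] //= [a b]; apply: kosP => /=; rewrite IHn. Qed.

Section KmapAdditive.
Variables (V W : lmodType R) (f : V -> W).
Hypothesis fB : {morph f : x y / x - y}.

Lemma kmapB n : {morph (@kmap _ _ f n) : x y / x - y}.
Proof.
by elim: n => [|n IHn] //= [a b] [c d]; apply: kosP => /=; rewrite IHn.
Qed.

Lemma kmap0 n : @kmap _ _ f n 0 = 0.
Proof. by rewrite -(subrr 0) kmapB subrr. Qed.

Lemma kmapN n : {morph (@kmap _ _ f n) : x / - x}.
Proof. by move=> x; rewrite -[- x]add0r kmapB kmap0 add0r. Qed.

Lemma kmapD n : {morph (@kmap _ _ f n) : x y / x + y}.
Proof. by move=> x y; rewrite -{1}[y]opprK kmapB kmapN opprK. Qed.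

Lemma kmap_scale n a b : (forall v, f (a *: v) = b *: f v) ->
  forall c, @kmap _ _ f n (a *: c) = b *: kmap f c.
Proof.
by move=> fZ; elim: n => [|n IHn] //= [c d]; apply: kosP => /=; rewrite IHn.
Qed.

Lemma kmap_scaleK (g : V -> V) n a : (forall v, g (a *: v) = v) ->
  forall c : kos V n, kmap g (a *: c) = c.
Proof.
by move=> gK; elim: n => [|n IHn] //= [c d]; apply: kosP => /=; rewrite IHn.
Qed.

(** Asks only for compatibility with [z i] for [i < n]. Division by [z n] satisfies this, although
    it does not commute with [z n] and is not linear over [R]. *)
Lemma kd_kmap n (c : kos V n) :
  (forall i v, (i < n)%N -> f (z i *: v) = z i *: f v) ->
  kd (kmap f c) = kmap f (kd c).
Proof.
elim: n c => [|n IHn] /= c fz; first by rewrite -[LHS](kmap0 0).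
have IH d : kd (kmap f d) = @kmap _ _ f n (kd d).
  by apply: IHn => i v lt_in; apply: fz; apply: ltnW.
apply: kosP => /=; last by rewrite kmapN IH.
by rewrite kmapD IH (kmap_scale (b := z n)) // => v; apply: fz.
Qed.

End KmapAdditive.

(** The Koszul complex of a submodule, as a predicate on chains. Quotient modules are never formed:
    their chains are chains of [V] up to [kall N0]. *)
Fixpoint kall V (P : V -> Prop) n : kos V n -> Prop :=
  match n with
  | 0 => P
  | n'.+1 => fun c => kall P c.1 /\ kall P c.2
  end.

Definition submod V (P : V -> Prop) : Prop :=
  P 0 /\ forall a u v, P u -> P v -> P (a *: u + v).

Section Submod.
Variables (V : lmodType R) (P : V -> Prop).
Hypothesis PS : submod P.

Lemma submod0 : P 0. Proof. by case: PS. Qed.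

Lemma submodZ a u : P u -> P (a *: u).
Proof. by move=> Pu; rewrite -[_ *: _]addr0; apply: PS.2 => //; apply: PS.1. Qed.

Lemma submodD u v : P u -> P v -> P (u + v).
Proof. by move=> Pu Pv; rewrite -[u]scale1r; apply: PS.2. Qed.

Lemma submodN u : P u -> P (- u).
Proof. by rewrite -scaleN1r; apply: submodZ. Qed.

Lemma submodB u v : P u -> P v -> P (u - v).
Proof. by move=> Pu Pv; apply/submodD/submodN. Qed.

Lemma submod_sum I (r : seq I) (Q : pred I) (F : I -> V) :
  (forall i, Q i -> P (F i)) -> P (\sum_(i <- r | Q i) F i).
Proof.
by move=> PF; elim/big_rec: _ => [|i x Qi Px]; [apply: submod0 | apply: submodD => //; apply: PF].
Qed.

Lemma kall0 n : kall P (0 : kos V n).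
Proof. by elim: n => //=; apply: submod0. Qed.

Lemma kallZ n a (c : kos V n) : kall P c -> kall P (a *: c).
Proof.
by elim: n c => [|n IHn] /=; [apply: submodZ | move=> c [? ?]; split; apply: IHn].
Qed.

Lemma kallD n (c d : kos V n) : kall P c -> kall P d -> kall P (c + d).
Proof.
elim: n c d => [|n IHn] /=; first exact: submodD.
by move=> c d [? ?] [? ?]; split; apply: IHn.
Qed.

Lemma kallN n (c : kos V n) : kall P c -> kall P (- c).
Proof. by rewrite -scaleN1r; apply: kallZ. Qed.

Lemma kallB n (c d : kos V n) : kall P c -> kall P d -> kall P (c - d).
Proof. by move=> Pc Pd; apply/kallD/kallN. Qed.

Lemma kall_kd n (c : kos V n) : kall P c -> kall P (kd c).
Proof.
elim: n c => [|n IHn] /=; first by move=> ? _; apply: submod0.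
move=> c [Pa Pb]; split; last by apply/kallN/IHn.
by apply: kallD; [apply: IHn | apply: kallZ].
Qed.

Lemma kall_kext n i (c : kos V n) : kall P c -> kall P (kext i c).
Proof.
elim: n c => [|n IHn] /=; first by move=> ? _; apply: submod0.
move=> c [Pa Pb]; case: ifP => _; split => //=; first exact: kall0.
  exact: IHn.
by apply/kallN/IHn.
Qed.

End Submod.

Lemma kall_sub V (P Q : V -> Prop) n (c : kos V n) :
  (forall v, P v -> Q v) -> kall P c -> kall Q c.
Proof.
by move=> PQ; elim: n c => [|n IHn] /= c; [apply: PQ | move=> [? ?]; split; apply: IHn].
Qed.

Lemma kall_and V (P Q : V -> Prop) n (c : kos V n) :
  kall P c -> kall Q c -> kall (fun v => P v /\ Q v) c.
Proof.
by elim: n c => [|n IHn] //= c [? ?] [? ?]; split; apply: IHn.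
Qed.

Lemma kallT V n (c : kos V n) : kall (fun=> True) c.
Proof. by elim: n c => //= n IHn c; split; apply: IHn. Qed.

Lemma kall_eq0 V n (c : kos V n) : kall (fun v => v = 0) c <-> c = 0.
Proof.
elim: n c => [|n IHn] //= [a b] /=; split=> [[/IHn -> /IHn ->] //|[-> ->]].
by split; apply/IHn.
Qed.

Lemma kall_kmap V W (P : W -> Prop) (f : V -> W) n (c : kos V n) :
  kall P (kmap f c) <-> kall (fun v => P (f v)) c.
Proof.
by elim: n c => [|n IHn] //= c; split=> -[/IHn ? /IHn ?].
Qed.

Lemma kall_split V W (P : V -> Prop) (Q : W -> Prop) (Q' : V -> Prop)
    (f : W -> V) n (c : kos V n) :
  (forall v, P v -> exists2 w, Q w & Q' (v - f w)) -> kall P c ->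
  exists2 d, kall Q d & kall Q' (c - kmap f d).
Proof.
move=> PQ; elim: n c => [|n IHn] /= c; first exact: PQ.
move=> [/IHn [d1 Qd1 Qc1] /IHn [d2 Qd2 Qc2]].
by exists (d1, d2).
Qed.

Fixpoint kinj V n : V -> kos V n :=
  match n with
  | 0 => id
  | n'.+1 => fun v => (kinj n' v, 0)
  end.

Fixpoint kbot V n : kos V n -> V :=
  match n with
  | 0 => id
  | n'.+1 => fun c => kbot c.1
  end.

Lemma kd_kinj V n (v : V) : kd (kinj n v) = 0.
Proof.
by elim: n => //= n IHn; rewrite IHn scaler0 addr0 raddf0 oppr0.
Qed.

Lemma kall_kinj V (P : V -> Prop) n v : submod P -> P v -> kall P (kinj n v).
Proof. by move=> PS Pv; elim: n => //= n IHn; split=> //; apply: kall0. Qed.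

Lemma kall_kbot V (P : V -> Prop) n (c : kos V n) : kall P c -> P (kbot c).
Proof. by elim: n c => //= n IHn c [? _]; apply: IHn. Qed.

Lemma kbot_kinj V n (v : V) : kbot (kinj n v) = v.
Proof. by elim: n. Qed.

Lemma kbot_is_linear V n : linear (@kbot V n).
Proof. by elim: n => //= n IHn a c d; rewrite IHn. Qed.

HB.instance Definition _ V n :=
  GRing.isLinear.Build R (kos V n) V _ (@kbot V n) (@kbot_is_linear V n).

Lemma kbotB V n : {morph @kbot V n : x y / x - y}.
Proof. exact: linearB. Qed.

Lemma kbotZ V n a (c : kos V n) : kbot (a *: c) = a *: kbot c.
Proof. exact: linearZ. Qed.

Lemma kinj_is_linear V n : linear (@kinj V n).
Proof.
elim: n => //= n IHn a c d; rewrite IHn.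
by apply: kosP => //=; rewrite scaler0 addr0.
Qed.

HB.instance Definition _ V n :=
  GRing.isLinear.Build R V (kos V n) _ (@kinj V n) (@kinj_is_linear V n).

Lemma kbot_kmap V W (f : V -> W) n (c : kos V n) :
  kbot (kmap f c) = f (kbot c).
Proof. by elim: n c => //= n IHn c; rewrite IHn. Qed.

Lemma kmap_kinj V W (f : V -> W) n v :
  f 0 = 0 -> kmap f (kinj n v) = kinj n (f v).
Proof.
move=> f0; elim: n => //= n ->; apply: kosP => //=.
by elim: n => //= n IHn; apply: kosP.
Qed.

(** The bottom coefficient of a boundary is a combination of the [z i] with coefficients of the
    chain. Arguments of Nakayama type obtain their elements of the irrelevant ideal here. *)
Lemma kbot_kd V (N P : V -> Prop) n (c : kos V n) : submod P ->
  (forall i v, (i < n)%N -> N v -> P (z i *: v)) -> kall N c -> P (kbot (kd c)).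
Proof.
move=> PS; elim: n c => [|n IHn] /= c Nz; first by move=> _; apply: submod0.
move=> [Na Nb]; rewrite linearD linearZ; apply: submodD => //.
  by apply: IHn => // i v lt_in; apply: Nz; apply: ltnW.
by apply: Nz => //; apply: kall_kbot.
Qed.

End Koszul.

(** * Exactness of the Koszul complex of the variables *)

Section KoszulExact.
Variables (R : comNzRingType) (z : nat -> R) (V : lmodType R).
Variables (rho : nat -> V -> V) (m : nat).
Hypothesis rhoB : forall i, {morph rho i : x y / x - y}.
Hypothesis rhoK : forall i v, (i < m)%N -> rho i (z i *: v) = v.
Hypothesis rhoC : forall i j v, (i < m)%N -> (j < m)%N -> i != j ->
  rho i (z j *: v) = z j *: rho i v.

Fixpoint ksig n (v : V) : V :=
  if n is n'.+1 then ksig n' (v - z n' *: rho n' v) else v.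

(** [rho n] divides by [z n]. Dividing the relation [kd c0 = - z n *: c1] gives [kd q = - c1] for
    the quotient [q] of [c0], so [c0 - z n *: q] is a cycle of the complex on one element fewer. At
    the end only the remainder [ksig] of the bottom coefficient is left. *)
Lemma kos_exact n (c : kos V n) : (n <= m)%N -> kd z c = 0 ->
  exists b, c - kinj n (ksig n (kbot c)) = kd z b.
Proof.
elim: n c => [|n IHn] c; first by move=> _ _; exists 0; rewrite /= subrr.
case: c => [c0 c1] lt_nm dc.
have := congr1 fst dc; rewrite /= => dc0.
have {dc} dc1 : kd z c1 = 0 by apply/eqP; rewrite -oppr_eq0; apply/eqP/(congr1 snd dc).
pose q := kmap (rho n) c0.
have dq : kd z q = - c1.
  rewrite (kd_kmap (rhoB n)) => [|i v lt_in]; last first.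
    by apply: rhoC => //; [apply: ltn_trans lt_nm | rewrite eq_sym ltn_eqF].
  rewrite (_ : kd z c0 = - (z n *: c1)); last by apply/eqP; rewrite -addr_eq0 dc0.
  by rewrite (kmapN (rhoB n)) kmap_scaleK // => v; apply: rhoK.
have /IHn [|b0 Eb0] : kd z (c0 - z n *: q) = 0.
- by rewrite linearB linearZ /= dq scalerN opprK.
- exact: ltnW.
exists (b0, q); apply: kosP => /=; last by rewrite subr0 dq opprK.
rewrite -Eb0 kbotB kbotZ kbot_kmap.
by rewrite addrAC subrK.
Qed.

End KoszulExact.

(** * Graded modules and vanishing of Koszul homology *)

Section Graded.
Variables (K : fieldType) (m : nat).
Local Notation S := {mpoly K[m]}.

(** The variables are continued by 0 to all natural numbers, so that the Koszul complex can be built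
    by recursion on its length. *)
Definition zvar (i : nat) : S := if insub i is Some j then 'X_j else 0.

Lemma zvarE (i : 'I_m) : zvar i = 'X_i.
Proof. by rewrite /zvar valK. Qed.

Record grading (V : lmodType S) := Grading {
  gpi :> int -> V -> V;
  gpiB : forall d, {morph gpi d : x y / x - y};
  gpi_id : forall d v, gpi d (gpi d v) = gpi d v;
  gpi_var : forall d (i : 'I_m) v, gpi (d + 1) ('X_i *: v) = 'X_i *: gpi d v
}.

Section Projection.
Variables (V : lmodType S) (g : grading V).

Lemma gpi_zvar d i v : (i < m)%N -> g (d + 1) (zvar i *: v) = zvar i *: g d v.
Proof. by move=> lt_im; rewrite -[i]/(nat_of_ord (Ordinal lt_im)) zvarE gpi_var. Qed.

Lemma gpi0 d : g d 0 = 0.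
Proof. by rewrite -[X in g d X](subrr 0) (gpiB g) subrr. Qed.

(* Projection to the chains of homological degree [k] all of whose entries have
   degree [r]; in the Koszul complex these have internal degree [k + r]. *)
Fixpoint kpi n (k r : int) : kos V n -> kos V n :=
  match n with
  | 0 => fun v => if k == 0 then g r v else 0
  | n'.+1 => fun c => (kpi k r c.1, kpi (k - 1) r c.2)
  end.

Lemma kpiB n k r : {morph @kpi n k r : x y / x - y}.
Proof.
elim: n k => [|n IHn] k /= x y; last by apply: kosP => /=; rewrite IHn.
by case: (k == 0); rewrite ?gpiB ?subr0.
Qed.

Lemma kpi0 n k r : @kpi n k r 0 = 0.
Proof. by rewrite -[X in kpi _ _ X](subrr 0) kpiB subrr. Qed.

Lemma kpiN n k r v : @kpi n k r (- v) = - kpi k r v.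
Proof. by rewrite -[- v]add0r kpiB kpi0 add0r. Qed.

Lemma kpiD n k r u v : @kpi n k r (u + v) = kpi k r u + kpi k r v.
Proof. by rewrite -{1}[v]opprK kpiB kpiN opprK. Qed.

Lemma kpi_id n k r (c : kos V n) : kpi k r (kpi k r c) = kpi k r c.
Proof.
elim: n k c => [|n IHn] k c /=; last by apply: kosP => /=; rewrite IHn.
by case: (k == 0); rewrite ?gpi_id.
Qed.

Lemma kpi_zvar n k r i (c : kos V n) : (i < m)%N ->
  kpi k (r + 1) (zvar i *: c) = zvar i *: kpi k r c.
Proof.
move=> lt_im; elim: n k c => [|n IHn] k c /=; last first.
  by apply: kosP => /=; rewrite IHn.
by case: (k == 0); rewrite ?gpi_zvar // scaler0.
Qed.

(** The differential lowers the homological degree and raises the degree of the coefficients,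
    keeping the internal degree [k + r]. *)
Lemma kpi_kd n k r (c : kos V n) : (n <= m)%N ->
  kpi (k - 1) (r + 1) (kd zvar c) = kd zvar (kpi k r c).
Proof.
elim: n k c => [|n IHn] k c; first by rewrite /= gpi0; case: ifP.
move=> lt_nm; apply: kosP => /=; last by rewrite kpiN IHn // ltnW.
by rewrite kpiD IHn ?kpi_zvar // ltnW.
Qed.

Lemma kpi_kinj n k r v :
  kpi k r (kinj n v) = if k == 0 then kinj n (g r v) else 0.
Proof.
elim: n k => [|n IHn] k //=; apply: kosP => /=.
  by rewrite IHn; case: ifP.
by rewrite kpi0; case: ifP.
Qed.

Definition gsub (N : V -> Prop) : Prop :=
  submod N /\ forall d v, N v -> N (g d v).

Lemma gsub0 : gsub (fun v => v = 0).
Proof.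
split=> [|d v ->]; last exact: gpi0.
by split=> // a u v -> ->; rewrite scaler0 addr0.
Qed.

Lemma kall_kpi (N : V -> Prop) n k r (c : kos V n) :
  gsub N -> kall N c -> kall N (kpi k r c).
Proof.
move=> [NS Ng]; elim: n k c => [|n IHn] k c /=; last first.
  by move=> [? ?]; split; apply: IHn.
by case: ifP => _ Nc; [apply: Ng | apply: submod0].
Qed.

(* [H_k(N/N0)] vanishes in internal degree [k + r]. *)
Definition kvan (N N0 : V -> Prop) (k r : int) : Prop :=
  forall c : kos V m, kall N c -> kall N0 (kd zvar c) ->
  exists2 b, kall N b & kall N0 (kpi k r c - kd zvar b).

(* [reg (V/N0) <= rho]. *)
Definition greg (N0 : V -> Prop) (rho : int) : Prop :=
  forall k r, rho < r -> kvan (fun=> True) N0 k r.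

Lemma greg_eq (N0 N1 : V -> Prop) rho :
  (forall v, N0 v <-> N1 v) -> greg N0 rho -> greg N1 rho.
Proof.
move=> N01 regN k r lt_r c _ dc; have [|b _ Nb] := regN k r lt_r c (kallT c).
  by apply: kall_sub dc => v /N01.
by exists b; [apply: kallT | apply: kall_sub Nb => v /N01].
Qed.

(** Here [L] is [I + J], and the sequence is [0 -> V/IJ -> V/I (+) V/J -> V/L -> 0]. A cycle modulo
    [IJ] bounds [b1] modulo [I] and [b2] modulo [J]; the difference [b1 - b2] is a cycle modulo [L]
    one homological degree higher, hence the bound [rho - 1] there. The part [u] in [I] of what
    remains after bounding this difference corrects [b1]. *)
Lemma greg_cap (I J L IJ : V -> Prop) rho :
  gsub I -> gsub J -> (forall v, I v -> L v) -> (forall v, J v -> L v) ->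
  (forall v, L v -> exists2 u, I u & J (v - u)) ->
  (forall v, IJ v <-> I v /\ J v) -> submod L ->
  greg I rho -> greg J rho -> greg L (rho - 1) -> greg IJ rho.
Proof.
move=> gI gJ IL JL LIJ IJE LS regI regJ regL k r lt_r c _ dc.
have [|b1 _ Ib1] := regI k r lt_r c (kallT c).
  by apply: kall_sub dc => v /IJE [].
have [|b2 _ Jb2] := regJ k r lt_r c (kallT c).
  by apply: kall_sub dc => v /IJE [].
have lt_r1 : rho - 1 < r - 1 by rewrite ltrD2r.
have [|e _ Le] := regL (k + 1) (r - 1) lt_r1 (b1 - b2) (kallT _).
  rewrite (_ : kd _ _ = (kpi k r c - kd zvar b2) - (kpi k r c - kd zvar b1)).
    by apply: kallB => //; apply: kall_sub; [exact: JL|exact: Jb2|exact: IL|exact: Ib1].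
  by rewrite linearB /= opprB [RHS]addrC addrA subrK.
have [u Iu Ju] := kall_split (f := id) LIJ Le.
rewrite kmap_id in Ju.
have kpid (b : kos V m) : kd zvar (kpi (k + 1) (r - 1) b) = kpi k r (kd zvar b).
  by rewrite -kpi_kd // (addrK 1 k) (subrK 1 r).
exists (kpi (k + 1) (r - 1) b1 - u); first exact: kallT.
apply: kall_sub (fun v => iffRL (IJE v)) _; apply: kall_and.
  have -> : kpi k r c - kd zvar (kpi (k + 1) (r - 1) b1 - u) =
      kpi k r (kpi k r c - kd zvar b1) + kd zvar u.
    by rewrite linearB /= kpid kpiB kpi_id opprD opprK addrA.
  by apply: kallD; [exact: gI.1 | exact: kall_kpi | exact: (kall_kd _ gI.1)].
have -> : kpi k r c - kd zvar (kpi (k + 1) (r - 1) b1 - u) =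
   kpi k r (kpi k r c - kd zvar b2) -
   kd zvar (kpi (k + 1) (r - 1) (b1 - b2) - kd zvar e - u).
  rewrite !linearB /= kdd !opprK addr0 !kpiB kpi_id linearB /= !kpid.
  by rewrite opprB !addrA subrK.
by apply: kallB; [exact: gJ.1 | exact: kall_kpi | exact: (kall_kd _ gJ.1)].
Qed.

Lemma kmap_scaleE a n (d : kos V n) : kmap (fun v => a *: v) d = a *: d.
Proof. by elim: n d => [|n IHn] //= d; apply: kosP; rewrite /= IHn. Qed.

Section ModuloVariable.
Variables (I L : V -> Prop) (rho : int) (i : 'I_m).
Hypotheses (gI : gsub I) (IL : forall v, I v -> L v).
Hypothesis LI : forall v, L v -> exists w, I (v - 'X_i *: w).
Hypothesis regL : greg L rho.

(** [L] is [I + 'X_i V]: the error of a bounding chain modulo [L] is ['X_i *: q] modulo [I], and as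
    a difference of a cycle and a boundary it is again a cycle modulo [I]. *)
Lemma greg_lift k r (c : kos V m) : rho < r -> kall I (kd zvar c) ->
  exists b q : kos V m, kall I (kpi k r c - kd zvar b - 'X_i *: q) /\
              kall I ('X_i *: kd zvar q).
Proof.
move=> lt_r dc; have IS := gI.1.
have [|b _ Lb] := regL k lt_r (kallT c); first exact: kall_sub dc.
have [q _ Iq] : exists2 q, kall (fun=> True) q &
    kall I (kpi k r c - kd zvar b - kmap (fun v => 'X_i *: v) q).
  by apply: kall_split Lb => v /LI [w Iw]; exists w.
rewrite kmap_scaleE in Iq; exists b, q; split=> //.
have -> : 'X_i *: kd zvar q = kpi (k - 1) (r + 1) (kd zvar c) -
    kd zvar (kpi k r c - kd zvar b - 'X_i *: q).
  rewrite kpi_kd // !linearB /= kdd linearZ /= !opprK addr0.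
  by rewrite addrA subrr add0r.
by apply: kallB; [| exact: kall_kpi | exact: kall_kd].
Qed.

(** When ['X_i] can be cancelled, [q] itself is a cycle modulo [I], and the homotopy [kext i]
    exhibits ['X_i *: q] as a boundary. *)
Lemma greg_nzd : (forall v, I ('X_i *: v) -> I v) -> greg I rho.
Proof.
move=> nzd k r lt_r c _ /(greg_lift k lt_r) [b [q [Iq Idq]]]; have IS := gI.1.
have {}Idq : kall I (kd zvar q).
  by move: Idq; rewrite -kmap_scaleE kall_kmap; apply: kall_sub.
exists (b + kext i q); first exact: kallT.
have -> : kpi k r c - kd zvar (b + kext i q) =
   (kpi k r c - kd zvar b - 'X_i *: q) + kext i (kd zvar q).
  rewrite -zvarE -(kd_kext _ _ (ltn_ord i)) linearD /= !opprD !addrA.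
  by rewrite subrK.
by apply: kallD => //; apply: kall_kext.
Qed.

(** The sequence [0 -> (V/C)(-1) -> V/I -> V/L -> 0] with [C = I : 'X_i]. Now [q] is a cycle modulo
    [C], in coefficient degree one lower, and is bounded there. *)
Lemma greg_colon (C : V -> Prop) : (forall v, I ('X_i *: v) <-> C v) ->
  greg C (rho - 1) -> greg I rho.
Proof.
move=> IC regC k r lt_r c _ /(greg_lift k lt_r) [b [q [Iq Idq]]]; have IS := gI.1.
have Cdq : kall C (kd zvar q).
  move: Idq; rewrite -kmap_scaleE kall_kmap; apply: kall_sub => v; exact: (IC v).1.
have lt_r1 : rho - 1 < r - 1 by rewrite ltrD2r.
have [b' _ Cb'] := regC k (r - 1) lt_r1 q (kallT q) Cdq.
exists (kpi (k + 1) (r - 1) b + 'X_i *: b'); first exact: kallT.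
have -> : kpi k r c - kd zvar (kpi (k + 1) (r - 1) b + 'X_i *: b') =
   kpi k r (kpi k r c - kd zvar b - 'X_i *: q) +
   'X_i *: (kpi k (r - 1) q - kd zvar b').
  have -> : kd zvar (kpi (k + 1) (r - 1) b + 'X_i *: b') =
     kpi k r (kd zvar b) + 'X_i *: kd zvar b'.
    by rewrite linearD linearZ /= -kpi_kd // (addrK 1 k) (subrK 1 r).
  have XE : 'X_i *: kpi k (r - 1) q = kpi k r ('X_i *: q).
    by rewrite -zvarE -kpi_zvar // (subrK 1 r).
  by rewrite scalerBr XE !kpiB kpi_id addrA subrK opprD addrA.
apply: kallD => //; first exact: kall_kpi.
by rewrite -kmap_scaleE kall_kmap; apply: kall_sub Cb' => v; exact: (IC v).2.
Qed.

End ModuloVariable.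

End Projection.
End Graded.

(** * Graded free modules *)

Section FreeModules.
Variables (K : fieldType) (m : nat).
Local Notation S := {mpoly K[m]}.
Local Notation zvar := (zvar K m).

Fact sgradeB (d : int) : {morph (hcomp d : S^o -> S^o) : x y / x - y}.
Proof. exact: (raddfB (hcomp d)). Qed.

Fact sgrade_var (d : int) (i : 'I_m) (v : S^o) :
  hcomp (d + 1) ('X_i *: v) = 'X_i *: (hcomp d v : S^o).
Proof. exact: hcompMX. Qed.

Definition sgrade : grading S^o :=
  @Grading _ _ S^o (@hcomp K m) sgradeB (@hcomp_id K m) sgrade_var.

Section RowGrading.
Variables (p : nat) (dl : 'I_p -> int).

Definition rpi (d : int) (u : 'rV[S]_p) : 'rV[S]_p :=
  \row_k hcomp (d - dl k) (u 0 k).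

Fact rpiB d : {morph rpi d : x y / x - y}.
Proof. by move=> x y; apply/rowP => k; rewrite !mxE linearB. Qed.

Fact rpi_id d u : rpi d (rpi d u) = rpi d u.
Proof. by apply/rowP => k; rewrite !mxE hcomp_id. Qed.

Fact rpi_var d (i : 'I_m) u : rpi (d + 1) ('X_i *: u) = 'X_i *: rpi d u.
Proof. by apply/rowP => k; rewrite !mxE addrAC hcompMX. Qed.

Definition rgrade : grading 'rV[S]_p := Grading rpiB rpi_id rpi_var.
End RowGrading.

Definition mcst (p : S) : S := (p@_0%MM)%:MP.

Lemma mcst_is_linear : linear mcst.
Proof. by move=> a p q; rewrite /mcst mcoeffD mcoeffZ mpolyCD mpolyCM mul_mpolyC. Qed.

HB.instance Definition _ := GRing.isLinear.Build K S S _ mcst mcst_is_linear.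

Definition nquo (i : nat) (p : S) : S :=
  if insub i is Some j then mquo (j : 'I_m) p else 0.

Lemma nquoE (i : 'I_m) p : nquo i p = mquo i p.
Proof. by rewrite /nquo valK. Qed.

Fact nquo_is_linear i : linear (nquo i).
Proof.
move=> a p q; rewrite /nquo; case: insub => [j|]; first exact: linearP.
by rewrite scaler0 addr0.
Qed.

HB.instance Definition _ i := GRing.isLinear.Build K S S _ (nquo i) (nquo_is_linear i).

Lemma nquoK i p : (i < m)%N -> nquo i (zvar i * p) = p.
Proof.
by move=> lt_im; rewrite -[i]/(val (Ordinal lt_im)) nquoE zvarE mquoK.
Qed.

Lemma nquoC i j p : (i < m)%N -> (j < m)%N -> i != j ->
  nquo i (zvar j * p) = zvar j * nquo i p.
Proof.
move=> lt_im lt_jm; rewrite -[i]/(val (Ordinal lt_im)) -[j]/(val (Ordinal lt_jm)).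
by rewrite (inj_eq val_inj) => ne; rewrite !nquoE zvarE mquoM.
Qed.

(** Sets the first [n] variables to 0. It runs from the identity to the constant term and is the
    value of [ksig] for free modules. *)
Definition mkill (n : nat) : S -> S :=
  mlin (fun u => if [forall i : 'I_m, (i < n)%N ==> (u i == 0%N)] then 'X_[u] else 0).

HB.instance Definition _ n := GRing.Linear.on (mkill n).

Lemma mkill0 p : mkill 0 p = p.
Proof.
move: p; apply: linear_mpolyP => [||u]; [exact: linearP | by [] |].
by rewrite /mkill mlinX ifT //; apply/forallP.
Qed.

Lemma mkill_all p : mkill m p = mcst p.
Proof.
move: p; apply: linear_mpolyP => [||u]; [exact: linearP | exact: linearP|].
rewrite /mkill mlinX /mcst mcoeffX; case: (u =P 0%MM) => [->|ne].
  by rewrite ifT ?mpolyX0 //; apply/forallP => i; rewrite mnm0E implybT.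
case: ifP => // /forallP u0; case: ne; apply/mnmP => i.
by rewrite mnm0E; apply/eqP; move: (u0 i); rewrite ltn_ord.
Qed.

Lemma mkillS n p : (n < m)%N ->
  mkill n (p - zvar n * nquo n p) = mkill n.+1 p.
Proof.
move=> lt_nm; have [i -> {n lt_nm}] : exists i : 'I_m, n = i.
  by exists (Ordinal lt_nm).
rewrite zvarE nquoE.
move: p; apply: linear_mpolyP => [a p q|a p q|u].
- rewrite linearP /= mulrDr -scalerAr opprD addrACA -scalerBr.
  by rewrite [LHS]linearP.
- exact: linearP.
rewrite linearB /= /mquo mlinX /mkill [in RHS]mlinX mlinX.
have allS : [forall j : 'I_m, (j < i.+1)%N ==> (u j == 0%N)] =
    [forall j : 'I_m, (j < i)%N ==> (u j == 0%N)] && (u i == 0%N).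
  apply/forallP/andP => [u0|[/forallP u0 ui] j].
    split; last by have := u0 i; rewrite /= ltnSn.
    by apply/forallP => j; apply/implyP => lt_ji; move: (u0 j); rewrite ltnS (ltnW lt_ji).
  apply/implyP; rewrite ltnS leq_eqVlt => /predU1P [ji|lt_ji].
    by rewrite (_ : j = i) //; apply/val_inj.
  by have /implyP := u0 j; apply.
rewrite allS; have [ui|u_gt0] := posnP (u i).
  by rewrite mulr0 raddf0 subr0 andbT.
rewrite andbF -mpolyXD addmC submK ?lep1mP -?lt0n //.
by rewrite mlinX subrr.
Qed.

Lemma row_exact p n (c : kos 'rV[S]_p n) : (n <= m)%N -> kd zvar c = 0 ->
  exists b, c - kinj n (map_mx (mkill n) (kbot c)) = kd zvar b.
Proof.
move=> le_nm dc.
pose rho i (u : 'rV[S]_p) := map_mx (nquo i) u.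
have [| | |b Eb] := @kos_exact _ zvar 'rV[S]_p rho m _ _ _ n c le_nm dc.
- by move=> i x y; apply/rowP => k; rewrite !mxE linearB.
- by move=> i v lt_im; apply/rowP => k; rewrite !mxE nquoK.
- by move=> i j v lt_i lt_j ne; apply/rowP => k; rewrite !mxE nquoC.
exists b; rewrite -Eb; congr (_ - kinj n _).
move: (kbot c) => v {c dc b Eb}; elim: n v le_nm => [|n IHn] v lt_nm /=.
  by apply/rowP => k; rewrite mxE mkill0.
rewrite -IHn 1?ltnW //; apply/rowP => k.
by rewrite !mxE mkillS.
Qed.

Lemma row_exact_cst p (c : kos 'rV[S]_p m) : kd zvar c = 0 ->
  exists b, c - kinj m (map_mx mcst (kbot c)) = kd zvar b.
Proof.
move=> dc; have [b Eb] := row_exact (leqnn m) dc; exists b; rewrite -Eb.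
by congr (_ - kinj m _); apply/rowP => k; rewrite !mxE mkill_all.
Qed.

Lemma hcomp_mcst d p : hcomp d (mcst p) = if d == 0 then mcst p else 0.
Proof.
rewrite /mcst -[(_)%:MP]mulr1 -mpolyX0 mul_mpolyC linearZ /= /hcomp mlinX mdeg0 eq_sym.
by case: ifP => // _; rewrite scaler0.
Qed.

Definition kex V (g : grading V) (k r : int) : Prop :=
  forall c : kos V m, kd zvar c = 0 -> exists b, kpi g k r c = kd zvar b.

(** A free module has Koszul homology only in homological degree 0, where it is spanned by the basis
    elements in their degrees. *)
Lemma row_kex p (dl : 'I_p -> int) k r :
  k != 0 \/ (forall l, dl l < r) -> kex (rgrade dl) k r.
Proof.
move=> kr c dc; have [b Eb] := row_exact_cst dc.
exists (kpi (rgrade dl) (k + 1) (r - 1) b).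
rewrite -kpi_kd // (addrK 1 k) (subrK 1 r) -Eb kpiB kpi_kinj.
case: eqP kr => [_ [//|lt_r]|_ _]; rewrite ?subr0 //.
set v := map_mx _ _; have -> : rgrade dl r v = 0.
  apply/rowP => l; rewrite !mxE hcomp_mcst; case: eqP => // /eqP.
  by rewrite subr_eq0 gt_eqF.
by rewrite (raddf0 (@kinj _ _ _)) subr0.
Qed.

(** * Dimension shift along a map from a graded free module *)

Section Shift.
Variables (W : lmodType S) (gW : grading W) (N0 : W -> Prop) (q : nat).
Variables (dl : 'I_q -> int) (phi : {linear 'rV[S]_q -> W}).
Hypotheses (gN0 : gsub gW N0).
Hypothesis phi_pi : forall d u, phi (rgrade dl d u) = gW d (phi u).

Definition kerphi (u : 'rV[S]_q) : Prop := N0 (phi u).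
Definition imphi (w : W) : Prop := exists u, N0 (w - phi u).

Lemma imphi_phi u : imphi (phi u).
Proof. by exists u; rewrite subrr; apply: (submod0 gN0.1). Qed.

Lemma gsub_kerphi : gsub (rgrade dl) kerphi.
Proof.
have NS := gN0.1; split=> [|d u Nu]; last by rewrite /kerphi phi_pi; apply: gN0.2.
split=> [|a u v Nu Nv]; first by rewrite /kerphi raddf0; apply: submod0.
by rewrite /kerphi linearP; apply: submodD => //; apply: submodZ.
Qed.

Lemma kmap_phi_kd n (c : kos 'rV[S]_q n) :
  kmap phi (kd zvar c) = kd zvar (kmap phi c).
Proof.
symmetry; apply: kd_kmap => [x y|i v _]; [exact: raddfB | exact: linearZ].
Qed.

Lemma kpi_phi n k r (c : kos 'rV[S]_q n) :
  kpi gW k r (kmap phi c) = kmap phi (kpi (rgrade dl) k r c).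
Proof.
elim: n k c => [|n IHn] k c /=; last by apply: kosP; rewrite /= IHn.
by case: (k == 0); rewrite ?phi_pi // raddf0.
Qed.

Lemma kall_imphi n (c : kos 'rV[S]_q n) : kall imphi (kmap phi c).
Proof.
by apply/kall_kmap; apply: kall_sub (kallT c) => v _; apply: imphi_phi.
Qed.

Lemma imphi_lift n (a : kos W n) : kall imphi a ->
  exists a', kall N0 (a - kmap phi a').
Proof.
move=> Na; have [|a' _ Na'] := @kall_split _ _ _ imphi (fun=> True) N0 phi n a _ Na.
  by move=> v [u Nu]; exists u.
by exists a'.
Qed.

(** A cycle of the kernel bounds some [b] in the free module by [kex], and [phi b] is a cycle modulo
    [N0] one degree higher. If [a] bounds this cycle and [a'] lifts [a], then subtracting
    [kd zvar a'] moves the component of [b] into the kernel without changing its boundary. *)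
Lemma kvan_shift k r : kvan gW imphi N0 (k + 1) (r - 1) ->
  kex (rgrade dl) k r -> kvan (rgrade dl) kerphi (fun u => u = 0) k r.
Proof.
move=> vanW exF c Zc /kall_eq0 /exF [b Eb]; have NS := gN0.1.
have [|a Na Ea] := vanW _ (kall_imphi b).
  rewrite -kmap_phi_kd -Eb; apply/kall_kmap.
  exact: (kall_kpi _ _ gsub_kerphi).
have [a' Na'] := imphi_lift Na.
exists (kpi (rgrade dl) (k + 1) (r - 1) b - kd zvar a').
  apply: (iffLR (kall_kmap N0 phi _)).
  have -> : kmap phi (kpi (rgrade dl) (k + 1) (r - 1) b - kd zvar a') =
      kpi gW (k + 1) (r - 1) (kmap phi b) - kd zvar a + kd zvar (a - kmap phi a').
    rewrite (kmapB (raddfB phi)) kmap_phi_kd -kpi_phi [kd zvar (a - _)]linearB /=.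
    by rewrite addrA subrK.
  by apply: kallD => //; apply: kall_kd.
apply/kall_eq0; rewrite linearB /= kdd subr0 -kpi_kd // (addrK 1 k) (subrK 1 r).
by rewrite -Eb kpi_id subrr.
Qed.

(* The last step of the dimension shift from Koszul homology to the homology of
   [F ⊗ K], where [psi] is a differential of [F] and [v] lifts a cycle of degree
   [j]. *)
Lemma kvan_const q' (psi : {linear 'rV[S]_q' -> 'rV[S]_q}) (j : int) (v : 'rV[S]_q') :
  kvan gW imphi N0 1 (j - 1) ->
  (forall t, kerphi (psi t)) -> (forall u, kerphi u -> exists t, u = psi t) ->
  rgrade dl j (psi v) = psi v -> map_mx mcst (psi v) = 0 ->
  exists t : kos 'rV[S]_q' m, psi (v - kbot (kd zvar t)) = 0.
Proof.
move=> vanW kerpsi kerpsiP hpsi cpsi; have NS := gN0.1.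
have [w Ew] := row_exact_cst (kd_kinj zvar m (psi v)).
rewrite kbot_kinj cpsi raddf0 subr0 in Ew.
have [|a Na Ea] := vanW _ (kall_imphi w).
  rewrite -kmap_phi_kd -Ew kmap_kinj ?raddf0 //.
  by apply: kall_kinj => //; apply: kerpsi.
have [a' Na'] := imphi_lift Na.
pose w' := kpi (rgrade dl) 1 (j - 1) w - kd zvar a'.
have Zw' : kall kerphi w'.
  apply: (iffLR (kall_kmap N0 phi _)).
  have -> : kmap phi w' =
      kpi gW 1 (j - 1) (kmap phi w) - kd zvar a + kd zvar (a - kmap phi a').
    rewrite (kmapB (raddfB phi)) kmap_phi_kd -kpi_phi [kd zvar (a - _)]linearB /=.
    by rewrite addrA subrK.
  by apply: kallD => //; apply: kall_kd.
have [u|t _ /kall_eq0 /eqP] := @kall_split _ _ _ kerphi (fun=> True)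
    (fun u => u = 0) psi m w' _ Zw'.
  by move=> /kerpsiP [t ->]; exists t; rewrite ?subrr.
rewrite subr_eq0 => /eqP Et; exists t.
have -> : kbot (kd zvar t) = kbot (kd zvar t) by [].
rewrite linearB /= -kbot_kmap.
have -> : kmap psi (kd zvar t) = kd zvar (kmap psi t).
  by symmetry; apply: kd_kmap => [x y|i x _]; [exact: raddfB | exact: linearZ].
have -> : kd zvar (kmap psi t) = kinj m (psi v).
  rewrite -Et linearB /= kdd subr0 -kpi_kd // (subrK 1 j) subrr -Ew kpi_kinj eqxx.
  by rewrite hpsi.
by rewrite kbot_kinj subrr.
Qed.

End Shift.

Lemma kvan_eq (V : lmodType S) (g : grading V) (N N' N0 N0' : V -> Prop) k r :
  (forall v, N v <-> N' v) -> (forall v, N0 v <-> N0' v) ->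
  kvan g N N0 k r -> kvan g N' N0' k r.
Proof.
move=> NN NN0 van c Nc dc; have [||b Nb Eb] := van c.
- by apply: kall_sub Nc => v /NN.
- by apply: kall_sub dc => v /NN0.
by exists b; [apply: kall_sub Nb => v /NN | apply: kall_sub Eb => v /NN0].
Qed.

Lemma rgrade_mulmx q p (dl : 'I_q -> int) (dl' : 'I_p -> int)
    (D : 'M[S]_(q, p)) d u :
  (forall k l, zhomog (dl k - dl' l) (D k l)) ->
  rgrade dl' d (u *m D) = rgrade dl d u *m D.
Proof.
move=> hD; apply/rowP => l; rewrite !mxE raddf_sum; apply: eq_bigr => k _.
by rewrite mxE -(hcompM _ _ (hD k l)); congr hcomp; rewrite addrA subrK.
Qed.

Lemma mcst_mulmx q p (u : 'rV[S]_q) (D : 'M[S]_(q, p)) :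
  map_mx (mcoeff 0%MM) (u *m D) = map_mx (mcoeff 0%MM) u *m map_mx (mcoeff 0%MM) D.
Proof. exact: map_mxM. Qed.

(** * Betti numbers of a resolution from Koszul homology *)

Section Betti.
Variables (I : S^o -> Prop) (F : free_seq K m).
Hypotheses (gI : gsub sgrade I) (resF : graded_free_resolution I F).

Definition augmap (u : 'rV[S]_(rk F 0)) : S^o := (u *m aug F) 0 0.

Fact augmap_is_linear : linear augmap.
Proof. by move=> a u v; rewrite /augmap mulmxDl -scalemxAl !mxE. Qed.

HB.instance Definition _ := GRing.isLinear.Build S 'rV[S]_(rk F 0) S^o _ augmap
  augmap_is_linear.

Lemma augmap_pi d u : augmap (rgrade (deg F 0) d u) = sgrade d (augmap u).
Proof.
rewrite /augmap /= !mxE raddf_sum; apply: eq_bigr => k _.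
by rewrite mxE -(hcompM _ _ (aug_homog resF k)) subrK.
Qed.

Lemma imphi_augmap v : imphi I augmap v.
Proof.
have [u Iu] := aug_surj resF; exists (v *: u).
rewrite linearZ -[X in X - _]mulr1 -mulrBr -opprB mulrN.
by apply: (submodN gI.1); apply: (submodZ gI.1).
Qed.

Definition syz i : 'rV[S]_(rk F i) -> Prop :=
  if i is i'.+1 then fun u => u *m diff F i' = 0 else fun u => I (augmap u).

Lemma syzE i u : syz u <-> exists w, u = w *m diff F i.
Proof.
by case: i u => [|i] u; [exact: (exact_aug resF) | exact: (exact_diff resF)].
Qed.

Definition diffmap i : {linear 'rV[S]_(rk F i.+1) -> 'rV[S]_(rk F i)} :=
  mulmxr (diff F i).

Lemma diffmap_pi i d u :
  diffmap i (rgrade (deg F i.+1) d u) = rgrade (deg F i) d (diffmap i u).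
Proof. by rewrite /= [RHS](rgrade_mulmx _ _ (diff_homog resF (i := i))). Qed.

Lemma imphi_diffmap i w : imphi (fun u => u = 0) (diffmap i) w <-> syz w.
Proof.
rewrite syzE; split=> -[u Eu]; exists u.
  by apply/eqP; rewrite -subr_eq0; apply/eqP.
by rewrite Eu subrr.
Qed.

(** Each of [i + 1] shifts raises the homological degree by one at fixed internal degree. Positivity
    of [k] keeps away from degree 0, where free modules have homology. *)
Lemma kvan_syz i (k r : int) : 0 < k ->
  kvan sgrade (fun=> True) I (k + i.+1%:Z) (r - i.+1%:Z) ->
  kvan (rgrade (deg F i)) (@syz i) (fun u => u = 0) k r.
Proof.
elim: i k r => [|i IHi] k r k_gt0 van.
  apply: (kvan_shift gI augmap_pi); last by apply: row_kex; left; rewrite gt_eqF.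
  apply: kvan_eq van => // v.
  by split=> // _; apply: imphi_augmap.
apply: (kvan_shift (@gsub0 _ _ _ _) (@diffmap_pi i)).
  apply: (kvan_eq (N := @syz i) (N0 := fun u => u = 0)) => [w|//|].
    by rewrite imphi_diffmap.
  have kE : k + 1 + i.+1%:Z = k + i.+2%:Z by lia.
  have rE : r - 1 - i.+1%:Z = r - i.+2%:Z by lia.
  by apply: IHi; rewrite ?kE ?rE //; lia.
by apply: row_kex; left; rewrite gt_eqF.
Qed.

Section Degree.
Variables (i : nat) (j : int).

Definition lift_row q (v : 'rV[K]_q) : 'rV[S]_q := map_mx (@mpolyC m K) v.

Lemma lift_rowK q (v : 'rV[K]_q) : map_mx (mcoeff 0%MM) (lift_row v) = v.
Proof. by apply/rowP => k; rewrite !mxE mpolyCK. Qed.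

Lemma rgrade_lift v : v *m degK F i j = v ->
  rgrade (deg F i) j (lift_row v) = lift_row v.
Proof.
move=> vj; apply/rowP => k; rewrite !mxE.
have -> : ((v 0 k)%:MP : S) = mcst (v 0 k)%:MP by rewrite /mcst mpolyCK.
rewrite hcomp_mcst subr_eq0 eq_sym; case: eqP => // nkj.
rewrite -vj mul_mx_diag !mxE (introF eqP nkj) mulr0.
by rewrite /mcst mpolyCK mpolyC0.
Qed.

Lemma degK_idem : degK F i j *m degK F i j = degK F i j.
Proof.
rewrite /degK mulmx_diag; congr diag_mx; apply/rowP => k; rewrite !mxE.
by case: eqP; rewrite ?mulr1 ?mulr0.
Qed.

Lemma degK_diffK : degK F i.+1 j *m diffK F i = diffK F i *m degK F i j.
Proof.
rewrite mul_diag_mx mul_mx_diag; apply/matrixP => k l; rewrite !mxE.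
have /zhomogP hD := diff_homog resF k l.
have [->|ne] := eqVneq (deg F i.+1 k) (deg F i l); first by rewrite mulrC.
suff -> : (diff F i k l)@_0 = 0 by rewrite mulr0 mul0r.
rewrite -hD mcoeff_hcomp mdeg0; case: eqP => // /eqP.
by rewrite eq_sym subr_eq0 (negbTE ne).
Qed.

Lemma kbot_kd_cst p (t : kos 'rV[S]_p m) :
  map_mx (mcoeff 0%MM) (kbot (kd zvar t)) = 0.
Proof.
suff cst0 k : (kbot (kd zvar t) 0 k)@_0%MM = 0 by apply/rowP => k; rewrite !mxE cst0.
have := @kbot_kd _ zvar 'rV[S]_p (fun=> True)
  (fun u => (u 0 k)@_0%MM = 0) m t; apply; last exact: kallT.
  split=> [|a u v Pu Pv]; first by rewrite mxE mcoeff0.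
  by rewrite !mxE mcoeffD rmorphM /= Pu Pv mulr0 addr0.
move=> l v lt_lm _; rewrite mxE -[l]/(val (Ordinal lt_lm)) zvarE rmorphM /=.
by rewrite mcoeffX mnm1_eq0 mul0r.
Qed.

Lemma map_mcst0 p (u : 'rV[S]_p) : map_mx (mcoeff 0%MM) u = 0 -> map_mx mcst u = 0.
Proof.
by move=> /rowP u0; apply/rowP => k; have := u0 k; rewrite !mxE /mcst => ->; rewrite mpolyC0.
Qed.

Lemma syz_const (v : 'rV[K]_(rk F i)) (t : kos 'rV[S]_(rk F i) m) :
  syz (lift_row v - kbot (kd zvar t)) ->
  exists y, v = map_mx (mcoeff 0%MM) (y *m diff F i).
Proof.
move=> /syzE [y Ey]; exists y.
by rewrite -Ey map_mxB lift_rowK kbot_kd_cst subr0.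
Qed.
End Degree.

(** Vanishing lets the constant lift of [v] be corrected by an element of the irrelevant ideal times
    [F_i] until it is a syzygy, hence an image of the next differential; the constant terms do not
    change. Index 0 uses the augmentation, index 1 the shift from [S/I], and larger indices the
    shift from a syzygy module. *)
Lemma cycle_const i j (v : 'rV[K]_(rk F i)) :
  kvan sgrade (fun=> True) I i%:Z (j - i%:Z) ->
  v *m degK F i j = v -> (v <= cycK F i)%MS ->
  exists y, v = map_mx (mcoeff 0%MM) (y *m diff F i).
Proof.
have syz_im k (t : 'rV_(rk F k.+1)) : syz (diffmap k t) by apply/syzE; exists t.
have cst_im k (u : 'rV[K]_(rk F k.+1)) : (u <= cycK F k.+1)%MS ->
    map_mx mcst (diffmap k (lift_row u)) = 0.
  by move=> /sub_kermxP u0; apply: map_mcst0; rewrite mcst_mulmx lift_rowK.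
case: i v => [|[|i]] v van vj vcyc; have hv := rgrade_lift vj.
- pose a : S^o := augmap (lift_row v).
  have ja : sgrade j a = a by rewrite -augmap_pi hv.
  have [|b _ Ib] := van (kinj m a) (kallT _).
    by rewrite kd_kinj; apply: (kall0 gI.1).
  have [|b' Ib'] := @imphi_lift _ I _ augmap m b.
    by apply: kall_sub (kallT b) => w _; apply: imphi_augmap.
  apply: (@syz_const 0 v b').
  rewrite /syz linearB /= -kbot_kmap (kmap_phi_kd augmap).
  have := kallD gI.1 Ib (kall_kd zvar gI.1 Ib').
  rewrite subr0 kpi_kinj eqxx ja [kd zvar (b - _)]linearB /= addrA subrK.
  by move=> /kall_kbot; rewrite kbotB kbot_kinj.
- have [||//|//||t Et] := @kvan_const _ _ I _ (deg F 0) augmap gI augmap_pi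
    _ (diffmap 0) j (lift_row v).
  + by apply: kvan_eq van => // w; split=> // _; apply: imphi_augmap.
  + exact: (syz_im 0).
  + by move=> u; move/(syzE (i := 0)).
  + by rewrite -diffmap_pi hv.
  + exact: cst_im.
  by apply: (@syz_const 1 v t).
have [||//|//||t Et] := @kvan_const _ _ (fun u => u = 0) _ (deg F i.+1)
    (diffmap i) (@gsub0 _ _ _ _) (@diffmap_pi i) _ (diffmap i.+1) j (lift_row v).
+ apply: (kvan_eq (N := @syz i) (N0 := fun u => u = 0)) => [w|//|].
    by rewrite imphi_diffmap.
  apply: kvan_syz => //; move: van; congr kvan; lia.
+ exact: (syz_im i.+1).
+ by move=> u; move/(syzE (i := i.+1)).
+ by rewrite -diffmap_pi hv.
+ exact: cst_im.
by apply: (@syz_const i.+2 v t).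
Qed.

Lemma dim_homologyK_eq0 i j :
  kvan sgrade (fun=> True) I i%:Z (j - i%:Z) -> dim_homologyK F i j = 0%N.
Proof.
move=> van; apply/eqP; rewrite subn_eq0; apply: mxrankS.
apply/row_subP => k; set v := row k _.
have : (v <= degK F i j :&: cycK F i)%MS by apply: row_sub.
rewrite sub_capmx => /andP [/submxP [w Ew] vcyc].
have vj : v *m degK F i j = v by rewrite Ew -mulmxA degK_idem.
have [y Ey] := cycle_const van vj vcyc.
by rewrite -vj Ey mcst_mulmx -mulmxA -degK_diffK submxMl.
Qed.

(** Provides a nonzero Betti number. Otherwise the constant parts of the first differential would
    span everything, every row would be a syzygy plus a row without constant terms, and the
    augmentation could not reach 1 modulo [I]. *)
Lemma dim_homologyK0_neq0 : (forall p, I p -> p@_0%MM = 0) ->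
  exists j, dim_homologyK F 0 j <> 0%N.
Proof.
move=> I0; apply: NNPP => noj.
have degE j : (degK F 0 j <= diffK F 0)%MS.
  have sub_deg : (degK F 1 j *m diffK F 0 <= degK F 0 j :&: cycK F 0)%MS.
    by rewrite sub_capmx submx1 degK_diffK submxMl.
  have : (degK F 0 j :&: cycK F 0 <= degK F 1 j *m diffK F 0)%MS.
    rewrite -(geq_leqif (mxrank_leqif_sup sub_deg)) -subn_eq0.
    by apply/eqP; apply: NNPP => nz; apply: noj; exists j.
  move=> /submx_trans /(_ (submxMl _ _)); apply: submx_trans.
  by rewrite sub_capmx submx1 submx_refl.
have diffE (v : 'rV[K]_(rk F 0)) : (v <= diffK F 0)%MS.
  apply: (submx_trans (submx1 v)); apply/row_subP => k; rewrite row1.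
  apply: submx_trans (degE (deg F 0 k)).
  rewrite (_ : delta_mx 0 k = delta_mx 0 k *m degK F 0 (deg F 0 k)) ?submxMl //.
  apply/rowP => l; rewrite mul_mx_diag !mxE /=.
  by case: (l =P k) => [->|_]; rewrite ?eqxx ?mulr1 ?mul0r.
have aug0 u : (augmap u)@_0%MM = 0.
  have /submxP [w Ew] := diffE (map_mx (mcoeff 0%MM) u).
  pose u' := u - lift_row w *m diff F 0.
  have u'0 k : (u' 0 k)@_0%MM = 0.
    have : map_mx (mcoeff 0%MM) u' = 0.
      by rewrite map_mxB mcst_mulmx lift_rowK Ew subrr.
    by move=> /rowP /(_ k); rewrite !mxE.
  rewrite -[u](subrK (lift_row w *m diff F 0)) linearD mcoeffD /=.
  rewrite [X in _ + X]I0 ?addr0; last first.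
    by apply/(syzE (i := 0)); exists (lift_row w).
  rewrite -/u' /augmap mxE raddf_sum big1 //= => k _.
  by rewrite rmorphM /= u'0 mul0r.
have [u /I0] := aug_surj resF; rewrite mcoeffB -[(u *m aug F) 0 0]/(augmap u) aug0.
by rewrite mcoeff1 eqxx sub0r => /eqP; rewrite oppr_eq0 oner_eq0.
Qed.

End Betti.

Definition in_irrelevant (I : S -> Prop) : Prop := forall p, I p -> p@_0%MM = 0.

Lemma int_max (P : int -> Prop) (b : int) :
  (exists j, P j) -> (forall j, P j -> j <= b) ->
  exists2 r, P r & forall j, P j -> j <= r.
Proof.
move=> [j0 Pj0] Pb; have [d Ed] : exists d : nat, b - j0 <= d%:Z.
  by exists `|b - j0|%N; lia.
elim: d j0 Pj0 Ed => [|d IHd] j0 Pj0 Ed.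
  by exists j0 => // j /Pb; lia.
have [[j [Pj lt_j]]|noj] := classic (exists j, P j /\ j0 < j).
  by apply: (IHd j) => //; lia.
exists j0 => // j Pj; rewrite leNgt; apply/negP => lt_j.
by apply: noj; exists j.
Qed.

(** The chosen value of [reg_quot] is meaningful only once a maximum exists; it does, because the
    degrees in question are bounded and there is at least one. *)
Lemma reg_quot_le_of_resolution (I : S^o -> Prop) (rho : int) :
  gsub sgrade I -> in_irrelevant I -> greg sgrade I rho ->
  (exists F, graded_free_resolution I F) -> reg_quot I <= rho.
Proof.
move=> gI properI regI exF.
have resF : graded_free_resolution I (resolution I).
  exact: (epsilon_spec (inhabits (empty_free_seq K m)) _ exF).
have betti_le i j : betti I i (i%:Z + j) <> 0%N -> j <= rho.
  move=> nz; rewrite leNgt; apply/negP => lt_j; apply: nz.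
  apply: (dim_homologyK_eq0 gI resF); apply: regI.
  by rewrite addrC addKr.
have [|j [i nz]|r [i nz] r_max] := @int_max
    (fun j => exists i, betti I i (i%:Z + j) <> 0%N) rho.
- have [j nz] := dim_homologyK0_neq0 resF properI.
  by exists j, 0; rewrite add0r.
- exact: betti_le nz.
have [[i' nz'] _] : is_reg I (reg_quot I).
  apply: (epsilon_spec (inhabits 0) (is_reg I)).
  exists r; split; first by exists i.
  by move=> i' j nz'; apply: r_max; exists i'.
exact: betti_le nz'.
Qed.

End FreeModules.

Arguments rgrade {K m p} dl.

(** * Existence of resolutions *)

Lemma fin_choice (n : nat) (T : Type) (Q : 'I_n -> T -> Prop) :
  (forall i, exists x, Q i x) -> exists f : 'I_n -> T, forall i, Q i (f i).
Proof.
move=> exQ; exists (fun i => proj1_sig (constructive_indefinite_description _ (exQ i))).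
by move=> i; case: constructive_indefinite_description.
Qed.

Lemma row_span_fin (K : fieldType) (M : nat) (P : 'rV[K]_M -> Prop) :
  exists n (A : 'M[K]_(n, M)), (forall i, P (row i A)) /\
    forall v, P v -> (v <= A)%MS.
Proof.
suff ext d n (A : 'M[K]_(n, M)) : (M <= d + \rank A)%N -> (forall i, P (row i A)) ->
    exists n (A : 'M[K]_(n, M)), (forall i, P (row i A)) /\
      forall v, P v -> (v <= A)%MS.
  by apply: (ext M 0%N 0) => [|[]//]; rewrite leq_addr.
elim: d n A => [|d IHd] n A le_M PA.
  exists n, A; split=> // v _; apply: submx_full.
  by rewrite /row_full eqn_leq rank_leq_col.
have [[v [Pv nvA]]|noV] := classic (exists v, P v /\ ~ (v <= A)%MS); last first.
  exists n, A; split=> // v Pv; apply: NNPP => nvA.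
  by apply: noV; exists v.
apply: (IHd _ (col_mx v A)); last first.
  move=> i; rewrite -[i]splitK; case: (split i) => j /=.
    by rewrite rowKu (_ : row j v = v) //; apply/rowP => k; rewrite mxE ord1.
  by rewrite rowKd.
have lt_A : (A < col_mx v A)%MS.
  by rewrite ltmxE col_mx_sub (submx_refl A) andbT -addsmxE addsmxSr; apply/negP.
by apply: leq_trans le_M _; rewrite addSnnS leq_add2l; apply: rank_ltmx.
Qed.

Section Resolution.
Variables (K : fieldType) (m : nat).
Local Notation S := {mpoly K[m]}.
Local Notation zvar := (zvar K m).

Section Generation.
Variables (p : nat) (dl : 'I_p -> int) (N : 'rV[S]_p -> Prop) (s : int).
Hypotheses (gN : gsub (rgrade dl) N).
Hypothesis van0 : forall r, s < r -> kvan (rgrade dl) N (fun u => u = 0) 0 r.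

Lemma row_sum_rpi (u : 'rV[S]_p) :
  exists L : nat, u = \sum_(t < L + L) rgrade dl (t%:Z - L%:Z) u.
Proof.
(* The degrees [t - L] run through the interval from [-L] to [L - 1], which contains every degree
   occurring in [u]. *)
pose L := \max_(k < p) (`|dl k|%N + msize (u 0%R k))%N; exists L.
apply/rowP => k; rewrite summxE; apply/mpolyP => mu; rewrite raddf_sum /=.
under eq_bigr => t _ do rewrite mxE mcoeff_hcomp.
have le_L : (`|dl k|%N + msize (u 0%R k) <= L)%N by apply: (leq_bigmax k).
have [mu_supp|/memN_msupp_eq0 ->] := boolP (mu \in msupp (u 0 k)); last first.
  by rewrite big1 // => t _; case: ifP.
have lt_mu := msize_mdeg_lt mu_supp.
have lt_t : (`|((mdeg mu)%:Z + dl k + L%:Z)%R| < L + L)%N by lia.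
rewrite (bigD1 (Ordinal lt_t)) //= ifT ?big1 ?addr0 //.
  move=> t /eqP ne; case: eqP => // Et; case: ne; apply/val_inj => /=; lia.
apply/eqP; lia.
Qed.

(** Homogeneous rows of degree at most [s] have entries of bounded degree, so [enc] embeds them into
    a space of finite dimension over [K], where finitely many such rows from [N] span all of
    them. *)
Lemma fin_gen_low : exists q (dl' : 'I_q -> int) (D : 'M[S]_(q, p)),
  [/\ forall k, dl' k <= s, forall k, N (row k D),
      forall k l, zhomog (dl' k - dl l) (D k l) &
      forall r u, r <= s -> N u -> rgrade dl r u = u -> exists w, u = w *m D].
Proof.
(* The entry [k] of such a row has degree at most [s - dl k], which is below [B]. *)
pose B := (`|s|%N + \max_(k < p) `|dl k|%N).+1.
pose T := ('I_p * 'X_{1..m < B})%type.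
pose enc (u : 'rV[S]_p) : 'rV[K]_#|{: T}| :=
  \row_(t < #|{: T}|) (u 0 (enum_val t : T).1)@_(bmnm (enum_val t : T).2).
pose low (u : 'rV[S]_p) := forall k mu, (B <= mdeg mu)%N -> (u 0 k)@_mu = 0.
have lowhom r u : r <= s -> rgrade dl r u = u -> low u.
  move=> le_r <- k mu le_B; rewrite mxE mcoeff_hcomp; case: eqP => // E.
  have le_k : (`|dl k|%N <= \max_(k < p) `|dl k|%N)%N by apply: (leq_bigmax k).
  exfalso; lia.
have enc_inj u v : low u -> low v -> enc u = enc v -> u = v.
  move=> lu lv /rowP Euv; apply/rowP => k; apply/mpolyP => mu.
  case: (ltnP (mdeg mu) B) => [lt_mu|le_mu]; last by rewrite lu ?lv.
  have := Euv (enum_rank ((k, BMultinom lt_mu) : T)).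
  by rewrite !mxE enum_rankK.
pose P (x : 'rV[K]_#|{: T}|) :=
  exists ru : int * 'rV[S]_p,
    [/\ ru.1 <= s, N ru.2, rgrade dl ru.1 ru.2 = ru.2 & x = enc ru.2].
have [n [A [PA spanA]]] := row_span_fin P.
have [f Pf] := fin_choice PA.
pose D : 'M[S]_(n, p) := \matrix_(i, l) (f i).2 0 l.
have rowD i : row i D = (f i).2 by apply/rowP => l; rewrite !mxE.
exists n, (fun i => (f i).1), D; split.
- by move=> k; case: (Pf k).
- by move=> k; rewrite rowD; case: (Pf k).
- move=> k l; rewrite mxE; case: (Pf k) => _ _ <- _.
  by rewrite mxE; apply: zhomog_hcomp.
move=> r u le_r Nu hu.
have /spanA /submxP [y Ey] : P (enc u) by exists (r, u).
exists (lift_row m y); apply: enc_inj.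
- exact: lowhom hu.
- move=> k mu le_mu; rewrite mxE raddf_sum big1 //= => i _.
  case: (Pf i) => le_i _ hi _; rewrite !mxE mul_mpolyC mcoeffZ.
  by rewrite (lowhom _ _ le_i hi) ?mulr0.
rewrite Ey; apply/rowP => t; rewrite !mxE raddf_sum; apply: eq_bigr => i _.
case: (Pf i) => _ _ _ /rowP /(_ t); rewrite !mxE => ->.
by rewrite /= mul_mpolyC mcoeffZ.
Qed.

Lemma kall_hom (V : lmodType S) (g : grading V) n k r (c : kos V n) :
  kall (fun v => g r v = v) (kpi g k r c).
Proof.
elim: n k c => [|n IHn] k c /=; last by split; apply: IHn.
by case: (k == 0); rewrite ?gpi_id ?gpi0.
Qed.

(* The vanishing of [N ⊗ K] in degrees above [s] bounds the degrees of generators,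
   so no appeal to Hilbert's basis theorem is needed. *)
Lemma fin_gen : exists q (dl' : 'I_q -> int) (D : 'M[S]_(q, p)),
  [/\ forall k, dl' k <= s, forall k l, zhomog (dl' k - dl l) (D k l) &
      forall u, N u <-> exists w, u = w *m D].
Proof.
have [q [dl' [D [dl_le ND hD low]]]] := fin_gen_low.
exists q, dl', D; split=> // u; split; last first.
  move=> [w ->]; rewrite mulmx_sum_row; apply: (submod_sum gN.1) => k _.
  by apply: (submodZ gN.1).
pose im (u : 'rV[S]_p) := exists w, u = w *m D.
have imS : submod im.
  split; first by exists 0; rewrite mul0mx.
  move=> a _ _ [w ->] [w' ->]; exists (a *: w + w').
  by rewrite mulmxDl scalemxAl.
(* Induction on the excess of the degree over [s]: by vanishing, an element of degree [r > s] is a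
   combination of variables with elements of [N] of degree [r - 1]. *)
have hom_im n r v : r <= s + n%:Z -> N v -> rgrade dl r v = v -> im v.
  elim: n r v => [|n IHn] r v le_r Nv hv; first by apply: (low r); rewrite // -[s]addr0.
  have [le_rs|lt_sr] := leP r s; first exact: (low r).
  have [||b Nb /kall_eq0 /eqP] := van0 lt_sr (c := kinj m v).
  - exact: kall_kinj gN.1 Nv.
  - by rewrite kd_kinj; apply/kall_eq0.
  rewrite kpi_kinj eqxx hv subr_eq0 => /eqP Eb.
  have {Eb} -> : v = kbot (kd zvar (kpi (rgrade dl) 1 (r - 1) b)).
    rewrite -kpi_kd // subrr (subrK 1 r) -Eb kpi_kinj eqxx hv.
    by rewrite kbot_kinj.
  apply: (@kbot_kd _ zvar _ (fun v => N v /\ rgrade dl (r - 1) v = v)) => //.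
    move=> i x _ [Nx hx]; apply: (submodZ imS); apply: (IHn (r - 1)) => //; lia.
  by apply: kall_and; [apply: kall_kpi | apply: kall_hom].
move=> Nu; have [L ->] := row_sum_rpi u.
apply: (submod_sum imS) => t _.
apply: (hom_im `|(t%:Z - L%:Z - s)%R|%N (t%:Z - L%:Z)).
- lia.
- exact: gN.2.
- by rewrite gpi_id.
Qed.

End Generation.

(** The state of the iterated construction: [sy_van] is what [fin_gen] needs to bound generators.
    The bound rises by one at each step, since the shift trades [(k, r)] for [(k + 1, r - 1)]. *)
Record syzygy := Syzygy {
  sy_rk : nat;
  sy_deg : 'I_sy_rk -> int;
  sy_mod : 'rV[S]_sy_rk -> Prop;
  sy_bound : int;
  sy_gsub : gsub (rgrade sy_deg) sy_mod;
  sy_deg_le : forall k, sy_deg k <= sy_bound;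
  sy_van : forall k r, sy_bound < r ->
    kvan (rgrade sy_deg) sy_mod (fun u => u = 0) k r
}.

Definition syz_step (T T' : syzygy) (D : 'M[S]_(sy_rk T', sy_rk T)) : Prop :=
  [/\ forall k l, zhomog (sy_deg k - sy_deg l) (D k l),
      forall u, sy_mod u <-> exists w, u = w *m D &
      forall u, sy_mod u <-> u *m D = 0].

Lemma syz_step_ex T : exists T' (D : 'M[S]_(sy_rk T', sy_rk T)), syz_step D.
Proof.
case: T => p dl N s gN dl_le van.
have [q [dl' [D [dl'_le hD imD]]]] := fin_gen gN (van 0).
pose phi : {linear 'rV[S]_q -> 'rV[S]_p} := mulmxr D.
have phi_pi d u : phi (rgrade dl' d u) = rgrade dl d (phi u).
  by rewrite /= [RHS](rgrade_mulmx _ _ hD).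
pose N' : 'rV[S]_q -> Prop := fun u => u *m D = 0.
have gN' : gsub (rgrade dl') N' by apply: (gsub_kerphi (@gsub0 _ _ _ (rgrade dl)) phi_pi).
have dl'_le1 k : dl' k <= s + 1 by apply: le_trans (dl'_le k) _; rewrite lerDl.
have van' k r : s + 1 < r -> kvan (rgrade dl') N' (fun u => u = 0) k r.
  move=> lt_r; apply: (kvan_shift (@gsub0 _ _ _ (rgrade dl)) phi_pi).
    apply: (kvan_eq (N := N) (N0 := fun u => u = 0)) => [w|//|].
      rewrite imD; split=> -[u Eu]; exists u; first by rewrite Eu subrr.
      by apply/eqP; rewrite -subr_eq0; apply/eqP.
    by apply: van; lia.
  apply: row_kex; right => l; apply: le_lt_trans lt_r; exact: dl'_le1.
by exists (Syzygy gN' dl'_le1 van'), D; split.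
Qed.

Definition syz_next T : syzygy :=
  proj1_sig (constructive_indefinite_description _ (syz_step_ex T)).

Definition syz_mx T : 'M[S]_(sy_rk (syz_next T), sy_rk T) :=
  proj1_sig (constructive_indefinite_description _
    (proj2_sig (constructive_indefinite_description _ (syz_step_ex T)))).

Lemma syz_mxP T : syz_step (syz_mx T).
Proof. exact: (proj2_sig (constructive_indefinite_description _ _)). Qed.

Definition syz_res (T : syzygy) (a : 'cV[S]_(sy_rk T)) : free_seq K m :=
  @FreeSeq K m (fun i => sy_rk (iter i syz_next T))
    (fun i => @sy_deg (iter i syz_next T))
    (fun i => syz_mx (iter i syz_next T)) a.

Theorem greg_resolution (I : S^o -> Prop) (rho : int) :
  gsub (sgrade K m) I -> 0 <= rho -> greg (sgrade K m) I rho ->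
  exists F, graded_free_resolution I F.
Proof.
move=> gI rho_ge0 regI.
pose phi0 (u : 'rV[S]_1) : S^o := u 0 0.
have phi0_lin : linear phi0 by move=> a u v; rewrite /phi0 !mxE.
pose phi : {linear 'rV[S]_1 -> S^o} :=
  HB.pack phi0 (GRing.isLinear.Build S 'rV[S]_1 S^o _ phi0 phi0_lin).
pose dl : 'I_1 -> int := fun=> 0.
have phi_pi d u : phi (rgrade dl d u) = sgrade K m d (phi u).
  by rewrite /= /phi0 mxE subr0.
have gN := gsub_kerphi gI phi_pi.
have dl_le k : dl k <= rho + 1 by rewrite /dl; lia.
have van k r : rho + 1 < r -> kvan (rgrade dl) (kerphi I phi) (fun u => u = 0) k r.
  move=> lt_r; apply: (kvan_shift gI phi_pi); last first.
    by apply: row_kex; right => l; rewrite /dl; lia.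
  apply: (kvan_eq (N := fun=> True) (N0 := I)) => [w|//|]; last by apply: regI; lia.
  split=> // _; exists (const_mx w); rewrite /= /phi0 mxE subrr.
  exact: (submod0 gI.1).
pose T := Syzygy gN dl_le van.
exists (@syz_res T 1); split => /=.
- move=> k; rewrite !ord1 mxE eqxx /zhomog /dl.
  by rewrite dhomog1.
- by move=> i; case: (syz_mxP (iter i syz_next T)).
- by exists 1; rewrite mulmx1 mxE eqxx subrr; apply: (submod0 gI.1).
- by move=> u; rewrite mulmx1; case: (syz_mxP T) => _ + _; apply.
move=> i u; case: (syz_mxP (iter i syz_next T)) => _ _ <-.
by case: (syz_mxP (iter i.+1 syz_next T)) => _ + _; apply.
Qed.

End Resolution.

Theorem reg_quot_le (K : fieldType) (m : nat) (I : {mpoly K[m]}^o -> Prop)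
    (rho : int) :
  gsub (sgrade K m) I -> in_irrelevant I -> 0 <= rho -> greg (sgrade K m) I rho ->
  reg_quot I <= rho.
Proof.
move=> gI properI rho_ge0 regI; apply: reg_quot_le_of_resolution => //.
exact: greg_resolution regI.
Qed.

(** * Ideals generated by variables and binomials *)

Section IdealGen.
Variables (K : fieldType) (m : nat).
Local Notation S := {mpoly K[m]}.
Implicit Types A : S -> Prop.

Lemma ideal_gen_mem A c a : A a -> ideal_gen A (c * a).
Proof.
move=> Aa; exists [:: (c, a)]; split=> [q|]; last by rewrite big_seq1.
by rewrite inE => /eqP ->.
Qed.

Lemma ideal_gen_in A a : A a -> ideal_gen A a.
Proof. by rewrite -{2}[a]mul1r; apply: ideal_gen_mem. Qed.

Lemma ideal_genD A p q : ideal_gen A p -> ideal_gen A q -> ideal_gen A (p + q).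
Proof.
move=> [s [As ->]] [t [At ->]]; exists (s ++ t); rewrite big_cat; split=> // x.
by rewrite mem_cat => /orP [/As|/At].
Qed.

Lemma ideal_gen_ind A (P : S -> Prop) :
  P 0 -> (forall p q, P p -> P q -> P (p + q)) -> (forall c a, A a -> P (c * a)) ->
  forall p, ideal_gen A p -> P p.
Proof.
move=> P0 PD PA p [s [As ->]]; elim: s As => [|x s IHs] As; first by rewrite big_nil.
rewrite big_cons; apply: PD; first by apply/PA/As/mem_head.
by apply: IHs => y ys; apply: As; rewrite inE ys orbT.
Qed.

Lemma submod_ideal_gen A : submod (ideal_gen A : S^o -> Prop).
Proof.
split; first by exists [::]; rewrite big_nil.
move=> a u v Au; apply: ideal_genD.
elim/ideal_gen_ind: u / Au => [|p q IHp IHq|c b Ab].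
- by exists [::]; rewrite scaler0 big_nil.
- by rewrite scalerDr; apply: ideal_genD.
have -> : a *: (c * b : S^o) = (a * c) * b by exact: mulrA.
exact: ideal_gen_mem.
Qed.

Lemma ideal_gen_sub A (P : S -> Prop) : submod (P : S^o -> Prop) ->
  (forall a, A a -> P a) -> forall p, ideal_gen A p -> P p.
Proof.
move=> PS AP; apply: ideal_gen_ind; first exact: (submod0 PS).
  by move=> p q; apply: (submodD PS).
by move=> c a /AP; apply: (submodZ PS).
Qed.

Lemma gsub_ideal_gen A : (forall a, A a -> exists d, zhomog d a) ->
  gsub (sgrade K m) (ideal_gen A).
Proof.
move=> hA; split; first exact: submod_ideal_gen.
move=> d v; elim/ideal_gen_ind => [|p q IHp IHq|c a Aa] /=.
- by rewrite raddf0; apply: (submod0 (submod_ideal_gen A)).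
- by rewrite raddfD; apply: ideal_genD.
have [e he] := hA a Aa; rewrite -[d](subrK e) hcompM //.
exact: ideal_gen_mem.
Qed.

(* [q] does not involve the variable [z]: dividing by ['X_z] with remainder is
   linear over [q]. *)
Definition zfree (z : 'I_m) (q : S) : Prop :=
  forall p, mquo z (q * p) = q * mquo z p.

Lemma zfreeX z z' : z != z' -> zfree z 'X_z'.
Proof. by move=> ne p; rewrite mquoM. Qed.

Lemma zfreeB z p q : zfree z p -> zfree z q -> zfree z (p - q).
Proof. by move=> zp zq r; rewrite !mulrBl raddfB /= zp zq. Qed.

Lemma zfreeM z p q : zfree z p -> zfree z q -> zfree z (p * q).
Proof. by move=> zp zq r; rewrite -!mulrA zp zq. Qed.

(** Applying [mquo z] to a combination of the generators gives a combination of the same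
    generators. *)
Lemma ideal_gen_zfree A z : (forall a, A a -> zfree z a) ->
  forall p, ideal_gen A ('X_z * p) -> ideal_gen A p.
Proof.
move=> zA p; rewrite -{2}[p](mquoK z).
elim/ideal_gen_ind => [|q r IHq IHr|c a Aa].
- by rewrite raddf0; apply: (submod0 (submod_ideal_gen A)).
- by rewrite raddfD; apply: ideal_genD.
by rewrite mulrC zA // mulrC; apply: ideal_gen_mem.
Qed.

(** The substitution of 0 for ['X_z]. *)
Definition mzero (z : 'I_m) (p : S) : S := p - 'X_z * mquo z p.

Lemma mzeroD z p q : mzero z (p + q) = mzero z p + mzero z q.
Proof. by rewrite /mzero raddfD /= mulrDr opprD addrACA. Qed.

Lemma mzeroB z p q : mzero z (p - q) = mzero z p - mzero z q.
Proof. by rewrite /mzero raddfB /= mulrBr !opprD addrACA. Qed.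

Lemma mzero0 z : mzero z 0 = 0.
Proof. by rewrite /mzero raddf0 mulr0 subr0. Qed.

Lemma mzeroX z p : mzero z ('X_z * p) = 0.
Proof. by rewrite /mzero mquoK subrr. Qed.

Lemma mzero_zfree z q p : zfree z q -> mzero z (q * p) = q * mzero z p.
Proof. by move=> zq; rewrite /mzero zq mulrBr mulrCA. Qed.

End IdealGen.

(** Confined to [U], since [e] still contains the edges at vertices deleted earlier. *)
Definition gcomp (T : finType) (U : {set T}) (e : rel T) (v : T) : rel T :=
  fun i j => e i j || [&& i != j, i \in U, j \in U, e v i & e v j].

Section BinomialIdeals.
Variables (K : fieldType) (n : nat).
Local Notation S := {mpoly K[n + n]}.
Local Notation x i := (varx K i).
Local Notation y i := (vary K i).
Local Notation ideal := (fun A : S -> Prop => ideal_gen A : S^o -> Prop).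

Definition vertex (z : 'I_(n + n)) : 'I_n :=
  match split z with inl i => i | inr i => i end.

Lemma vertexl i : vertex (lshift n i) = i.
Proof. by rewrite /vertex (unsplitK (inl i)). Qed.

Lemma vertexr i : vertex (rshift n i) = i.
Proof. by rewrite /vertex (unsplitK (inr i)). Qed.

Lemma vertex_cases z : z = lshift n (vertex z) \/ z = rshift n (vertex z).
Proof. by rewrite /vertex -{1 3}[z]splitK; case: (split z) => i; [left|right]. Qed.

Definition bin (i j : 'I_n) : S := x i * y j - x j * y i.

Definition gens (Z : {set 'I_(n + n)}) (r : rel 'I_n) (f : S) : Prop :=
  (exists2 z, z \in Z & f = 'X_z) \/ (exists i j, r i j /\ f = bin i j).

Definition videal Z r : S^o -> Prop := ideal_gen (gens Z r).

Lemma submod_videal Z r : submod (videal Z r).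
Proof. exact: submod_ideal_gen. Qed.

Lemma videalX (Z : {set 'I_(n + n)}) r z c : z \in Z -> videal Z r (c * 'X_z).
Proof. by move=> zZ; apply: ideal_gen_mem; left; exists z. Qed.

Lemma videalB Z (r : rel 'I_n) i j c : r i j -> videal Z r (c * bin i j).
Proof. by move=> rij; apply: ideal_gen_mem; right; exists i, j. Qed.

Lemma bin_zfree z i j : vertex z != i -> vertex z != j -> zfree z (bin i j).
Proof.
have freel k : vertex z != k -> zfree z (x k).
  by move=> ne; apply: zfreeX; apply: contraNneq ne => ->; rewrite vertexl.
have freer k : vertex z != k -> zfree z (y k).
  by move=> ne; apply: zfreeX; apply: contraNneq ne => ->; rewrite vertexr.
by move=> ni nj; apply: zfreeB; apply: zfreeM; first [exact: freel|exact: freer].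
Qed.

Lemma gsub_videal Z r : gsub (sgrade K (n + n)) (videal Z r).
Proof.
have hX z : zhomog 1 ('X_z : S).
  by apply/zhomogP; rewrite /hcomp mlinX mdeg1.
have hM p q : zhomog 1 p -> zhomog 1 q -> zhomog 2 (p * q).
  by move=> /zhomogP hp hq; apply/zhomogP; rewrite (@hcompM _ _ 1 1) ?hp.
apply: gsub_ideal_gen => _ [[z _ ->]|[i [j [_ ->]]]]; first by exists 1.
exists 2; apply/zhomogP; rewrite raddfB /=.
by congr (_ - _); apply/zhomogP; apply: hM; apply: hX.
Qed.

(** Deleting a vertex means adding its two variables to the ideal, so that all graphs of the
    induction live over the same ring and their quotients fit into exact sequences. *)
Definition zkill (U : {set 'I_n}) : {set 'I_(n + n)} := [set z | vertex z \notin U].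
Definition restr (e : rel 'I_n) (U : {set 'I_n}) : rel 'I_n :=
  fun i j => [&& i \in U, j \in U & e i j].

Definition gideal U e : S^o -> Prop := videal (zkill U) (restr e U).

Definition vreg Z r (rho : int) : Prop := greg (sgrade K (n + n)) (videal Z r) rho.
Definition Greg U e rho : Prop := vreg (zkill U) (restr e U) rho.

Lemma videal_sub (Z : {set 'I_(n + n)}) (r : rel 'I_n) (P : S^o -> Prop) : submod P ->
  (forall z, z \in Z -> P 'X_z) -> (forall i j, r i j -> P (bin i j)) ->
  forall p, videal Z r p -> P p.
Proof.
move=> PS PX PB; apply: (ideal_gen_sub PS) => _ [[z zZ ->]|[i [j [rij ->]]]].
  exact: PX.
exact: PB.
Qed.

Lemma videalX1 (Z : {set 'I_(n + n)}) r z : z \in Z -> videal Z r 'X_z.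
Proof. by move=> zZ; rewrite -['X_z]mul1r; apply: videalX. Qed.

Lemma videalB1 Z (r : rel 'I_n) i j : r i j -> videal Z r (bin i j).
Proof. by move=> rij; rewrite -[bin i j]mul1r; apply: videalB. Qed.

Lemma bin_killl (P : S^o -> Prop) i j : submod P -> P (x i) -> P (y i) -> P (bin i j).
Proof.
move=> PS Px Py; apply: (submodB PS); last by apply: (submodZ PS).
by rewrite mulrC; apply: (submodZ PS).
Qed.

Lemma bin_killr (P : S^o -> Prop) i j : submod P -> P (x j) -> P (y j) -> P (bin i j).
Proof.
move=> PS Px Py; apply: (submodB PS); first by apply: (submodZ PS).
by rewrite mulrC; apply: (submodZ PS).
Qed.

Lemma videalS (Z Z' : {set 'I_(n + n)}) r p : Z \subset Z' ->
  videal Z r p -> videal Z' r p.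
Proof.
move=> /subsetP sZ; apply: videal_sub => [|z zZ|i j rij]; first exact: submod_videal.
  exact/videalX1/sZ.
exact: videalB1.
Qed.

Lemma videal_modX Z r z (p : S^o) : videal (z |: Z) r p ->
  exists q, videal Z r (p - 'X_z *: q).
Proof.
elim/ideal_gen_ind => [|p1 p2 [a Ia] [b Ib]|c _ [[z' z'Z ->]|[i [j [rij ->]]]]].
- by exists 0; rewrite scaler0 subr0; apply: (submod0 (submod_videal Z r)).
- by exists (a + b); rewrite scalerDr opprD addrACA; apply: (submodD (submod_videal Z r)).
- case/setU1P: z'Z => [->|z'Z].
    by exists c; rewrite [X in X - _]mulrC subrr; apply: (submod0 (submod_videal Z r)).
  by exists 0; rewrite scaler0 subr0; apply: videalX.
by exists 0; rewrite scaler0 subr0; apply: videalB.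
Qed.

Lemma vreg_add1 (Z : {set 'I_(n + n)}) (r : rel 'I_n) z rho :
  z \notin Z -> (forall i j, r i j -> vertex z != i /\ vertex z != j) ->
  vreg (z |: Z) r rho -> vreg Z r rho.
Proof.
move=> nzZ rz regL; apply: (greg_nzd (L := videal (z |: Z) r) (i := z)) regL _.
- exact: gsub_videal.
- by move=> p; apply: videalS; apply: subsetUr.
- exact: videal_modX.
apply: ideal_gen_zfree => _ [[z' z'Z ->]|[i [j [/rz [zi zj] ->]]]].
  by apply: zfreeX; apply: contraNneq nzZ => ->.
exact: bin_zfree.
Qed.

(** The additional variables occur in no generator, so they are nonzerodivisors and can be added one
    at a time. *)
Lemma vreg_add (Z Z' : {set 'I_(n + n)}) (r : rel 'I_n) rho : Z \subset Z' ->
  (forall z i j, z \in Z' :\: Z -> r i j -> vertex z != i /\ vertex z != j) ->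
  vreg Z' r rho -> vreg Z r rho.
Proof.
have [k] := ubnP #|Z' :\: Z|; elim: k Z => // k IHk Z lt_k sZ rz regZ'.
have [Z0|[z zD]] := set_0Vmem (Z' :\: Z).
  by rewrite (_ : Z = Z') //; apply/eqP; rewrite eqEsubset sZ -setD_eq0 Z0 eqxx.
have /setDP [zZ' nzZ] := zD.
apply: (@vreg_add1 Z r z) => // [i j rij|]; first exact: rz.
apply: IHk => //.
- rewrite setUC -setDDl; move: lt_k; rewrite (cardsD1 z) zD add1n ltnS; exact.
- by rewrite subUset sub1set zZ'.
by move=> z' i j; rewrite setUC -setDDl => /setD1P [_]; apply: rz.
Qed.

Lemma vreg_all r rho : 0 <= rho -> vreg setT r rho.
Proof.
move=> rho_ge0 k d lt_d c _ _; exists 0; first exact: kallT.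
rewrite raddf0 subr0; apply: kall_sub (kall_hom _ _ _ _) => v /= hv.
rewrite -{}hv /hcomp /mlin; apply: (submod_sum (submod_videal _ _)) => u _.
rewrite -mul_mpolyC; apply: (submodZ (submod_videal _ _)).
case: eqP => [Eu|_]; last exact: (submod0 (submod_videal _ _)).
have [z uz] : exists z, u z != 0%N.
  apply/existsP; rewrite -negb_forall; apply/negP => /forallP u0.
  by move: Eu lt_d; rewrite mdegE big1 => [<-|i _]; [lia | apply/eqP].
rewrite -[u](@submK _ U_(z)%MM) ?lep1mP // mpolyXD.
by apply: videalX; rewrite inE.
Qed.

Lemma Greg_edgeless (U : {set 'I_n}) (e : rel 'I_n) rho :
  (forall i j, i \in U -> j \in U -> ~~ e i j) -> 0 <= rho -> Greg U e rho.
Proof.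
move=> noe rho_ge0; apply: (@vreg_add _ setT); first exact: subsetT.
  by move=> z i j _ /and3P [iU jU]; rewrite (negbTE (noe i j iU jU)).
exact: vreg_all.
Qed.

Lemma vreg_eq Z r Z' r' rho :
  (forall p, videal Z r p <-> videal Z' r' p) -> vreg Z r rho -> vreg Z' r' rho.
Proof. exact: greg_eq. Qed.

Lemma zkillD1 (U : {set 'I_n}) v z : z \in zkill (U :\ v) ->
  [\/ z = lshift n v, z = rshift n v | z \in zkill U].
Proof.
rewrite !inE negb_and negbK => /orP [/eqP|]; last by constructor 3.
by case: (vertex_cases z) => -> <-; rewrite ?vertexl ?vertexr; [constructor 1|constructor 2].
Qed.

(* [x_v f_ab] and [y_v f_ab] lie in [(f_va, f_vb)]; hence [J(G_v)] and [J(G)]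
   agree up to elements free of [x_v, y_v], which are detected by setting
   [x_v = y_v = 0]. *)
Section Ohtani.
Variables (U : {set 'I_n}) (e : rel 'I_n) (v : 'I_n).
Hypotheses (e_irr : irreflexive e) (vU : v \in U).
Local Notation Uv := (U :\ v).
Local Notation ev := (gcomp U e v).

Let kx e' : gideal Uv e' (x v).
Proof. by apply: videalX1; rewrite !inE vertexl eqxx. Qed.

Let ky e' : gideal Uv e' (y v).
Proof. by apply: videalX1; rewrite !inE vertexr eqxx. Qed.

Lemma gideal_del (e' : rel 'I_n) p : gideal U e' p -> gideal Uv e' p.
Proof.
apply: videal_sub => [|z|i j /and3P [iU jU eij]]; first exact: submod_videal.
  rewrite inE => nzU; apply: videalX1; rewrite !inE negb_and negbK.
  by rewrite nzU orbT.
have [->|ni] := eqVneq i v; first exact: bin_killl (submod_videal _ _) (kx _) (ky _).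
have [->|nj] := eqVneq j v; first exact: bin_killr (submod_videal _ _) (kx _) (ky _).
by apply: videalB1; rewrite /restr !inE ni nj iU jU.
Qed.

Lemma gideal_mono W (e' : rel 'I_n) p : (forall i j, e i j -> e' i j) ->
  gideal W e p -> gideal W e' p.
Proof.
move=> ee'; apply: videal_sub => [|z zW|i j /and3P [iU jU eij]].
- exact: submod_videal.
- exact: videalX1.
by apply: videalB1; rewrite /restr iU jU ee'.
Qed.

Lemma gcomp_bin a b c : restr ev U a b -> gideal U e ((x v * c) * bin a b) /\
  gideal U e ((y v * c) * bin a b).
Proof.
move=> /and3P [aU bU /orP [eab|/and5P [nab _ _ eva evb]]].
  by split; apply: videalB; rewrite /restr aU bU.
have GS := submod_videal (zkill U) (restr e U).
have ra : restr e U v a by rewrite /restr vU aU.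
have rb : restr e U v b by rewrite /restr vU bU.
split.
  have -> : x v * c * bin a b = (c * x a) * bin v b - (c * x b) * bin v a.
    by rewrite /bin; ring.
  by apply: (submodB GS); apply: videalB.
have -> : y v * c * bin a b = (c * y a) * bin v b - (c * y b) * bin v a.
  by rewrite /bin; ring.
by apply: (submodB GS); apply: videalB.
Qed.

Definition vzero (p : S) : S := mzero (rshift n v) (mzero (lshift n v) p).

Lemma vzero0 : vzero 0 = 0.
Proof. by rewrite /vzero !mzero0. Qed.

Lemma vzeroD p q : vzero (p + q) = vzero p + vzero q.
Proof. by rewrite /vzero !mzeroD. Qed.

Lemma vzeroB p q : vzero (p - q) = vzero p - vzero q.
Proof. by rewrite /vzero !mzeroB. Qed.

Lemma vzerox c : vzero (c * x v) = 0.
Proof. by rewrite /vzero mulrC mzeroX mzero0. Qed.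

Lemma vzeroy c : vzero (c * y v) = 0.
Proof.
rewrite /vzero mulrC mzero_zfree ?mzeroX //.
by apply: zfreeX; rewrite eq_lrshift.
Qed.

Lemma vzero_free c q : zfree (lshift n v) q -> zfree (rshift n v) q ->
  vzero (c * q) = vzero c * q.
Proof. by move=> ql qr; rewrite /vzero mulrC !mzero_zfree // mulrC. Qed.

Lemma vzero_bin c i j : i != v -> j != v -> vzero (c * bin i j) = vzero c * bin i j.
Proof.
by move=> ni nj; apply: vzero_free; apply: bin_zfree;
  rewrite ?vertexl ?vertexr eq_sym.
Qed.

Lemma vzero_split c : exists a b, c = vzero c + x v * a + y v * b.
Proof.
exists (mquo (lshift n v) c), (mquo (rshift n v) (mzero (lshift n v) c)).
by rewrite /vzero /mzero /varx /vary; ring.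
Qed.

Lemma vzero_gideal p : gideal Uv e p -> gideal U e (vzero p).
Proof.
have GS := submod_videal (zkill U) (restr e U).
elim/ideal_gen_ind => [|q r IHq IHr|c _ [[z zU ->]|[i [j [/and3P [iU jU eij] ->]]]]].
- by rewrite vzero0; apply: (submod0 GS).
- by rewrite vzeroD; apply: (submodD GS).
- case/zkillD1: zU => [->|->|zU].
  + by rewrite vzerox; apply: (submod0 GS).
  + by rewrite vzeroy; apply: (submod0 GS).
  have nzv : vertex z != v by move: zU; rewrite inE; apply: contraNneq => ->.
  rewrite vzero_free; first exact: videalX.
    by apply: zfreeX; apply: contraNneq nzv => <-; rewrite vertexl.
  by apply: zfreeX; apply: contraNneq nzv => <-; rewrite vertexr.
case/setD1P: iU jU => ni iU /setD1P [nj jU].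
by rewrite vzero_bin //; apply: videalB; rewrite /restr iU jU.
Qed.

(** For an added binomial, which avoids [v], the difference is a multiple by an element of
    [(x_v, y_v)], and [gcomp_bin] applies. A binomial at [v] goes to 0 and belongs to an edge of the
    original graph. *)
Lemma vzero_gcomp p : gideal U ev p -> gideal U e (p - vzero p).
Proof.
have GS := submod_videal (zkill U) (restr e U).
elim/ideal_gen_ind => [|q r IHq IHr|c _ [[z zU ->]|[i [j [rij ->]]]]].
- by rewrite vzero0 subrr; apply: (submod0 GS).
- by rewrite vzeroD opprD addrACA; apply: (submodD GS).
- have nzv : vertex z != v by move: zU; rewrite inE; apply: contraNneq => ->.
  rewrite vzero_free; first by rewrite -mulrBl; apply: videalX.
    by apply: zfreeX; apply: contraNneq nzv => <-; rewrite vertexl.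
  by apply: zfreeX; apply: contraNneq nzv => <-; rewrite vertexr.
have [niv|nj] := boolP ((i == v) || (j == v)).
  have rij' : restr e U i j.
    move: rij; rewrite /restr /gcomp; case: (e i j) => //=.
    by case/orP: niv => /eqP ->; rewrite e_irr ?andbF.
  have -> : vzero (c * bin i j) = 0.
    case/orP: niv => /eqP ->.
      have -> : c * bin v j = (c * y j) * x v - (c * x j) * y v.
        by rewrite /bin; ring.
      by rewrite vzeroB vzerox vzeroy subr0.
    have -> : c * bin i v = (c * x i) * y v - (c * y i) * x v.
      by rewrite /bin; ring.
    by rewrite vzeroB vzerox vzeroy subr0.
  by rewrite subr0; apply: videalB.
move: nj; rewrite negb_or => /andP [ni nj]; rewrite vzero_bin // -mulrBl.
have [a [b Ec]] := vzero_split c.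
have -> : c - vzero c = x v * a + y v * b by rewrite {1}Ec; ring.
by rewrite mulrDl; apply: (submodD GS); [case: (gcomp_bin a rij) | case: (gcomp_bin b rij)].
Qed.

(** For the converse, [p] is the sum of [p - vzero p], controlled by the completed graph, and
    [vzero p], controlled by the graph without [v]. *)
Lemma gideal_cap p : gideal U e p <-> gideal U ev p /\ gideal Uv e p.
Proof.
split=> [Gp|[Gvp Gp]].
  by split; [apply: gideal_mono Gp => i j eij; rewrite /gcomp eij | apply: gideal_del].
have GS := submod_videal (zkill U) (restr e U).
rewrite -[p](subrK (vzero p)); apply: (submodD GS).
  exact: vzero_gcomp.
exact: vzero_gideal.
Qed.

Lemma Greg_ohtani rho : Greg U ev rho -> Greg Uv e rho -> Greg Uv ev (rho - 1) ->
  Greg U e rho.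
Proof.
have emono i j : e i j -> ev i j by rewrite /gcomp => ->.
apply: (@greg_cap _ _ _ _ _ _ (gideal Uv ev)); try exact: gsub_videal.
- exact: gideal_del.
- by move=> p; apply: gideal_mono.
- move=> p; elim/ideal_gen_ind => [|q r [a Ia Ja] [b Ib Jb]|c f [[z zU ->]|[i [j [rij ->]]]]].
  + exists 0; first exact: (submod0 (submod_videal _ _)).
    by rewrite subr0; exact: (submod0 (submod_videal _ _)).
  + exists (a + b); first exact: (submodD (submod_videal _ _)).
    by rewrite opprD addrACA; apply: (submodD (submod_videal _ _)).
  + exists 0; first exact: (submod0 (submod_videal _ _)).
    by rewrite subr0; apply: videalX.
  exists (c * bin i j); last by rewrite subrr; apply: (submod0 (submod_videal _ _)).
  apply: videalB; move: rij; rewrite /restr !inE.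
  by move=> /and3P [/andP [_ ->] /andP [_ ->] ->].
- exact: gideal_cap.
- exact: submod_videal.
Qed.

End Ohtani.
End BinomialIdeals.

(** * Disjoint unions of cliques *)

Section CliqueUnion.
Variables (K : fieldType) (n : nat) (U : {set 'I_n}) (e : rel 'I_n).
Hypothesis e_sym : ssrbool.symmetric e.
Hypothesis e_tr : forall i j k, i \in U -> j \in U -> k \in U ->
  e i j -> e j k -> i != k -> e i k.
Local Notation S := {mpoly K[n + n]}.
Local Notation x i := (varx K i).
Local Notation y i := (vary K i).
Local Notation L i := (lshift n i).
Local Notation R i := (rshift n i).
Local Notation J := (@gideal K n U e).

Definition samecl (i j : 'I_n) : bool := (i == j) || restr e U i j.

Lemma samecl_refl i : samecl i i.
Proof. by rewrite /samecl eqxx. Qed.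

Lemma samecl_sym i j : samecl i j = samecl j i.
Proof. by rewrite /samecl /restr eq_sym e_sym andbCA. Qed.

Lemma samecl_trans i j k : samecl i j -> samecl j k -> samecl i k.
Proof.
move=> /predU1P [-> //|/and3P [iU jU eij]] /predU1P [<-|/and3P [_ kU ejk]].
  by rewrite /samecl /restr iU jU eij orbT.
rewrite /samecl /restr iU kU; have [//|ne] := eqVneq i k.
by rewrite (e_tr iU jU kU eij ejk ne).
Qed.

Definition alive (u : 'X_{1..n + n}) : bool :=
  [forall v, (v \notin U) ==> (u (L v) == 0%N) && (u (R v) == 0%N)].

(* Two monomials avoiding the killed variables are congruent modulo [J] iff they
   have the same degree at each vertex and the same [x]-degree in each clique. *)
Definition mclass (u : 'X_{1..n + n}) : {ffun 'I_n -> nat * nat} :=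
  [ffun i => (u (L i) + u (R i), \sum_(j | samecl i j) u (L j))%N].

Lemma aliveP (u : 'X_{1..n + n}) :
  reflect (forall v, v \notin U -> u (L v) = 0%N /\ u (R v) = 0%N) (alive u).
Proof.
apply: (iffP forallP) => [u0 v vU|u0 v]; last first.
  by apply/implyP => /u0 [-> ->].
by move/implyP: (u0 v) => /(_ vU) /andP [/eqP -> /eqP ->].
Qed.

Lemma sum_delta (P : pred 'I_n) i : (\sum_(j | P j) (i == j) = P i :> nat)%N.
Proof.
rewrite big_mkcond (bigD1 i) //= eqxx big1 ?addn0; first by case: (P i).
by move=> j; rewrite eq_sym => /negbTE ->; case: (P j).
Qed.

(** Induction on the total excess of the [x]-exponents of [u] over those of [u']. An excess at [i]
    forces a deficit at some [j] of the same clique; then [y_j] divides the monomial, and trading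
    [x_i y_j] for [x_j y_i] lowers the excess modulo [J]. *)
Lemma mclass_congr (u u' : 'X_{1..n + n}) : alive u -> alive u' -> mclass u = mclass u' ->
  J ('X_[u] - 'X_[u']).
Proof.
have JS : submod J by apply: submod_videal.
have [d] := ubnP (\sum_i (u (L i) - u' (L i)))%N.
elim: d u => // d IHd u; rewrite ltnS => lt_d au au' cl_u.
have degE k : (u (L k) + u (R k) = u' (L k) + u' (R k))%N.
  by have /ffunP/(_ k) := cl_u; rewrite !ffunE => -[].
have sumE k : (\sum_(j | samecl k j) u (L j) = \sum_(j | samecl k j) u' (L j))%N.
  by have /ffunP/(_ k) := cl_u; rewrite !ffunE => -[].
have [[i lt_i]|noi] := classic (exists i, u' (L i) < u (L i))%N; last first.
  have le_u k : (u (L k) <= u' (L k))%N.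
    by rewrite leqNgt; apply/negP => lt_k; apply: noi; exists k.
  have xE k : u (L k) = u' (L k).
    apply/eqP; rewrite eqn_leq le_u leqNgt; apply/negP => lt_k.
    have := sumE k; rewrite (bigD1 k) ?samecl_refl //= [in RHS](bigD1 k) ?samecl_refl //=.
    have : (\sum_(j | samecl k j && (j != k)) u (L j) <=
            \sum_(j | samecl k j && (j != k)) u' (L j))%N by apply: leq_sum.
    by move=> leS eqS; have := leq_add lt_k leS; rewrite addSn eqS ltnn.
  have -> : u = u'.
    apply/mnmP => z; case: (vertex_cases z) => ->; first exact: xE.
    by have := degE (vertex z); rewrite xE => /addnI.
  by rewrite subrr; apply: (submod0 JS).
have iU : i \in U.
  by apply: contraTT lt_i => /(aliveP _ au) [-> _]; rewrite ltn0.
have [j ij lt_j] : exists2 j, samecl i j & (u (L j) < u' (L j))%N.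
  apply: NNPP => noj; have le_u j : samecl i j -> (u' (L j) <= u (L j))%N.
    by move=> ij; rewrite leqNgt; apply/negP => lt_j; apply: noj; exists j.
  have := sumE i; rewrite (bigD1 i) ?samecl_refl //= [in RHS](bigD1 i) ?samecl_refl //=.
  have : (\sum_(j | samecl i j && (j != i)) u' (L j) <=
          \sum_(j | samecl i j && (j != i)) u (L j))%N.
    by apply: leq_sum => j /andP [/le_u].
  by move=> leS eqS; have := leq_add lt_i leS; rewrite addSn eqS ltnn.
have nij : i != j by apply: contraTneq lt_j => <-; rewrite -leqNgt ltnW.
have rij : restr e U i j by move: ij; rewrite /samecl (negbTE nij).
have jU : j \in U by case/and3P: rij.
have [w Ew] : exists w, u = (w + (U_(L i) + U_(R j)))%MM.
  exists (u - (U_(L i) + U_(R j)))%MM; rewrite submK //; apply/mnm_lepP => z.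
  rewrite mnmDE !mnm1E; have [<-|_] := eqVneq (L i) z.
    by rewrite eq_rlshift addn0; lia.
  by have [<-|//] := eqVneq (R j) z; have := degE j; lia.
have uL k : u (L k) = (w (L k) + (i == k))%N.
  by rewrite Ew !mnmDE !mnm1E eq_lshift eq_rlshift addn0.
have uR k : u (R k) = (w (R k) + (j == k))%N.
  by rewrite Ew !mnmDE !mnm1E eq_rshift eq_lrshift.
pose u2 := (w + (U_(L j) + U_(R i)))%MM.
have u2L k : u2 (L k) = (w (L k) + (j == k))%N.
  by rewrite !mnmDE !mnm1E eq_lshift eq_rlshift addn0.
have u2R k : u2 (R k) = (w (R k) + (i == k))%N.
  by rewrite !mnmDE !mnm1E eq_rshift eq_lrshift.
have -> : 'X_[u] - 'X_[u'] = ('X_[u] - 'X_[u2]) + ('X_[u2] - 'X_[u']) :> S.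
  by rewrite addrA subrK.
apply: (submodD JS).
  have -> : 'X_[u] - 'X_[u2] = 'X_[w] * bin K i j :> S.
    by rewrite Ew /u2 !mpolyXD /bin /varx /vary; ring.
  exact: videalB.
apply: IHd => //.
- apply: leq_trans lt_d; rewrite (bigD1 i) //= [X in (_ < X)%N](bigD1 i) //=.
  rewrite -addSn; apply: leq_add.
    by move: lt_i; rewrite u2L uL eqxx eq_sym (negbTE nij); lia.
  apply: leq_sum => k nki; rewrite u2L uL [i == k]eq_sym (negbTE nki).
  have [<-|_] := eqVneq j k; last by [].
  by move: lt_j; rewrite uL (negbTE nij); lia.
- apply/aliveP => k kU; have [] := aliveP _ au k kU.
  rewrite u2L u2R uL uR.
  have -> : (i == k) = false by apply/eqP => ik; move: kU; rewrite -ik iU.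
  have -> : (j == k) = false by apply/eqP => jk; move: kU; rewrite -jk jU.
  by rewrite !addn0.
- rewrite -cl_u; apply/ffunP => k; rewrite !ffunE u2L u2R uL uR; congr (_, _).
    lia.
  under eq_bigr => l _ do rewrite u2L.
  under [RHS]eq_bigr => l _ do rewrite uL.
  rewrite !big_split /= !sum_delta; congr (_ + nat_of_bool _)%N.
  apply/idP/idP => kl; apply: samecl_trans kl _ => //.
  by rewrite samecl_sym.
Qed.

(** These functionals cut out [J]: [class_sum_gideal] and [class_sum_eq0] are the two directions.
    Multiplication by [x_v] shifts the classes injectively, which makes [x_v] a nonzerodivisor
    modulo [J]. *)
Definition class_sum (w : {ffun 'I_n -> nat * nat}) : S -> K^o :=
  mlin (fun u => if alive u && (mclass u == w) then 1 else 0 : K^o).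

HB.instance Definition _ w := GRing.Linear.on (class_sum w).

Lemma class_sumX w u : class_sum w 'X_[u] = (alive u && (mclass u == w))%:R.
Proof. by rewrite /class_sum mlinX; case: ifP. Qed.

Lemma mnm_xy (u : 'X_{1..n + n}) i j k :
  ((u + (U_(L i) + U_(R j)))%MM (L k) = u (L k) + (i == k))%N /\
  ((u + (U_(L i) + U_(R j)))%MM (R k) = u (R k) + (j == k))%N.
Proof.
by rewrite !mnmDE !mnm1E eq_lshift eq_rlshift eq_rshift eq_lrshift addn0.
Qed.

Lemma alive_class_swap (u : 'X_{1..n + n}) i j : restr e U i j ->
  alive (u + (U_(L i) + U_(R j)))%MM = alive (u + (U_(L j) + U_(R i)))%MM /\
  mclass (u + (U_(L i) + U_(R j)))%MM = mclass (u + (U_(L j) + U_(R i)))%MM.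
Proof.
move=> rij; have /and3P [iU jU _] := rij; split.
  apply: eq_forallb => k; case kU: (k \in U) => //=.
  case: (mnm_xy u i j k) => -> ->; case: (mnm_xy u j i k) => -> ->.
  have -> : (i == k) = false by apply/eqP => ik; move: kU; rewrite -ik iU.
  by have -> : (j == k) = false by apply/eqP => jk; move: kU; rewrite -jk jU.
apply/ffunP => k; rewrite !ffunE; congr (_, _).
  by case: (mnm_xy u i j k) => -> ->; case: (mnm_xy u j i k) => -> ->; lia.
under eq_bigr => l _ do rewrite (mnm_xy u i j l).1.
under [RHS]eq_bigr => l _ do rewrite (mnm_xy u j i l).1.
rewrite !big_split /= !sum_delta; congr (_ + nat_of_bool _)%N.
have ij : samecl i j by rewrite /samecl rij orbT.
by apply/idP/idP => kl; apply: samecl_trans kl _; rewrite // samecl_sym.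
Qed.

Lemma class_sum_gideal w p : J p -> class_sum w p = 0.
Proof.
elim/ideal_gen_ind => [|q r IHq IHr|c _ [[z zU ->]|[i [j [rij ->]]]]].
- exact: raddf0.
- by rewrite raddfD /= IHq IHr addr0.
- move: c; apply: linear_mpolyP => [a p' q|a p' q|u].
  + by rewrite mulrDl -scalerAl linearP.
  + by rewrite scaler0 addr0.
  rewrite -mpolyXD class_sumX (_ : alive _ = false) //.
  apply/negP => /aliveP /(_ (vertex z)); move: zU; rewrite inE => -> /(_ isT).
  move=> [hL hR]; case: (vertex_cases z) => E; [move: hL | move: hR];
    by rewrite -E mnmDE mnm1E eqxx addn1.
move: c; apply: linear_mpolyP => [a p' q|a p' q|u].
- by rewrite mulrDl -scalerAl linearP.
- by rewrite scaler0 addr0.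
rewrite /bin mulrBr raddfB /= /varx /vary -!mpolyXD !class_sumX.
by case: (alive_class_swap u rij) => -> ->; rewrite subrr.
Qed.

Definition class_shift v (w : {ffun 'I_n -> nat * nat}) : {ffun 'I_n -> nat * nat} :=
  [ffun i => ((w i).1 + (v == i), (w i).2 + samecl i v)%N].

Lemma class_shift_inj v : injective (class_shift v).
Proof.
move=> w w' /ffunP Ew; apply/ffunP => i; have := Ew i; rewrite !ffunE.
by case: (w i) (w' i) => [a b] [a' b'] /= [/addIn -> /addIn ->].
Qed.

Lemma class_sum_shift v w p : v \in U ->
  class_sum (class_shift v w) (x v * p) = class_sum w p.
Proof.
move=> vU; move: p; apply: linear_mpolyP => [a p q|a p q|u].
- by rewrite mulrDr -scalerAr linearP.
- by rewrite linearP.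
rewrite /varx -mpolyXD !class_sumX.
have uL k : ((U_(L v) + u)%MM (L k) = u (L k) + (v == k))%N.
  by rewrite mnmDE mnm1E eq_lshift addnC.
have uR k : ((U_(L v) + u)%MM (R k) = u (R k))%N.
  by rewrite mnmDE mnm1E eq_lrshift.
have -> : alive (U_(L v) + u)%MM = alive u.
  apply: eq_forallb => k; case kU: (k \in U) => //=; rewrite uL uR.
  have -> : (v == k) = false by apply/eqP => vk; move: kU; rewrite -vk vU.
  by rewrite addn0.
have -> : mclass (U_(L v) + u)%MM = class_shift v (mclass u).
  apply/ffunP => k; rewrite !ffunE /= uL uR; congr (_, _); first by rewrite addnAC.
  under eq_bigr => l _ do rewrite uL.
  by rewrite big_split /= sum_delta.
by rewrite (inj_eq (@class_shift_inj v)).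
Qed.

(** Replacing every monomial by a representative depending only on its class, or by 0 if it is not
    alive, changes [p] by an element of [J]; the coefficients of the result are class sums. *)
Lemma class_sum_eq0 p : (forall w, class_sum w p = 0) -> J p.
Proof.
move=> p0; have JS : submod J by apply: submod_videal.
pose rep u := choose (fun u' => alive u' && (mclass u' == mclass u)) u.
pose f (u : 'X_{1..n + n}) : S := if alive u then 'X_[rep u] else 0.
have repP u : alive u -> alive (rep u) /\ mclass (rep u) = mclass u.
  move=> au; pose P u' := alive u' && (mclass u' == mclass u).
  have Pu : P u by rewrite /P au eqxx.
  by have /andP [? /eqP] := chooseP Pu.
suff f0 : mlin f p = 0.
  rewrite -[p]subr0 -f0 {1}[p]mpolyE /mlin -sumrB.
  apply: (submod_sum JS) => u _; rewrite -scalerBr -mul_mpolyC; apply: (submodZ JS).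
  rewrite /f; case: ifP => au.
    by have [ar cr] := repP u au; apply: mclass_congr.
  rewrite subr0; have [v [vU nz]] : exists v, v \notin U /\ ((u (L v) != 0) || (u (R v) != 0))%N.
    move/negbT: au; rewrite negb_forall => /existsP [v].
    by rewrite negb_imply negb_and => /andP [vU nz]; exists v.
  case/orP: nz => nz.
    rewrite -[u](@submK _ U_(L v)%MM) ?lep1mP // mpolyXD; apply: videalX.
    by rewrite inE vertexl.
  rewrite -[u](@submK _ U_(R v)%MM) ?lep1mP // mpolyXD; apply: videalX.
  by rewrite inE vertexr.
apply/mpolyP => mu; rewrite mcoeff0.
suff -> : (mlin f p)@_mu = if (rep mu == mu) && alive mu then class_sum (mclass mu) p else 0.
  by rewrite p0 if_same.
move: p {p0}; apply: (@linear_mpolyP _ _ K^o) => [a p q|a p q|u].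
- by rewrite linearP mcoeffD mcoeffZ.
- by case: ifP => _; rewrite ?linearP // scaler0 addr0.
rewrite mlinX class_sumX /f; have [au|nau] := boolP (alive u); last first.
  by rewrite mcoeff0 if_same.
rewrite mcoeffX; have [ru|nru] := eqVneq (rep u) mu.
  have [amu cmu] := repP u au; rewrite ru in amu cmu.
  have -> : rep mu = mu.
    by rewrite -[RHS]ru /rep cmu; apply: choose_id; rewrite ?amu ?au ?cmu eqxx.
  by rewrite eqxx amu cmu eqxx.
case: ifP => // /andP [/eqP rmu amu]; case: eqP => // cu.
by case/eqP: nru; rewrite -rmu /rep cu; apply: choose_id; rewrite ?amu ?au ?cu eqxx.
Qed.

Lemma gideal_nzd v p : v \in U -> J (x v * p) -> J p.
Proof.
move=> vU Jp; apply: class_sum_eq0 => w.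
by rewrite -(class_sum_shift w p vU) class_sum_gideal.
Qed.

(** [Q] is the clique of [v]. After passing to [J + (x_v)], adding [y_v] gives the graph without
    [v]. The colon by [y_v] contains [x_j] for all [j] in [Q], because [y_v x_j] is [y_j x_v] minus
    a binomial of [J]. *)
Lemma Greg_clique v rho : v \in U ->
  Greg K (U :\ v) e rho ->
  Greg K (U :\: (v |: [set w in U | e v w])) e (rho - 1) -> Greg K U e rho.
Proof.
move=> vU regD regQ; pose r := restr e U.
set Q := v |: _ in regQ; have vQ : v \in Q by rewrite setU11.
have QU : Q \subset U by apply/subsetP => w; rewrite !inE => /predU1P [->|/andP []].
have Qclosed i j : r i j -> i \in Q -> j \in Q.
  case/and3P=> iU jU eij; rewrite !inE iU jU /=.
  case/predU1P=> [<-|evi]; first by rewrite eij orbT.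
  by have [//|nj] := eqVneq j v; rewrite (e_tr vU iU jU) // eq_sym.
have Qopen i j : r i j -> i \notin Q -> j \notin Q.
  move=> rij; apply: contra; apply: Qclosed.
  by move: rij; rewrite /r /restr e_sym andbCA.
pose Z1 : {set 'I_(n + n)} := L v |: zkill U.
pose ZC : {set 'I_(n + n)} := zkill U :|: [set L i | i in Q].
pose rC := restr e (U :\: Q).
have S1 := submod_videal K Z1 r; have SC := submod_videal K ZC rC.
have xyQ j : j \in Q -> videal Z1 r (y v * x j).
  rewrite !inE => /predU1P [->|/andP [jU evj]].
    by apply: videalX; rewrite setU11.
  have -> : y v * x j = y j * x v - bin K v j by rewrite /bin; ring.
  apply: (submodB S1); first by apply: videalX; rewrite setU11.
  by apply: videalB1; rewrite /r /restr vU jU.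
have xC j : j \in Q -> videal ZC rC (x j).
  by move=> jQ; apply: videalX1; rewrite inE imset_f ?orbT.
apply: (greg_nzd (L := videal Z1 r) (i := L v)).
- exact: gsub_videal.
- by move=> p; apply: videalS; apply: subsetUr.
- exact: videal_modX.
- apply: (@greg_colon _ _ _ _ _ (videal (R v |: Z1) r) rho (R v) _ _ _ _ (videal ZC rC)).
  + exact: gsub_videal.
  + by move=> p; apply: videalS; apply: subsetUr.
  + exact: videal_modX.
  + apply: vreg_eq regD => p; split.
      apply: videal_sub => [|z /zkillD1 [->|->|zU]|i j]; first exact: submod_videal.
      * by apply: videalX1; rewrite !inE eqxx orbT.
      * by apply: videalX1; rewrite setU11.
      * by apply: videalX1; rewrite !in_setU1 zU !orbT.
      rewrite /restr !inE => /and3P [/andP [_ iU] /andP [_ jU] eij].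
      by apply: videalB1; rewrite /r /restr iU jU.
    have SD := submod_videal K (zkill (U :\ v)) (restr e (U :\ v)).
    have kz z : vertex z = v -> videal (zkill (U :\ v)) (restr e (U :\ v)) ('X_z : S).
      by move=> zv; apply: videalX1; rewrite !inE zv eqxx.
    apply: videal_sub => // [z|i j].
      rewrite !in_setU1 => /or3P [/eqP ->|/eqP ->|zU].
      * exact/kz/vertexr.
      * exact/kz/vertexl.
      by apply: videalX1; move: zU; rewrite !inE negb_and orbC => ->.
    have [->|ni] := eqVneq i v.
      by move=> _; apply: bin_killl => //; apply: kz; rewrite ?vertexl ?vertexr.
    have [->|nj] := eqVneq j v.
      by move=> _; apply: bin_killr => //; apply: kz; rewrite ?vertexl ?vertexr.
    by move=> rij; apply: videalB1; move: rij; rewrite /r /restr !inE ni nj.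
  + move=> p; split=> [Jp|Cp].
      apply: (@ideal_gen_zfree _ _ _ (R v)).
        move=> _ [[z zC ->]|[i [j [rij ->]]]].
          apply: zfreeX; apply: contraTneq zC => <-.
          rewrite !inE vertexr vU /=; apply/imsetP => -[i _ /eqP].
          by rewrite eq_rlshift.
        move: rij; rewrite /rC /restr !in_setD => /and3P [/andP [iQ _] /andP [jQ _] _].
        by apply: bin_zfree; rewrite vertexr; apply: contraTneq vQ => ->.
      apply: (@videal_sub K n Z1 r) (Jp : videal Z1 r (y v * p)) => // [z|i j rij].
        rewrite in_setU1 => /predU1P [->|zU]; first exact: xC.
        by apply: videalX1; rewrite in_setU zU.
      have [iQ|niQ] := boolP (i \in Q).
        apply: (submodB SC); rewrite mulrC; apply: (submodZ SC); apply: xC => //.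
        exact: Qclosed iQ.
      apply: videalB1; have /and3P [iU jU eij] := rij.
      by rewrite /rC /restr !in_setD niQ (Qopen _ _ rij niQ) iU jU.
    pose P (q : S^o) := videal Z1 r (y v * q).
    have PS : submod P.
      split; first by rewrite /P mulr0; apply: (submod0 S1).
      move=> a q1 q2 P1 P2; rewrite /P mulrDr; apply: (submodD S1) => //.
      by rewrite [X in videal _ _ X]mulrCA; apply: (submodZ S1).
    apply: (@videal_sub K n ZC rC P) Cp => // [z|i j].
      rewrite in_setU => /orP [zU|/imsetP [j jQ ->]]; last exact: xyQ.
      by apply: videalX; rewrite in_setU1 zU orbT.
    rewrite /rC /restr !in_setD => /and3P [/andP [_ iU] /andP [_ jU] eij].
    by apply: videalB; rewrite /r /restr iU jU.
  (* The variables [y_j] with [j] in [Q] occur in no generator of the colon ideal and may be added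
     to it. *)
  apply: vreg_add regQ.
    apply/subsetP => z; rewrite in_setU => /orP [|/imsetP [i iQ ->]].
      by rewrite inE [in X in _ -> X]inE in_setD => /negbTE ->; rewrite andbF.
    by rewrite inE in_setD vertexl iQ.
  move=> z i j /setDP [zk zC].
  have zQ : vertex z \in Q.
    move: zC; rewrite in_setU negb_or => /andP [zU _].
    move: zk zU; rewrite inE [z \in zkill U]inE in_setD negbK negb_and negbK.
    by case/orP=> [|/negbTE ->].
  rewrite /rC /restr !in_setD => /and3P [/andP [iQ _] /andP [jQ _] _].
  by split; apply: contraTneq zQ => ->.
by move=> p; apply: gideal_nzd.
Qed.

End CliqueUnion.

Theorem reg_quot_binomial_le (K : fieldType) n (e : rel 'I_n) (rho : int) :
  0 <= rho -> Greg K setT e rho -> reg_quot (binomial_edge_ideal K e) <= rho.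
Proof.
move=> rho_ge0 regG.
have JE p : gideal setT e p <-> binomial_edge_ideal K e p.
  split.
    have BS : submod (binomial_edge_ideal K e : {mpoly K[n + n]}^o -> Prop).
      exact: submod_ideal_gen.
    apply: videal_sub => // [z|i j /and3P [_ _ eij]]; first by rewrite !inE.
    by apply: ideal_gen_in; exists i, j.
  apply: ideal_gen_sub => [|_ [i [j [eij ->]]]]; first exact: submod_videal.
  by apply: videalB1; rewrite /restr !inE.
have cst0 p : binomial_edge_ideal K e p -> p@_0%MM = 0.
  elim/ideal_gen_ind => [|q r IHq IHr|c _ [i [j [_ ->]]]]; first exact: mcoeff0.
    by rewrite mcoeffD IHq IHr addr0.
  by rewrite rmorphM rmorphB !rmorphM /= !mcoeffX !mnm1_eq0 !mul0r subr0 mulr0.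
apply: reg_quot_le => //; last exact: greg_eq regG.
split; first exact: submod_ideal_gen.
by move=> d p /JE Jp; apply/JE; apply: (gsub_videal _ _ _).2.
Qed.

(** * Weights of graphs with marked cycles *)

Section MarkedCycles.
Local Open Scope nat_scope.
Variable T : finType.
Implicit Types (e : rel T) (U C D W : {set T}) (F : {set {set T}}) (H : {set T * T}).

Definition nb e C (x : T) : {set T} := [set y in C | e x y].

(* The induced graph on [C] is a cycle: 2-regular and connected. *)
Definition cyc e C : Prop :=
  [/\ (2 < #|C|)%N, forall x, x \in C -> #|nb e C x| = 2 &
      forall X : {set T}, X \subset C -> X != set0 ->
        (forall x y, x \in X -> y \in C -> e x y -> y \in X) -> X = C].

Definition adjeq e (x y : T) : bool := (x == y) || e x y.

(* Certifies that every component of the graph outside the cycle [C] is attached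
   to a clique of [C]. *)
Definition labeling e U C (kappa : T -> {set T}) : Prop :=
  [/\ forall u, u \in U -> u \notin C -> kappa u \subset C,
      forall u p q, u \in U -> u \notin C -> p \in kappa u -> q \in kappa u -> adjeq e p q,
      forall u p, u \in U -> u \notin C -> p \in C -> e u p -> p \in kappa u &
      forall u w, u \in U -> u \notin C -> w \in U -> w \notin C -> e u w ->
        kappa u = kappa w].

Definition marked e U C : Prop :=
  [/\ C \subset U, cyc e C & exists kappa, labeling e U C kappa].

Definition valid e U F : Prop :=
  (forall C, C \in F -> marked e U C) /\
  (forall C D, C \in F -> D \in F -> C != D -> (#|C :&: D| <= 1)%N).

(* [h] and [h'] lie in a common clique. *)
Definition common e (h h' : T * T) : bool :=
  [&& adjeq e h.1 h'.1, adjeq e h.1 h'.2, adjeq e h.2 h'.1 & adjeq e h.2 h'.2].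

Definition inside H C : {set T * T} := [set h in H | (h.1 \in C) && (h.2 \in C)].

(** The two orientations of an edge lie in a common clique, so at most one of them belongs to [H]
    and [#|H|] counts undirected edges. *)
Definition cdisj e H : Prop :=
  forall h h', h \in H -> h' \in H -> common e h h' -> h = h'.

Definition adm e U F H : Prop :=
  [/\ forall h, h \in H -> [&& h.1 \in U, h.2 \in U & e h.1 h.2], cdisj e H &
      forall C, C \in F -> (#|inside H C| <= #|C| - 2)%N].

Lemma card_setD1 (A : finType) (B : {set A}) a : a \in B -> #|B| = #|B :\ a|.+1.
Proof. by move=> aB; rewrite (cardsD1 a) aB. Qed.

Lemma adjeq_sym e x y : ssrbool.symmetric e -> adjeq e x y = adjeq e y x.
Proof. by move=> e_sym; rewrite /adjeq eq_sym e_sym. Qed.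

Lemma clique_inside e H C : (forall x y, x \in C -> y \in C -> adjeq e x y) ->
  cdisj e H -> (#|inside H C| <= 1)%N.
Proof.
move=> cliqueC dH; apply/card_le1_eqP => h h'.
rewrite !inE => /and3P [hH h1 h2] /and3P [h'H h'1 h'2].
by apply: dH => //; apply/and4P; split; apply: cliqueC.
Qed.

Section Cycle.
Variables (e : rel T) (C : {set T}).
Hypotheses (e_sym : ssrbool.symmetric e) (e_irr : irreflexive e) (cycC : cyc e C).

Lemma cyc3_clique x y : #|C| = 3 -> x \in C -> y \in C -> adjeq e x y.
Proof.
case: cycC => _ deg _ C3 xC yC; rewrite /adjeq; have [//|nxy] := eqVneq x y.
have sub : nb e C x \subset C :\ x.
  apply/subsetP => w; rewrite !inE => /andP [-> exw]; rewrite andbT.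
  by apply: contraTneq exw => ->; rewrite e_irr.
have /eqP E : nb e C x == C :\ x.
  by rewrite eqEcard sub deg //; have := cardsD1 x C; rewrite xC C3; lia.
have : y \in nb e C x by rewrite E !inE yC eq_sym nxy.
by rewrite inE => /andP [].
Qed.

Lemma cyc_transitive_clique x y :
  (forall i j k, i \in C -> j \in C -> k \in C -> e i j -> e j k -> i != k -> e i k) ->
  x \in C -> y \in C -> adjeq e x y.
Proof.
case: cycC => _ _ conn e_tr xC yC.
have XE : [set z in C | adjeq e x z] = C.
  apply: conn.
  - by apply/subsetP => z; rewrite inE => /andP [].
  - by apply/set0Pn; exists x; rewrite inE xC /adjeq eqxx.
  move=> z w; rewrite !inE => /andP [zC /predU1P [<-|exz]] wC ezw.
    by rewrite wC /adjeq ezw orbT.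
  rewrite wC /adjeq; have [//|nxw] := eqVneq x w.
  exact: (e_tr x z w).
by move: yC; rewrite -{1}XE inE => /andP [].
Qed.

(** Adjacent neighbours [a], [b] would make [[set v; a; b]] closed under adjacency in [C], hence
    equal to [C]. *)
Lemma cyc_nb v : v \in C -> (3 < #|C|)%N ->
  exists a b, [/\ a != b, ~~ e a b & nb e C v = [set a; b]].
Proof.
case: cycC => _ deg conn vC C3.
have /eqP/cards2P [a [b [nab E]]] := deg v vC; exists a, b; split=> //.
apply/negP => eab.
have [aC eva] : a \in C /\ e v a.
  by have : a \in nb e C v; [rewrite E !inE eqxx | rewrite inE => /andP []].
have [bC evb] : b \in C /\ e v b.
  by have : b \in nb e C v; [rewrite E !inE eqxx orbT | rewrite inE => /andP []].
have nva : v != a by apply: contraTneq eva => ->; rewrite e_irr.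
have nvb : v != b by apply: contraTneq evb => ->; rewrite e_irr.
have nbE x y z : x \in C -> y \in C -> z \in C -> y != z -> e x y -> e x z ->
    forall w, w \in C -> e x w -> w \in [set y; z].
  move=> xC yC zC nyz exy exz w wC exw.
  have /eqP -> : [set y; z] == nb e C x.
    rewrite eqEcard deg // cards2 nyz andbT.
    by apply/subsetP => t; rewrite !inE => /orP [] /eqP ->; rewrite ?yC ?zC.
  by rewrite inE wC.
have XE : [set v; a; b] = C.
  apply: conn.
  - by apply/subsetP => z; rewrite !inE => /orP [/orP [] |] /eqP ->.
  - by apply/set0Pn; exists v; rewrite !inE eqxx.
  move=> z w; rewrite !inE => /orP [/orP [] |] /eqP -> wC ezw.
  - have := nbE v a b vC aC bC nab eva evb w wC ezw.
    by rewrite !inE => /orP [] ->; rewrite ?orbT.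
  - have := nbE a v b aC vC bC nvb _ eab w wC ezw.
    by rewrite e_sym => /(_ eva); rewrite !inE => /orP [] ->; rewrite ?orbT.
  have := nbE b v a bC vC aC nva _ _ w wC ezw.
  rewrite e_sym => /(_ evb); rewrite e_sym => /(_ eab).
  by rewrite !inE => /orP [] ->; rewrite ?orbT.
by move: C3; rewrite -XE setUC cardsU1 cards2; case: (_ \notin _); case: (_ != _).
Qed.

(** Without [v] the cycle is a path with [#|C| - 2] edges. Summing degrees gives [2 #|C| - 4]
    ordered pairs, among which the edges of [H] and their reversals form disjoint sets. *)
Lemma cyc_del_edges v H : v \in C -> cdisj e H ->
  (forall h, h \in H -> e h.1 h.2 /\ h.1 != v /\ h.2 != v) ->
  (#|inside H C| <= #|C| - 2)%N.
Proof.
case: cycC => C3 deg _ vC dH He.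
pose P := [set p : T * T | [&& p.1 \in C :\ v, p.2 \in C :\ v & e p.1 p.2]].
pose sw (h : T * T) := (h.2, h.1).
have sw_inj : injective sw by move=> [a b] [c d] [-> ->].
have subP : inside H C :|: sw @: inside H C \subset P.
  apply/subsetP => h; rewrite in_setU => /orP [|/imsetP [h' + ->]];
    rewrite !inE => /and3P [/He [e12 [-> ->]] -> ->] //=.
  by rewrite e_sym.
have dis : [disjoint inside H C & sw @: inside H C].
  apply/pred0P => h /=; apply/negP => /andP [] + /imsetP [h' + hE].
  rewrite !inE => /and3P [hH _ _] /and3P [h'H _ _].
  have [e12 _] := He _ h'H.
  have : h' = h.
    apply: dH => //; rewrite hE /common /adjeq /sw /= (e_sym h'.2 h'.1).
    by rewrite e12 !eqxx !orbT.
  rewrite hE; case: (h') e12 => a b /= eab [E _].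
  by move: eab; rewrite E e_irr.
have degD x : x \in C -> (#|nb e (C :\ v) x| + e x v = 2)%N.
  move=> xC; rewrite -(deg x xC) (cardsD1 v (nb e C x)) inE vC /= addnC.
  by congr (_ + #|pred_of_set _|)%N; apply/setP => y; rewrite !inE andbA.
have cardP : (#|P| + 4 = #|C|.*2)%N.
  have -> : #|P| = (\sum_(x in C :\ v) #|nb e (C :\ v) x|)%N.
    pose Q (x y : T) := y \in nb e (C :\ v) x.
    rewrite -sum1_card (eq_bigl (fun p : T * T => (p.1 \in C :\ v) && Q p.1 p.2)).
      rewrite -(pair_big_dep _ Q (fun _ _ => 1%N)) /=.
      by apply: eq_bigr => x _; rewrite sum1_card.
    by move=> p; rewrite /Q !inE.
  have sumv : (\sum_(x in C :\ v) e x v = 2)%N.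
    rewrite -(deg v vC) -sum1_card big_mkcond [RHS]big_mkcond; apply: eq_bigr => x _.
    rewrite !inE (e_sym x); have [->|_] := eqVneq x v; first by rewrite e_irr andbF.
    by case: (x \in C) => //=; case: (e v x).
  have sum2 : (\sum_(x in C :\ v) 2 = #|C|.-1.*2)%N.
    by rewrite sum_nat_const (cardsD1 v C) vC muln2.
  have : (\sum_(x in C :\ v) (#|nb e (C :\ v) x| + e x v) = \sum_(x in C :\ v) 2)%N.
    by apply: eq_bigr => x /setD1P [_ /degD].
  rewrite big_split /= sumv sum2; move: C3 (\sum_(x in _) _).
  by move: #|C| => c c_gt2 s; lia.
have := subset_leq_card subP; rewrite cardsU (eqP (_ : _ :&: _ == set0)); last first.
  by rewrite setI_eq0.
rewrite cards0 subn0 card_imset //; move: cardP.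
by move: #|P| #|C| #|inside H C| => p c i; lia.
Qed.
End Cycle.

Section Contraction.
Variables (e : rel T) (U : {set T}) (v : T).
Hypotheses (e_sym : ssrbool.symmetric e) (e_irr : irreflexive e) (vU : v \in U).
Local Notation ev := (gcomp U e v).

Lemma gcomp_sym : ssrbool.symmetric ev.
Proof.
move=> i j; rewrite /gcomp e_sym eq_sym; congr (_ || _).
by apply/and5P/and5P => -[? ? ? ? ?]; split.
Qed.

Lemma gcomp_irr : irreflexive ev.
Proof. by move=> i; rewrite /gcomp e_irr eqxx. Qed.

Lemma gcomp_sub i j : e i j -> ev i j.
Proof. by rewrite /gcomp => ->. Qed.

Lemma gcompP i j : reflect (e i j \/ [/\ i != j, i \in U, j \in U, e v i & e v j]) (ev i j).
Proof.
by apply: (iffP orP) => -[?|H]; [left | right; apply/and5P | left | right; apply/and5P].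
Qed.

(** The edge [ab] between the neighbours of [v] replaces the path through [v]. A closed set contains
    both of [a], [b] or neither, so it becomes closed in the old cycle with or without [v] added. *)
Lemma cyc_contract C : C \subset U -> v \in C -> 3 < #|C| -> cyc e C ->
  cyc ev (C :\ v).
Proof.
move=> /subsetP CU vC C3 cycC.
have [a [b [nab eab nbv]]] := cyc_nb e_sym e_irr cycC vC C3.
have [_ deg conn] := cycC.
have nbvP w : w \in C -> e v w = (w \in [set a; b]) by move=> wC; rewrite -nbv inE wC.
have [aC bC] : a \in C /\ b \in C.
  have : (a \in nb e C v) && (b \in nb e C v) by rewrite nbv !inE !eqxx orbT.
  by rewrite !inE => /andP [/andP [-> _] /andP [-> _]].
have eva : e v a by rewrite nbvP // !inE eqxx.
have evb : e v b by rewrite nbvP // !inE eqxx orbT.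
have nav : a != v by apply: contraTneq eva => ->; rewrite e_irr.
have nbv' : b != v by apply: contraTneq evb => ->; rewrite e_irr.
have evE x w : x \in C -> w \in C -> x != a -> x != b -> ev x w = e x w.
  move=> xC wC xa xb; apply/gcompP/idP => [[//|[_ _ _ evx _]]|exw]; last by left.
  by move: evx; rewrite nbvP // !inE (negbTE xa) (negbTE xb).
have evP x w : x \in C -> w \in C -> ev x w ->
    [\/ e x w, x = a /\ w = b | x = b /\ w = a].
  move=> xC wC /gcompP [exw|[nxw _ _]]; first by constructor 1.
  rewrite !nbvP // !inE => /orP [] /eqP xE /orP [] /eqP wE;
    move: nxw; rewrite xE wE ?eqxx // => _; by [constructor 2 | constructor 3].
have evab : ev a b by apply/gcompP; right; split; rewrite ?CU.
have deg_end c d : c \in C -> d \in C -> c != v -> d != v -> c != d -> e v c ->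
    ~~ e c d -> (forall w, w \in C -> ev c w -> e c w \/ w = d) -> ev c d ->
    #|nb ev (C :\ v) c| = 2.
  move=> cC dC cv dv ncd evc ecd evc_only evcd.
  have -> : nb ev (C :\ v) c = d |: (nb e C c :\ v).
    apply/setP => w; rewrite !inE.
    have [->|nwd] := eqVneq w d; first by rewrite dC dv evcd.
    have [//|nwv /=] := eqVneq w v.
    case wC: (w \in C) => //=; apply/idP/idP => [/(evc_only _ wC) [//|wd]|].
      by rewrite wd eqxx in nwd.
    exact: gcomp_sub.
  rewrite cardsU1 !inE dv dC /= ecd /=.
  have vnb : v \in nb e C c by rewrite inE vC e_sym.
  by have := card_setD1 vnb; rewrite deg // => -[<-].
split.
- by have := card_setD1 vC; lia.
- move=> x /setD1P [nxv xC].
  have [xa|nxa] := eqVneq x a.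
    rewrite xa; apply: (deg_end a b) => // w wC.
    move=> /(evP _ _ aC wC) [|[_ ->]|[ab _]]; [by left | by right |].
    by rewrite ab eqxx in nab.
  have [xb|nxb] := eqVneq x b.
    rewrite xb; apply: (deg_end b a) => //; rewrite 1?eq_sym 1?e_sym 1?gcomp_sym //.
    move=> w wC /(evP _ _ bC wC) [|[ba _]|[_ ->]]; [by left| |by right].
    by rewrite ba eqxx in nab.
  rewrite -(deg x xC); congr #|pred_of_set _|; apply/setP => w; rewrite !inE.
  have [->|nwv] := eqVneq w v.
    by rewrite vC e_sym nbvP // !inE (negbTE nxa) (negbTE nxb).
  by case wC: (w \in C) => //=; apply: evE.
move=> X /subsetP XC X0 Xcl.
have XCC : X \subset C by apply/subsetP => x /XC /setD1P [].
have nvX : v \notin X by apply/negP => /XC; rewrite !inE eqxx.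
have Xcl' x w : x \in X -> w \in C -> e x w -> (w \in X) || (w == v).
  move=> xX wC exw; have [//|nwv] := eqVneq w v; first by rewrite orbT.
  by rewrite (Xcl x) ?inE ?nwv // gcomp_sub.
have abX : (a \in X) = (b \in X).
  by apply/idP/idP => cX; [apply: (Xcl a) | apply: (Xcl b)]; rewrite ?inE ?nav ?nbv' // gcomp_sym.
case aX: (a \in X); last first.
  suff XE : X = C by rewrite XE vC in nvX.
  apply: conn => // x w xX wC exw; case/orP: (Xcl' x w xX wC exw) => // /eqP wv.
  have := subsetP XCC x xX; move: exw; rewrite wv e_sym => evx xC.
  move: evx; rewrite nbvP // !inE => /orP [] /eqP xE.
    by rewrite -xE xX in aX.
  by rewrite abX -xE xX in aX.
have XE : v |: X = C.
  apply: conn.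
  - by rewrite subUset sub1set vC.
  - by apply/set0Pn; exists v; rewrite setU11.
  move=> x w /setU1P [->|xX] wC.
    by rewrite nbvP // !inE => /orP [] /eqP ->; rewrite -?abX aX orbT.
  by rewrite !inE orbC => /Xcl'; apply.
by rewrite -XE setU1K.
Qed.

(** The neighbours of [v] on [C] lie in the clique [kappa v], so completing [v] adds no edge inside
    [C]. *)
Lemma cyc_keep C kappa : v \notin C -> labeling e U C kappa -> cyc e C -> C \subset U ->
  cyc ev C.
Proof.
move=> vC [ksub kcl knb _] [C3 deg conn] /subsetP CU.
have evE x w : x \in C -> w \in C -> ev x w = e x w.
  move=> xC wC; apply/gcompP/idP => [[//|[nxw _ _ evx evw]]|]; last by left.
  have := kcl v x w vU vC (knb v x vU vC xC evx) (knb v w vU vC wC evw).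
  by rewrite /adjeq (negbTE nxw).
split=> // [x xC|X XC X0 Xcl].
  rewrite -(deg x xC); congr #|pred_of_set _|; apply/setP => w; rewrite !inE.
  by case wC: (w \in C) => //=; apply: evE.
apply: conn => // x w xX wC exw; apply: (Xcl x) => //; exact: gcomp_sub.
Qed.

Lemma labeling_keep C kappa : v \notin C -> labeling e U C kappa ->
  labeling ev U C kappa.
Proof.
move=> vC [ksub kcl knb kconst]; split=> //.
- move=> u p q uU uC pk qk; have := kcl u p q uU uC pk qk.
  by rewrite /adjeq => /orP [->//|/gcomp_sub ->]; rewrite orbT.
- move=> u p uU uC pC /gcompP [|[_ _ _ evu evp]]; first exact: knb.
  by rewrite -(kconst v u vU vC uU uC evu); apply: knb.
move=> u w uU uC wU wC /gcompP [|[_ _ _ evu evw]]; first exact: kconst.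
by rewrite -(kconst v u) // -(kconst v w).
Qed.

(** Now [v] lies outside the cycle and joins the components that were attached at [v]. All of them
    receive the two neighbours of [v] as label, which have just become adjacent. *)
Lemma labeling_contract C kappa : C \subset U -> v \in C -> labeling e U C kappa ->
  labeling ev U (C :\ v)
    (fun u => if (u == v) || (v \in kappa u) then nb e C v else kappa u).
Proof.
move=> /subsetP CU vC [ksub kcl knb kconst].
have nbC w : w \in nb e C v -> [/\ w \in C, e v w & w != v].
  rewrite inE => /andP [wC evw]; split=> //.
  by apply: contraTneq evw => ->; rewrite e_irr.
have outE u : u \in U -> u \notin C :\ v -> u = v \/ u \notin C.
  by rewrite !inE negb_and negbK => _ /orP [/eqP|]; [left|right].
have kv u w : u \in U -> u \notin C -> v \in kappa u -> w \in kappa u -> w != v -> w \in nb e C v.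
  move=> uU uC vk wk nwv; rewrite inE (subsetP (ksub u uU uC)) //=.
  by have := kcl u v w uU uC vk wk; rewrite /adjeq eq_sym (negbTE nwv).
split.
- move=> u uU /(outE u uU) uC; apply/subsetP => w; case: ifP => [_ /nbC [wC _ nwv]|uk wk].
    by rewrite !inE nwv.
  case: uC => [uv|uC]; first by rewrite uv eqxx in uk.
  rewrite !inE (subsetP (ksub u uU uC)) // andbT.
  by apply: contraFneq uk => <-; rewrite wk orbT.
- move=> u p q uU /(outE u uU) uC; case: ifP => [_ /nbC [pC evp _] /nbC [qC evq _]|uk].
    rewrite /adjeq; have [//|npq] := eqVneq p q.
    by apply/gcompP; right; split; rewrite ?CU.
  case: uC => [uv|uC]; first by rewrite uv eqxx in uk.
  move=> pk qk; have := kcl u p q uU uC pk qk.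
  by rewrite /adjeq => /orP [->//|/gcomp_sub ->]; rewrite orbT.
- move=> u p uU /(outE u uU) uC /setD1P [npv pC] eup.
  have evp_nb : e v p -> p \in nb e C v by rewrite inE pC.
  case: uC => [uv|uC].
    rewrite uv eqxx /=; apply: evp_nb; move: eup; rewrite uv => /gcompP [//|[_ _ _ + _]].
    by rewrite e_irr.
  case/gcompP: eup => [eup|[_ _ _ evu evp]].
    have pk := knb u p uU uC pC eup.
    by case: ifP => // /predU1P [uv|vk]; [rewrite uv vC in uC | apply: kv vk pk npv].
  by rewrite (knb u v) ?orbT // 1?e_sym // evp_nb.
move=> u w uU /(outE u uU) uC wU /(outE w wU) wC euw.
have toN t : t \in U -> t \notin C -> e v t -> v \in kappa t.
  by move=> tU tC evt; apply: knb => //; rewrite e_sym.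
case: uC wC => [uv|uC] [wv|wC].
- by rewrite uv wv.
- rewrite uv eqxx /= (toN w) ?orbT //; move: euw; rewrite uv => /gcompP [//|[_ _ _ + _]].
  by rewrite e_irr.
- rewrite wv eqxx /= (toN u) ?orbT //; move: euw; rewrite wv => /gcompP [|[_ _ _ _ +]].
    by rewrite e_sym.
  by rewrite e_irr.
case/gcompP: euw => [euw|[_ _ _ evu evw]].
  rewrite (kconst u w) //; have -> : (u == v) = false by apply: contraNF uC => /eqP ->.
  by have -> : (w == v) = false by apply: contraNF wC => /eqP ->.
by rewrite !toN ?orbT.
Qed.

(** The size condition drops the marked triangles through [v], which shrink to an edge. *)
Definition contract F : {set {set T}} := [set D in [set C :\ v | C in F] | 2 < #|D|].

Lemma valid_contract F : valid e U F -> valid ev U (contract F).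
Proof.
move=> [mark share]; split.
  move=> D; rewrite inE => /andP [/imsetP [C CF ->]] gt2.
  have [CU cycC [kappa lab]] := mark C CF.
  have sub : C :\ v \subset U by apply: subset_trans CU; apply: subsetDl.
  have [vC|vC] := boolP (v \in C).
    split=> //; last by eexists; apply: labeling_contract lab.
    by apply: cyc_contract => //; have := cardsD1 v C; rewrite vC; move: gt2; lia.
  have -> : C :\ v = C by apply/eqP; rewrite eqEsubset subsetDl subsetD1 subxx vC.
  by split=> //; [apply: cyc_keep lab _ _ | exists kappa; apply: labeling_keep].
move=> C' D'; rewrite !inE => /andP [/imsetP [C CF ->] _] /andP [/imsetP [D DF ->] _] ne.
have nCD : C != D by apply: contraNneq ne => ->.
apply: leq_trans (share C D CF DF nCD); apply: subset_leq_card.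
by apply: setISS; apply: subsetDl.
Qed.

End Contraction.

Lemma valid_delete e U F v : (forall C, C \in F -> v \notin C) -> valid e U F ->
  valid e (U :\ v) F.
Proof.
move=> nvF [mark share]; split=> // C CF.
have [CU cycC [kappa [ksub kcl knb kconst]]] := mark C CF; split=> //.
  by rewrite subsetD1 CU nvF.
exists kappa; split.
- by move=> u /setD1P [_ uU]; apply: ksub.
- by move=> u p q /setD1P [_ uU]; apply: kcl.
- by move=> u p /setD1P [_ uU]; apply: knb.
by move=> u w /setD1P [_ uU] uC /setD1P [_ wU]; apply: kconst.
Qed.

Lemma valid_sub e U F F' : F' \subset F -> valid e U F -> valid e U F'.
Proof.
move=> /subsetP sF [mark share]; split=> [C /sF|C D /sF CF /sF DF]; first exact: mark.
exact: share.
Qed.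

Lemma valid0 e U : valid e U set0.
Proof. by split=> [C|C D]; rewrite inE. Qed.


Lemma card_inside_le e U F H C : adm e U F H -> C \in F -> #|inside H C| <= #|C| - 2.
Proof. by case=> _ _; apply. Qed.

Section Augment.
Variables (e : rel T) (U : {set T}) (F : {set {set T}}) (v : T) (W : {set T})
  (H : {set T * T}).
Hypotheses (e_sym : ssrbool.symmetric e) (e_irr : irreflexive e) (vU : v \in U).
Local Notation ev := (gcomp U e v).
Hypotheses (WU : W \subset U) (validF : valid e U F).
Hypothesis admH : adm ev W (contract v F) H.

Let Nv (x : T) := (x == v) || (x \in U) && e v x.

(* The edges of [H] that were already edges before completing [v]; at most one
   edge of [H] is lost, since the closed neighbourhood of [v] became a clique. *)
Definition kept : {set T * T} := [set h in H | ~~ (Nv h.1 && Nv h.2)].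

Lemma keptP h : h \in kept -> [/\ h \in H, h.1 \in U, h.2 \in U, e h.1 h.2 & ~~ (Nv h.1 && Nv h.2)].
Proof.
rewrite inE => /andP [hH nN]; have [/(_ h hH) /and3P [h1 h2 eh] _ _] := admH.
split=> //; try exact: (subsetP WU).
case/gcompP: eh => // -[_ h1U h2U ev1 ev2].
by rewrite /Nv h1U h2U ev1 ev2 !orbT in nN.
Qed.

Lemma Nv_adjeq x y : Nv x -> Nv y -> adjeq ev x y.
Proof.
rewrite /Nv /adjeq; have [//|nxy] := eqVneq x y.
move=> /predU1P [xE|/andP [xU evx]] /predU1P [yE|/andP [yU evy]].
- by rewrite xE yE eqxx in nxy.
- by rewrite xE gcomp_sub.
- by rewrite yE gcomp_sub // e_sym.
by apply/gcompP; right.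
Qed.

Lemma card_kept : #|H| <= #|kept|.+1.
Proof.
have [_ dH _] := admH; rewrite -(cardsID kept H) -addn1 leq_add //.
  by apply: subset_leq_card; apply: subsetIr.
apply/card_le1_eqP => h h'; rewrite !inE => /andP [+ hH] /andP [+ h'H].
rewrite hH h'H !negbK => /andP [h1 h2] /andP [h'1 h'2].
by apply: dH => //; apply/and4P; split; apply: Nv_adjeq.
Qed.

Lemma inside_kept C : v \in C -> C \subset U -> inside kept C \subset inside H (C :\ v).
Proof.
move=> vC CU; apply/subsetP => h; rewrite [h \in inside _ _]inE => /and3P [hk h1 h2].
have [hH h1U h2U eh nN] := keptP hk; rewrite !inE hH h1 h2 !andbT /=.
apply/andP; split; apply: contra nN => /eqP hv.
  by rewrite /Nv hv eqxx h2U -hv eh orbT.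
by rewrite /Nv hv eqxx h1U -hv e_sym eh !orbT.
Qed.

Lemma contract_mem C : C \in F -> 3 < #|C| -> C :\ v \in contract v F.
Proof.
move=> CF gt3; rewrite inE; apply/andP; split; first by apply/imsetP; exists C.
have [vC|vC] := boolP (v \in C).
  by rewrite (card_setD1 vC) in gt3.
have -> : C :\ v = C by apply/eqP; rewrite eqEsubset subsetDl subsetD1 subxx vC.
exact: ltnW.
Qed.

(** The shortened cycle has limit [#|C| - 3], which leaves room on [C] for one edge at [v]. *)
Lemma card_inside_kept C : C \in F -> 3 < #|C| -> v \in C ->
  #|inside kept C| <= #|C| - 3.
Proof.
move=> CF gt3 vC; have [CU _ _] := validF.1 C CF.
apply: leq_trans (subset_leq_card (inside_kept vC CU)) _.
have := card_inside_le admH (contract_mem CF gt3).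
by rewrite (card_setD1 vC) subSS.
Qed.

Definition augment (A : {set T}) : {set T * T} := kept :|: [set (v, a) | a in A].

Section AugmentBy.
Variable A : {set T}.
Hypothesis Av : forall a, a \in A -> (a \in U) && e v a.
Hypothesis Aind : forall a b, a \in A -> b \in A -> a != b -> ~~ e a b.

Lemma kept_notin a : a \in A -> (v, a) \notin kept.
Proof.
move=> /Av aN; apply/negP => /keptP [_ _ _ _].
by rewrite /Nv /= eqxx aN orbT.
Qed.

Lemma card_augment : #|augment A| = #|kept| + #|A|.
Proof.
rewrite /augment cardsU (_ : _ :&: _ = set0) ?cards0 ?subn0.
  by rewrite card_imset // => a b [].
apply/eqP; rewrite setI_eq0; apply/pred0P => h /=; apply/negP => /andP [hk].
by case/imsetP=> a aA hE; move: hk; rewrite hE (negbTE (kept_notin aA)).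
Qed.

Lemma kept_common h a : h \in kept -> a \in A -> ~~ common e h (v, a).
Proof.
move=> /keptP [_ h1U h2U _ nN] _; apply: contra nN => /and4P [/= hv _ h2v _].
have toN x : x \in U -> adjeq e x v -> Nv x.
  by rewrite /Nv /adjeq => -> /orP [->//|]; rewrite e_sym => ->; rewrite orbT.
by rewrite !toN.
Qed.

Lemma common_sym h h' : common e h h' = common e h' h.
Proof.
rewrite /common !(adjeq_sym h'.1 _ e_sym) !(adjeq_sym h'.2 _ e_sym).
by apply/and4P/and4P => -[? ? ? ?]; split.
Qed.

Lemma cdisj_augment : cdisj e (augment A).
Proof.
have [_ dH _] := admH.
move=> h h'; rewrite !in_setU => /orP [hk|/imsetP [a aA ->]] /orP [h'k|/imsetP [b bA ->]].
- have [hH _ _ _ _] := keptP hk; have [h'H _ _ _ _] := keptP h'k.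
  move=> /and4P [c1 c2 c3 c4]; apply: dH => //.
  have sub x y : adjeq e x y -> adjeq ev x y.
    by rewrite /adjeq => /orP [->//|/(gcomp_sub U v) ->]; rewrite orbT.
  by apply/and4P; split; apply: sub.
- by move=> c; have := kept_common hk bA; rewrite c.
- by move=> c; have := kept_common h'k aA; rewrite common_sym c.
case/and4P=> _ _ _ /= ab; congr (_, _); move: ab; rewrite /adjeq.
by have [//|nab] := eqVneq a b; rewrite (negbTE (Aind aA bA nab)).
Qed.

Lemma inside_augment C :
  #|inside (augment A) C| <= #|inside kept C| + (if v \in C then #|A :&: C| else 0).
Proof.
have sub : inside (augment A) C \subset inside kept C :|:
    (if v \in C then [set (v, a) | a in A :&: C] else set0).
  apply/subsetP => h; rewrite inE => /andP [/setUP [hk|/imsetP [a aA ->]] /= hC].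
    by rewrite in_setU inE hk hC.
  case/andP: hC => -> aC; rewrite in_setU orbC; apply/orP; left.
  by apply: imset_f; rewrite inE aA.
apply: leq_trans (subset_leq_card sub) _; apply: leq_trans (leq_card_setU _ _) _.
rewrite leq_add2l; case: ifP => _; last by rewrite cards0.
exact: leq_imset_card.
Qed.

Lemma adm_augment :
  (forall C, C \in F -> v \in C -> 3 < #|C| -> #|inside kept C| + #|A :&: C| <= #|C| - 2) ->
  adm e U F (augment A).
Proof.
move=> bound; split; last 1 first.
- move=> C CF; have [CU cycC _] := validF.1 C CF.
  have gt2 : 2 < #|C| by case: cycC.
  (* A marked triangle may be absent from the contracted family, but it is a clique, so [cdisj]
     alone gives its limit 1. *)
  have [gt3|le3] := ltnP 3 #|C|; last first.
    have C3 : #|C| = 3 by apply/eqP; rewrite eqn_leq le3.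
    rewrite C3; apply: clique_inside cdisj_augment => x y.
    exact: (cyc3_clique e_irr cycC C3).
  apply: leq_trans (inside_augment C) _; case: ifP => vC; first exact: bound.
  rewrite addn0; have CE : C :\ v = C.
    by apply/eqP; rewrite eqEsubset subsetDl subsetD1 subxx vC.
  have := card_inside_le admH (contract_mem CF gt3); rewrite CE; apply: leq_trans.
  apply: subset_leq_card; apply/subsetP => h.
  by rewrite ![h \in inside _ _]inE => /andP [/keptP [-> _ _ _ _] ->].
- move=> h /setUP [/keptP [_ -> -> -> _] //|/imsetP [a /Av /andP [aU eva] ->]] /=.
  by rewrite vU aU.
exact: cdisj_augment.
Qed.

End AugmentBy.

Lemma adm_augment1 a : a \in U -> e v a ->
  adm e U F (augment [set a]) /\ #|augment [set a]| = #|kept|.+1.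
Proof.
move=> aU eva.
have Av b : b \in [set a] -> (b \in U) && e v b by rewrite inE => /eqP ->; rewrite aU.
split; last by rewrite card_augment // cards1 addn1.
apply: adm_augment => // [b c /set1P -> /set1P ->|C CF vC gt3]; first by rewrite eqxx.
have := card_inside_kept CF gt3 vC.
have : #|[set a] :&: C| <= 1 by rewrite -(cards1 a); apply/subset_leq_card/subsetIl.
by move: #|_ :&: C| #|inside _ _| #|C| gt3 => x y z; lia.
Qed.

Lemma adm_augment2 a b : a \in U -> e v a -> b \in U -> e v b -> a != b -> ~~ e a b ->
  (forall C, C \in F -> v \in C -> 3 < #|C| -> a \in C -> b \in C ->
     #|inside kept C| <= #|C| - 4) ->
  adm e U F (augment [set a; b]) /\ #|augment [set a; b]| = #|kept|.+2.
Proof.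
move=> aU eva bU evb nab eab bound.
have Av c : c \in [set a; b] -> (c \in U) && e v c.
  by rewrite !inE => /orP [] /eqP ->; rewrite ?aU ?bU.
split; last by rewrite card_augment // cards2 nab addn2.
apply: adm_augment => // [c d|C CF vC gt3].
  by rewrite !inE => /orP [] /eqP -> /orP [] /eqP ->; rewrite ?eqxx // e_sym.
have le3 := card_inside_kept CF gt3 vC.
have [/andP [aC bC]|nC] := boolP ((a \in C) && (b \in C)).
  have le4 := bound C CF vC gt3 aC bC.
  have : #|[set a; b] :&: C| <= 2.
    by have := subset_leq_card (subsetIl [set a; b] C); rewrite cards2 nab.
  by move: #|_ :&: C| #|inside _ _| #|C| gt3 le3 le4 => x y z; lia.
have : #|[set a; b] :&: C| <= 1.
  apply/card_le1_eqP => c d; rewrite !inE.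
  move=> /andP [/orP [] /eqP -> cC] /andP [/orP [] /eqP -> dC] //;
    by rewrite cC dC in nC.
by move: #|_ :&: C| #|inside _ _| #|C| gt3 le3 => x y z; lia.
Qed.

End Augment.

(* Completing [v] and deleting it lowers the maximal size of an admissible set: at
   most one edge is lost and two non-adjacent edges at [v] can be added. *)
Lemma adm_grow e U F v H a b :
  ssrbool.symmetric e -> irreflexive e -> v \in U -> valid e U F ->
  adm (gcomp U e v) (U :\ v) (contract v F) H ->
  a \in U -> e v a -> b \in U -> e v b -> a != b -> ~~ e a b ->
  exists2 H', adm e U F H' & #|H| < #|H'|.
Proof.
move=> e_sym e_irr vU validF admH aU eva bU evb nab eab.
have WU : U :\ v \subset U by apply: subsetDl.
have aug1 := adm_augment1 e_sym e_irr vU WU validF admH.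
have aug2 := adm_augment2 e_sym e_irr vU WU validF admH.
pose k := kept e U v H.
have [le_Hk|lt_kH] := leqP #|H| #|k|.
  have [admA cardA] := aug1 a aU eva; exists (augment e U v H [set a]) => //.
  by rewrite cardA ltnS.
have le_H : #|H| <= #|k|.+1 := card_kept e_sym admH.
(* One edge was lost, so two must be added. A long marked cycle through [v] with only one of [c],
   [d] has room by [card_inside_kept]; one containing both needs room for two. *)
suff [c [d [[cU evc dU evd] [ncd ecd bound]]]] : exists c d,
    [/\ c \in U, e v c, d \in U & e v d] /\ [/\ c != d, ~~ e c d &
    forall C, C \in F -> v \in C -> 3 < #|C| -> c \in C -> d \in C ->
      #|inside k C| <= #|C| - 4].
  have [admA cardA] := aug2 c d cU evc dU evd ncd ecd bound.
  exists (augment e U v H [set c; d]) => //.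
  by rewrite cardA !ltnS.
have [h0 /setDP [h0H nk0]] : exists h, h \in H :\: k.
  apply/set0Pn; rewrite setD_eq0; apply: contraTN lt_kH => /subset_leq_card.
  by rewrite leqNgt.
have [Hedge _ _] := admH; have /and3P [] := Hedge h0 h0H.
move=> /setD1P [n1 h1U] /setD1P [n2 h2U] eh0.
have [ev1 ev2] : e v h0.1 /\ e v h0.2.
  move: nk0; rewrite inE h0H /= negbK (negbTE n1) (negbTE n2) /=.
  by move=> /andP [/andP [_ ->] /andP [_ ->]].
have n12 : h0.1 != h0.2 by apply: contraTneq eh0 => ->; rewrite gcomp_irr.
have uniqC C D w : C \in F -> D \in F -> v \in C -> v \in D -> w != v ->
    w \in C -> w \in D -> D = C.
  move=> CF DF vC vD nwv wC wD; apply/eqP; apply: contraTT isT => nDC.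
  have := validF.2 D C DF CF nDC; rewrite leqNgt => /negP; case.
  have <- : #|[set v; w]| = 2 by rewrite cards2 eq_sym nwv.
  apply: subset_leq_card; apply/subsetP => t.
  by rewrite !inE => /orP [] /eqP ->; rewrite ?vC ?vD ?wC ?wD.
have nbadj C x y : C \in F -> 3 < #|C| -> v \in C -> x \in C -> y \in C ->
    e v x -> e v y -> x != y -> ~~ e x y.
  move=> CF gt3 vC xC yC evx evy nxy; have [_ cycC _] := validF.1 C CF.
  have [a1 [b1 [_ eab1 nbv]]] := cyc_nb e_sym e_irr cycC vC gt3.
  have : (x \in [set a1; b1]) && (y \in [set a1; b1]) by rewrite -nbv !inE xC yC evx.
  rewrite !inE => /andP [/orP [] /eqP xE /orP [] /eqP yE].
  - by rewrite xE yE eqxx in nxy.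
  - by rewrite xE yE.
  - by rewrite xE yE e_sym.
  by rewrite xE yE eqxx in nxy.
have [[C [CF gt3 vC]]|noC] := classic (exists C, [/\ C \in F, 3 < #|C| & v \in C]);
  last first.
  by exists a, b; do 2!split=> //; move=> C CF vC gt3; case: noC; exists C.
have [CU cycC [kappa [ksub kcl knb _]]] := validF.1 C CF.
(* If the lost edge joins the two neighbours of [v] on [C], it used one of the [#|C| - 3] places on
   the shortened cycle. At most [#|C| - 4] kept edges then lie on [C], and both new edges fit. *)
have [/andP [h1C h2C]|nhC] := boolP ((h0.1 \in C) && (h0.2 \in C)).
  exists h0.1, h0.2; do 2!split=> //; first exact: nbadj h2C _ _ n12.
  move=> D DF vD _ h1D _; have -> := uniqC C D _ CF DF vC vD n1 h1C h1D.
  have sub : h0 |: inside k C \subset inside H (C :\ v).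
    rewrite subUset sub1set (inside_kept e_sym WU admH vC CU) andbT.
    by rewrite !inE h0H n1 n2 h1C h2C.
  have := subset_leq_card sub; rewrite cardsU1 [h0 \in inside _ _]inE (negbTE nk0) /=.
  have := card_inside_le admH (contract_mem v CF gt3).
  rewrite (card_setD1 vC) subSS; move: #|inside k C| #|inside H _| #|C :\ v|.
  by clear; move=> x y z; lia.
(* Otherwise one end [c] of the lost edge is off [C]. As [kappa c] is a clique, some neighbour [t]
   of [v] on [C] is not adjacent to [c]. Only [C] among the marked cycles contains [v] and [t], so
   none contains [v], [c] and [t]. *)
have [c [cU evc ncv nCc]] : exists c, [/\ c \in U, e v c, c != v & c \notin C].
  by case/nandP: nhC => nC; [exists h0.1 | exists h0.2].
have [a1 [b1 [nab1 eab1 nbv]]] := cyc_nb e_sym e_irr cycC vC gt3.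
have [t [tC evt ect]] : exists t, [/\ t \in C, e v t & ~~ e c t].
  have nbP w : w \in [set a1; b1] -> w \in C /\ e v w by rewrite -nbv inE => /andP.
  have [a1C eva1] := nbP a1 (set21 _ _); have [b1C evb1] := nbP b1 (set22 _ _).
  have [eca|] := boolP (e c a1); last by exists a1.
  exists b1; split=> //; apply/negP => ecb.
  have := kcl c a1 b1 cU nCc (knb c a1 cU nCc a1C eca) (knb c b1 cU nCc b1C ecb).
  by rewrite /adjeq (negbTE nab1) (negbTE eab1).
have ntv : t != v by apply: contraTneq evt => ->; rewrite e_irr.
exists c, t; split; first by split=> //; exact: (subsetP CU).
split=> //; first by apply: contraNneq nCc => ->.
move=> D DF vD _ cD tD; have DC := uniqC C D t CF DF vC vD ntv tC tD.
by rewrite -DC cD in nCc.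
Qed.

Lemma adm_complete e U F v H a :
  ssrbool.symmetric e -> irreflexive e -> v \in U -> valid e U F ->
  adm (gcomp U e v) U (contract v F) H -> a \in U -> e v a ->
  exists2 H', adm e U F H' & #|H| <= #|H'|.
Proof.
move=> e_sym e_irr vU validF admH aU eva.
have [admA cardA] := adm_augment1 e_sym e_irr vU (subxx U) validF admH aU eva.
exists (augment e U v H [set a]) => //.
by rewrite cardA; apply: card_kept admH.
Qed.

(** The marked cycles through [v] lose their mark, but on the remaining path their limit holds
    automatically. *)
Lemma adm_delete e U F v H :
  ssrbool.symmetric e -> irreflexive e -> valid e U F ->
  adm e (U :\ v) [set C in F | v \notin C] H -> adm e U F H.
Proof.
move=> e_sym e_irr validF [Hedge dH bound]; split=> // [h /Hedge|C CF].
  by rewrite !inE => /and3P [/andP [_ ->] /andP [_ ->] ->].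
have [vC|vC] := boolP (v \in C); last by apply: bound; rewrite inE CF.
have [_ cycC _] := validF.1 C CF.
apply: (cyc_del_edges e_sym e_irr cycC vC dH) => h /Hedge.
by rewrite !inE => /and3P [/andP [-> _] /andP [-> _] ->].
Qed.

Lemma adm_edge e U F v w :
  valid e U F -> v \in U -> w \in U -> e v w -> adm e U F [set (v, w)].
Proof.
move=> validF vU wU evw; split.
- by move=> h /set1P ->; rewrite /= vU wU.
- by move=> h h' /set1P -> /set1P ->.
move=> C CF; have [_ [gt2 _ _] _] := validF.1 C CF.
have : #|inside [set (v, w)] C| <= 1.
  by rewrite -(cards1 (v, w)); apply: subset_leq_card; apply/subsetP => h; rewrite inE => /andP [].
by move=> /leq_trans; apply; rewrite subn_gt0.
Qed.

(* In a disjoint union of cliques every marked cycle is a triangle. *)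
Lemma adm_transitive e U F H :
  valid e U F ->
  (forall i j k, i \in U -> j \in U -> k \in U -> e i j -> e j k -> i != k -> e i k) ->
  (forall h, h \in H -> [&& h.1 \in U, h.2 \in U & e h.1 h.2]) -> cdisj e H ->
  adm e U F H.
Proof.
move=> validF e_tr Hedge dH; split=> // C CF.
have [/subsetP CU cycC _] := validF.1 C CF; have [gt2 _ _] := cycC.
apply: leq_trans (_ : 1 <= _); last by rewrite subn_gt0.
apply: clique_inside dH => x y xC yC; apply: (cyc_transitive_clique cycC) => // i j k.
by move=> iC jC kC; apply: e_tr; apply: CU.
Qed.

End MarkedCycles.

(** * Regularity bound for graphs with marked cycles *)

Section MarkedRegularity.
Variables (K : fieldType) (n : nat).

Theorem Greg_marked (e : rel 'I_n) U F N :
  ssrbool.symmetric e -> irreflexive e -> valid e U F ->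
  (forall H, adm e U F H -> (#|H| <= N)%N) -> Greg K U e N%:Z.
Proof.
have [k] := ubnP #|[set p : 'I_n * 'I_n | [&& p.1 \in U, p.2 \in U & ~~ e p.1 p.2]]|.
elim: k e U F N => // k IHk e U F N lt_k e_sym e_irr validF HN.
have IHdel e' v N' F' : ssrbool.symmetric e' -> irreflexive e' -> (forall i j, e i j -> e' i j) ->
    v \in U -> valid e' (U :\ v) F' ->
    (forall H, adm e' (U :\ v) F' H -> (#|H| <= N')%N) -> Greg K (U :\ v) e' N'%:Z.
  move=> e'_sym e'_irr ee' vU validF' HN'; apply: (IHk e' _ F') => //.
  rewrite ltnS in lt_k; apply: leq_trans lt_k; apply: proper_card; apply/properP; split.
    apply/subsetP => p; rewrite !inE => /and3P [/andP [_ ->] /andP [_ ->]] /=.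
    by apply: contra; apply: ee'.
  by exists (v, v); rewrite !inE /= ?vU ?e_irr ?eqxx.
have [[v [a [b [vU aU bU [eva evb nab eab]]]]]|simplicial] := classic (exists v a b,
    [/\ v \in U, a \in U, b \in U & [/\ e v a, e v b, a != b & ~~ e a b]]).
  have ev_sym := gcomp_sym U v e_sym; have ev_irr := gcomp_irr U v e_irr.
  have N_gt0 : (0 < N)%N.
    by rewrite -(cards1 (v, a)); apply: HN; apply: adm_edge.
  apply: (Greg_ohtani e_irr vU).
  - apply: (IHk _ _ (contract v F)) => //; last first.
    + move=> H admH; have [H' admH' le_H] := adm_complete e_sym e_irr vU validF admH aU eva.
      exact: leq_trans le_H (HN _ admH').
    + exact: valid_contract.
    rewrite ltnS in lt_k; apply: leq_trans lt_k; apply: proper_card; apply/properP; split.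
      apply/subsetP => p; rewrite !inE => /and3P [-> ->] /=.
      by apply: contra; apply: gcomp_sub.
    exists (a, b); rewrite !inE /= ?aU ?bU //= negbK.
    by rewrite /gcomp nab aU bU eva evb orbT.
  - apply: (IHdel e v N [set C in F | v \notin C]) => //.
      apply: valid_delete => [C|]; first by rewrite inE => /andP [].
      by apply: valid_sub validF; apply/subsetP => C; rewrite inE => /andP [].
    by move=> H admH; apply: HN; apply: adm_delete admH.
  case: N HN N_gt0 => // N HN _; rewrite (_ : N.+1%:Z - 1 = N%:Z); last by lia.
  apply: (IHdel _ _ _ (contract v F)) => //; first by move=> i j; apply: gcomp_sub.
    apply: valid_delete; last exact: valid_contract.
    by move=> C; rewrite inE => /andP [/imsetP [D _ ->] _]; rewrite !inE eqxx.
  move=> H admH.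
  have [H' admH' lt_H] := adm_grow e_sym e_irr vU validF admH aU eva bU evb nab eab.
  by rewrite -ltnS; apply: leq_trans lt_H (HN _ admH').
have e_tr i j l : i \in U -> j \in U -> l \in U -> e i j -> e j l -> i != l -> e i l.
  move=> iU jU lU eij ejl nil; apply: contraT => eil; case: simplicial.
  by exists j, i, l; do 2!split=> //; rewrite e_sym.
have [[v [w [vU wU evw]]]|noe] := classic (exists v w, [/\ v \in U, w \in U & e v w]);
  last first.
  apply: Greg_edgeless => // i j iU jU; apply/negP => eij.
  by apply: noe; exists i, j.
have admT := adm_transitive validF e_tr.
apply: (Greg_clique e_sym e_tr vU).
  apply: (IHdel e v N set0) => //; first exact: valid0.
  move=> H [Hedge dH _]; apply: HN; apply: admT => // h /Hedge.
  by rewrite !inE => /and3P [/andP [_ ->] /andP [_ ->] ->].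
set Q := v |: _; have vQ : v \in Q by rewrite setU11.
have N_gt0 : (0 < N)%N.
  by rewrite -(cards1 (v, w)); apply: HN; apply: adm_edge.
case: N HN IHdel N_gt0 => // N HN _ _; rewrite (_ : N.+1%:Z - 1 = N%:Z); last by lia.
apply: (IHk e _ set0) => //; last first.
(* The edge [(v, w)] of the removed clique can be added to [H], which accounts for the bound
   [N - 1]. *)
- move=> H [Hedge dH _].
  have HU h : h \in H -> [/\ h.1 \in U, h.2 \in U, h.1 \notin Q & e h.1 h.2].
    by move=> /Hedge /and3P [/setDP [? ?] /setDP [? ?] ?].
  have nvwH : (v, w) \notin H by apply/negP => /HU [_ _] /=; rewrite vQ.
  have nadj h : h \in H -> ~~ adjeq e v h.1.
    move=> /HU [h1U _ h1Q _]; apply: contra h1Q; rewrite !inE h1U /adjeq eq_sym.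
    by [].
  rewrite -ltnS -[#|H|.+1]add1n; have := cardsU1 (v, w) H; rewrite nvwH => <-.
  apply: HN; apply: admT.
    by move=> h /setU1P [->|/HU [-> -> _ ->]] //=; rewrite vU wU.
  move=> h h' /setU1P [->|hH] /setU1P [->|h'H] //.
  + by case/and4P=> /= c _ _ _; have := nadj _ h'H; rewrite c.
  + case/and4P=> /= c _ _ _; have := nadj _ hH.
    by rewrite adjeq_sym // c.
  exact: dH.
- exact: valid0.
rewrite ltnS in lt_k; apply: leq_trans lt_k; apply: proper_card; apply/properP; split.
  by apply/subsetP => p; rewrite !in_set => /and3P [/andP [_ ->] /andP [_ ->] ->].
by exists (v, v); rewrite in_set /= ?vU ?e_irr // in_setD vQ.
Qed.

End MarkedRegularity.

(** * Induced cycles and blocks *)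

Section Blocks.
Local Open Scope nat_scope.
Variables (T : finType) (e : rel T).
Hypotheses (e_sym : ssrbool.symmetric e) (e_irr : irreflexive e).
Implicit Types (A B C D W : {set T}) (H : subgraph T).

Definition within A : rel T := fun x y => [&& x \in A, y \in A & e x y].
Definition linked A (x y : T) : bool := connect (within A) x y.

Lemma within_sym A : ssrbool.symmetric (within A).
Proof. by move=> x y; rewrite /within e_sym andbCA. Qed.

Lemma linked_sym A x y : linked A x y = linked A y x.
Proof. exact: (sym_connect_sym (within_sym A)). Qed.

Lemma linked_trans A x y z : linked A x y -> linked A y z -> linked A x z.
Proof. exact: connect_trans. Qed.

Lemma linkedS A B x y : A \subset B -> linked A x y -> linked B x y.
Proof.
move=> /subsetP AB; apply: connect_sub => a b /and3P [/AB aB /AB bB eab].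
by apply: connect1; rewrite /within aB bB.
Qed.

Lemma linked1 A x y : x \in A -> y \in A -> e x y -> linked A x y.
Proof. by move=> xA yA exy; apply: connect1; rewrite /within xA yA. Qed.

Lemma linked_closed A (X : {pred T}) x y : linked A x y -> x \in X ->
  (forall a b, a \in X -> within A a b -> b \in X) -> y \in X.
Proof.
move=> /connectP [s + ->] xX cl; elim: s x xX => //= a s IHs x xX /andP [xa].
by apply: IHs; apply: cl xa.
Qed.

Lemma sorted_linked A (s : seq T) x y : sorted e s -> {subset s <= A} ->
  x \in s -> y \in s -> linked A x y.
Proof.
case: s => // a s; rewrite /= => pas sA.
have pwas : path (within A) a s.
  elim: s a pas sA => //= b s IHs a /andP [eab pbs] sA.
  rewrite /within !sA ?eab ?inE ?eqxx ?orbT //=; apply: IHs => // z zs.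
  by apply: sA; rewrite inE zs orbT.
have la z : z \in a :: s -> linked A a z by apply: path_connect.
by move=> /la ax /la ay; apply: linked_trans ay; rewrite linked_sym.
Qed.

Lemma adj_induced W x y : adj (induced e W) x y = within W x y.
Proof. by rewrite /adj inE. Qed.

Section InducedCycle.
Variables (k : nat) (W : {set T}).
Hypothesis cycW : is_cycle k (induced e W).

Lemma is_cycle_tuple : exists c : seq T, [/\ uniq c, size c = k, W =i c, 2 < k &
  forall x y, x \in W -> y \in W -> e x y = (y == next c x) || (x == next c y)].
Proof.
have /andP [k_gt2 /existsP [c /and3P [Uc /eqP WE adjE]]] := cycW.
exists c; split=> //; first by rewrite size_tuple.
  by move=> x; rewrite [W]WE inE.
move=> x y xW yW.
have := forall_inP (forall_inP adjE x xW) y yW; rewrite adj_induced => /eqP <-.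
by rewrite /within xW yW.
Qed.

Lemma is_cycle_card : k = #|W|.
Proof.
have [c [Uc <- WE _ _]] := is_cycle_tuple.
by rewrite (eq_card WE) (card_uniqP Uc).
Qed.

Lemma is_cycle_linked v x y : v \in W -> x \in W :\ v -> y \in W :\ v ->
  linked (W :\ v) x y.
Proof.
have [c [Uc _ WE _ eE]] := is_cycle_tuple => vW xW yW.
have ec : cycle e c.
  apply: cycle_from_next => // z zc; rewrite eE ?WE ?mem_next //.
  by rewrite eqxx.
have [i s rotc] := rot_to (etrans (esym (WE v)) vW).
have memE z : z \in W :\ v -> z \in s.
  by rewrite in_setD1 WE -(mem_rot i) rotc inE => /andP [/negbTE ->].
have sW : {subset s <= W :\ v}.
  move=> z zs; rewrite in_setD1 WE -(mem_rot i) rotc inE zs orbT andbT.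
  by apply: contraTneq zs => ->; have := rot_uniq i c; rewrite rotc Uc => /andP [].
apply: (@sorted_linked _ s); rewrite ?memE //.
have : cycle e (rot i c) by rewrite rot_cycle.
rewrite rotc /= rcons_path => /andP [+ _].
exact: path_sorted.
Qed.

Lemma is_cycle_cyc : cyc e W.
Proof.
have [c [Uc sc WE k_gt2 eE]] := is_cycle_tuple.
have W_gt2 : 2 < #|W| by rewrite -is_cycle_card.
split=> // [x xW|X /subsetP XW /set0Pn [x xX] Xcl].
  have xc : x \in c by rewrite -WE.
  have nbE : nb e W x = [set next c x; prev c x].
    apply/setP => y; rewrite !inE; apply/andP/orP => [[yW]|].
      rewrite eE // => /orP [->|/eqP ->]; first by left.
      by right; rewrite prev_next.
    case=> /eqP ->; rewrite WE ?mem_next ?mem_prev xc; split=> //.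
      by rewrite eE ?WE ?mem_next // eqxx.
    by rewrite eE ?WE ?mem_prev // next_prev // eqxx orbT.
  rewrite nbE cards2; suff -> : next c x != prev c x by [].
  apply/eqP => E; have nn : next c (next c x) = x by rewrite E next_prev.
  have [i s rotc] := rot_to xc.
  have Ur : uniq (x :: s) by rewrite -rotc rot_uniq.
  move: nn; rewrite -!(next_rot i Uc) rotc.
  have : 2 < size (x :: s) by rewrite -rotc size_rot sc.
  case: s Ur {rotc} => [|a [|b s]] //= /and3P [+ + _] _.
  rewrite !inE !negb_or !eqxx => /and3P [xa xb _] /andP [ab _].
  by rewrite eq_sym (negbTE xa) => bx; rewrite bx eqxx in xb.
apply/eqP; rewrite eqEsubset; apply/andP; split; apply/subsetP => // y yW.
have [<-//|nxy] := eqVneq x y.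
have [v vW] : exists v, v \in W :\: [set x; y].
  apply/set0Pn; rewrite setD_eq0; apply: contraTN W_gt2 => /subset_leq_card.
  by rewrite cards2 nxy -leqNgt.
move: vW; rewrite !inE negb_or => /andP [/andP [vx vy] vW].
have xW := XW x xX.
have : linked (W :\ v) x y.
  by apply: is_cycle_linked; rewrite ?in_setD1 1?eq_sym ?vx ?vy.
move=> /linked_closed; apply; first exact: xX.
move=> a b aX /and3P [_ /setD1P [_ bW] eab]; exact: Xcl eab.
Qed.

End InducedCycle.

Lemma block_ex H : subgraph_of e H -> connected_no_cut H ->
  exists2 B : subgraph T, block e B & subgraph_le H B.
Proof.
have [k] := ubnP (#|{: T}| + #|{: T * T}| - (#|H.1| + #|H.2|)).
elim: k H => // k IHk H; rewrite ltnS => le_k subH nocutH.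
have le_refl : subgraph_le H H by rewrite /subgraph_le !subxx.
have [maxH|] := classic (forall H' : subgraph T, subgraph_of e H' ->
    connected_no_cut H' -> subgraph_le H H' -> H' = H).
  by exists H.
move=> /not_all_ex_not [H' nH'].
have [subH' [nocutH' [leH ne]]] : subgraph_of e H' /\ connected_no_cut H' /\
    subgraph_le H H' /\ H' <> H.
  by do 3!(split; first by apply: NNPP => n; apply: nH'); apply: contra_not nH' => ->.
have [|B blockB leB] := IHk H' _ subH' nocutH'.
- apply: leq_trans le_k; have /andP [sub1 sub2] := leH.
  have le1 := subset_leq_card sub1; have le2 := subset_leq_card sub2.
  have m1 := max_card (mem H'.1); have m2 := max_card (mem H'.2).
  have lt12 : #|H.1| + #|H.2| < #|H'.1| + #|H'.2|.
    rewrite ltn_neqAle leq_add // andbT; apply/eqP => E.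
    case: ne; rewrite [H]surjective_pairing [H']surjective_pairing.
    have /eqP -> : H.1 == H'.1 by rewrite eqEcard sub1 -(leq_add2r #|H.2|) E leq_add2l.
    have /eqP -> : H.2 == H'.2 by rewrite eqEcard sub2 -(leq_add2l #|H.1|) E leq_add2r.
    by [].
  by apply: ltn_sub2l => //; apply: leq_trans lt12 (leq_add m1 m2).
exists B => //; move: leH leB => /andP [s1 s2] /andP [s3 s4].
by rewrite /subgraph_le (subset_trans s1) ?(subset_trans s2).
Qed.

Lemma induced_subgraph W : subgraph_of e (induced e W).
Proof.
split=> x y; first by rewrite !adj_induced within_sym.
by rewrite adj_induced.
Qed.

Lemma induced_no_cut W : 2 < #|W| ->
  (forall v x y, v \in W -> x \in W :\ v -> y \in W :\ v -> linked (W :\ v) x y) ->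
  connected_no_cut (induced e W).
Proof.
move=> W_gt2 lW.
have W0 : W != set0 by rewrite -card_gt0 (leq_trans _ W_gt2).
split; first split=> // x y xW yW.
  have [v vW] : exists v, v \in W :\: [set x; y].
    apply/set0Pn; rewrite setD_eq0; apply: contraTN W_gt2 => /subset_leq_card.
    by rewrite cards2 -leqNgt => /leq_trans; apply; case: (x != y).
  move: vW; rewrite !inE negb_or => /andP [/andP [vx vy] vW].
  have : linked W x y.
    by apply: linkedS (subsetDl W [set v]) _; apply: lW; rewrite ?inE 1?eq_sym ?vx ?vy.
  by apply: connect_sub => a b ab; apply: connect1; rewrite adj_induced.
move=> v [vW [x [y [xW yW _ /negP]]]]; apply.
have := lW v x y vW xW yW; apply: connect_sub => a b /and3P [/setD1P [av aW] /setD1P [bv bW] eab].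
by apply: connect1; rewrite /adj !inE /= aW bW eab av.
Qed.

Hypothesis blocksG : forall H : subgraph T, block e H ->
  (exists k : nat, is_cycle k H) \/ is_complete H.

Definition long_cycle C : bool := (3 < #|C|) && is_cycle #|C| (induced e C).

Lemma long_cycle_cyc C : long_cycle C -> cyc e C.
Proof. by case/andP=> _; apply: is_cycle_cyc. Qed.

(* A 2-connected induced subgraph containing a long induced cycle lies in a
   block, which must be a cycle; so it contains no vertex adjacent to [C]. *)
Lemma long_cycle_block C W p u : long_cycle C -> C \subset W ->
  connected_no_cut (induced e W) -> p \in C -> u \in W -> u \notin C -> ~~ e u p.
Proof.
move=> lcC /subsetP CW nocutW pC uW uC; apply/negP => eup.
have [C_gt3 _] := andP lcC; have [_ deg _] := long_cycle_cyc lcC.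
have [B blockB /andP [le1 le2]] := block_ex (induced_subgraph W) nocutW.
have [[subB1 subB] _ _] := blockB.
have adjB x y : x \in W -> y \in W -> e x y -> adj B x y.
  by move=> xW yW exy; apply: (subsetP le2); rewrite inE /= xW yW.
have vB x : x \in W -> x \in verts B by apply: (subsetP le1).
have [[k cycB]|complB] := blocksG blockB; last first.
  have : C :\ p \subset nb e C p.
    apply/subsetP => y /setD1P [yp yC]; rewrite inE yC /=.
    have /subB /and3P [_ _ //] : adj B p y.
    have := forall_inP (forall_inP complB p (vB p (CW p pC))) y (vB y (CW y yC)).
    by rewrite eq_sym yp.
  move=> /subset_leq_card; rewrite deg // leqNgt => /negP; apply.
  by move: C_gt3; rewrite (card_setD1 pC).
have /andP [_ /existsP [c /and3P [Uc _ adjE]]] := cycB.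
have nbB y : y \in W -> e p y -> y \in [set next c p; prev c p].
  move=> yW epy; have := forall_inP (forall_inP adjE p (vB p (CW p pC))) y (vB y yW).
  rewrite (adjB p y (CW p pC) yW epy) !inE => /eqP/esym/orP [->//|/eqP ->].
  by rewrite prev_next // eqxx orbT.
have : u |: nb e C p \subset [set next c p; prev c p].
  apply/subsetP => y /setU1P [->|]; first by apply: nbB => //; rewrite e_sym.
  by rewrite inE => /andP [yC]; apply: nbB; apply: CW.
move=> /subset_leq_card; rewrite cardsU1 deg // inE (negbTE uC) /= cards2.
by case: (_ != _).
Qed.

Lemma long_cycle_linked C r r' : long_cycle C -> r \in C -> r' \in C -> linked C r r'.
Proof.
move=> /andP [C_gt3 cycC] rC r'C.
have [v] : exists v, v \in C :\: [set r; r'].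
  apply/set0Pn; rewrite setD_eq0; apply: contraTN C_gt3 => /subset_leq_card.
  by rewrite cards2 -leqNgt => /leq_trans; apply; case: (r != r').
rewrite !inE negb_or => /andP [/andP [vr vr'] vC].
apply: linkedS (subsetDl C [set v]) _.
by apply: (is_cycle_linked cycC); rewrite ?in_setD1 1?eq_sym ?vr ?vr'.
Qed.

Lemma path_within A u s : u \in A -> path (within A) u s ->
  sorted e (u :: s) /\ {subset u :: s <= A}.
Proof.
elim: s u => [|a s IHs] u uA /=; first by move=> _; split=> // z; rewrite inE => /eqP ->.
move=> /andP [/and3P [_ aA eua] /(IHs a aA) [srt sub]]; split.
  by rewrite eua.
by move=> z; rewrite inE => /predU1P [->|] //; apply: sub.
Qed.

(** If [p] and [q] differed, [C] with a simple path from [u] to [w] outside it would induce a graph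
    without cut vertices, against [long_cycle_block]. *)
Lemma long_cycle_ear C p q u w : long_cycle C -> p \in C -> q \in C ->
  u \notin C -> w \notin C -> e u p -> e w q -> linked (~: C) u w -> p = q.
Proof.
move=> lcC pC qC uC wC eup ewq /connectP [s0 ps0 w_last0].
apply/eqP; apply: contraT => npq; have /andP [C_gt3 cycC] := lcC.
have [s [ps Us w_last]] : exists s,
    [/\ path (within (~: C)) u s, uniq (u :: s) & w = last u s].
  by rewrite w_last0; case/shortenP: ps0 => s ps Us _; exists s.
have [srt sC] : sorted e (u :: s) /\ {subset u :: s <= ~: C}.
  by apply: path_within ps; rewrite inE.
pose t := u :: s; pose W := C :|: [set z in t].
have CW : C \subset W by apply: subsetUl.
have tW z : z \in t -> z \in W by move=> zt; rewrite in_setU in_set zt orbT.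
have ut : u \in t by rewrite mem_head.
have wt : w \in t by rewrite w_last mem_last.
(* For [v] on [C], the whole path leads to whichever of [p], [q] differs from [v]. For [v] on the
   path, the part before it leads to [p] and the part after it to [q]. *)
have toC v x : v \in W -> x \in W :\ v -> exists2 r, r \in C :\ v & linked (W :\ v) x r.
  move=> vW /setD1P [xv]; rewrite in_setU => /orP [xC|].
    by exists x; [rewrite in_setD1 xv | apply: connect0].
  rewrite in_set => xt; have [vC|vC] := boolP (v \in C).
    have tWv : {subset t <= W :\ v}.
      move=> z zt; rewrite in_setD1 tW // andbT.
      by apply: contraTneq (sC z zt) => ->; rewrite inE vC.
    have [pv|npv] := eqVneq p v.
      have nqv : q != v by rewrite -pv eq_sym.
      exists q; first by rewrite in_setD1 nqv.
      apply: linked_trans (sorted_linked srt tWv xt wt) _.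
      by apply: (linked1 _ _ ewq); [apply: tWv | rewrite in_setD1 nqv (subsetP CW)].
    exists p; first by rewrite in_setD1 npv.
    apply: linked_trans (sorted_linked srt tWv xt ut) _.
    by apply: (linked1 _ _ eup); [apply: tWv | rewrite in_setD1 npv (subsetP CW)].
  have vt : v \in t by move: vW; rewrite in_setU in_set (negbTE vC).
  have CWv z : z \in C -> z \in W :\ v.
    by move=> zC; rewrite in_setD1 (subsetP CW) // andbT; apply: contraTneq zC => ->.
  have Cv z : z \in C -> z \in C :\ v.
    by move=> zC; rewrite in_setD1 zC andbT; apply: contraTneq zC => ->.
  have [s1 [s2 tE]] : exists s1 s2, t = s1 ++ v :: s2.
    by case/splitPr: vt => s1 s2; exists s1, s2.
  rewrite -/t tE in srt Us.
  have [srt1 /= /path_sorted srt2] := cat_sorted2 srt.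
  move: Us; rewrite cat_uniq /= negb_or => /and3P [_ /andP [v1 _] /andP [v2 _]].
  have sub1 : {subset s1 <= W :\ v}.
    move=> z z1; rewrite in_setD1 tW ?andbT; first by apply: contraNneq v1 => <-.
    by rewrite tE mem_cat z1.
  have sub2 : {subset s2 <= W :\ v}.
    move=> z z2; rewrite in_setD1 tW ?andbT; first by apply: contraNneq v2 => <-.
    by rewrite tE mem_cat inE z2 !orbT.
  move: xt; rewrite -/t tE mem_cat inE (negbTE xv) /= => /orP [x1|x2].
    have u1 : u \in s1.
      by case: (s1) tE x1 => // a s1' [<- _] _; rewrite mem_head.
    exists p; first exact: Cv.
    apply: linked_trans (sorted_linked srt1 sub1 x1 u1) _.
    by apply: (linked1 _ _ eup); [apply: sub1 | apply: CWv].
  have w2 : w \in s2.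
    have -> : w = last v s2.
      by have := congr1 (last u) tE; rewrite /= -w_last last_cat.
    by case: (s2) x2 => // b s2' _; rewrite /= mem_last.
  exists q; first exact: Cv.
  apply: linked_trans (sorted_linked srt2 sub2 x2 w2) _.
  by apply: (linked1 _ _ ewq); [apply: sub2 | apply: CWv].
have W_gt2 : 2 < #|W| by apply: leq_trans (subset_leq_card CW); apply: ltnW.
suff nocut : connected_no_cut (induced e W).
  by have := long_cycle_block lcC CW nocut pC (tW u ut) uC; rewrite eup.
apply: induced_no_cut => // v x y vW xW yW.
have [r rC xr] := toC v x vW xW; have [r' r'C yr'] := toC v y vW yW.
apply: linked_trans xr _; apply: linked_trans (_ : linked _ r r') _; last first.
  by rewrite linked_sym.
have [vC|vC] := boolP (v \in C).
  by apply: linkedS (setSD [set v] CW) _; apply: (is_cycle_linked cycC vC rC r'C).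
have CE : C :\ v = C by apply/eqP; rewrite eqEsubset subsetDl subsetD1 subxx vC.
rewrite CE in rC r'C; apply: linkedS (_ : C \subset W :\ v) _.
  by rewrite subsetD1 CW vC.
exact: long_cycle_linked.
Qed.

(** The vertices of [C] adjacent to the component of [u] outside [C]. For a long cycle there is at
    most one, so it serves as a label. *)
Definition attach C (u : T) : {set T} :=
  [set p in C | [exists w, [&& w \notin C, linked (~: C) u w & e w p]]].

Lemma attachP C u p : reflect (p \in C /\ exists w, [/\ w \notin C, linked (~: C) u w & e w p])
  (p \in attach C u).
Proof.
rewrite inE; apply: (iffP andP) => -[pC ex]; split=> //.
  by have /existsP [w /and3P [? ? ?]] := ex; exists w.
by have [w [? ? ?]] := ex; apply/existsP; exists w; apply/and3P.
Qed.

Lemma attach_uniq C u p q : long_cycle C -> u \notin C ->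
  p \in attach C u -> q \in attach C u -> p = q.
Proof.
move=> lcC uC /attachP [pC [w [wC uw ewp]]] /attachP [qC [w' [w'C uw' ew'q]]].
apply: (long_cycle_ear lcC pC qC wC w'C ewp ew'q).
by apply: linked_trans uw'; rewrite linked_sym.
Qed.

Definition long_cycles : {set {set T}} := [set C | long_cycle C].

(** If long cycles [C] and [D] shared two vertices, start at [u] in [D] off [C]. At most one vertex
    [t] of [D] can be an entrance to [C] from the component of [u]; yet [D] without [t] still
    connects [u] to another common vertex. *)
Lemma valid_long_cycles : valid e setT long_cycles.
Proof.
have attach1 C u p : long_cycle C -> u \notin C -> p \in C -> e u p -> p \in attach C u.
  by move=> lcC uC pC eup; apply/attachP; split=> //; exists u; split=> //; apply: connect0.
split=> [C|C D]; rewrite !inE => lcC.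
  split; [exact: subsetT | exact: long_cycle_cyc |].
  exists (attach C); split.
  - by move=> u _ _; apply/subsetP => p; rewrite inE => /andP [].
  - by move=> u p q _ uC pu qu; rewrite /adjeq (attach_uniq lcC uC pu qu) eqxx.
  - by move=> u p _; apply: attach1.
  move=> u w _ uC _ wC euw; have uw : linked (~: C) u w by apply: linked1; rewrite ?inE.
  apply/setP => p; apply/attachP/attachP => -[pC [t [tC lt etp]]]; split=> //; exists t; split=> //.
    by apply: linked_trans lt; rewrite linked_sym.
  exact: linked_trans uw lt.
move=> lcD nCD; rewrite leqNgt; apply/negP => CD_gt1.
have [_ degC connC] := long_cycle_cyc lcC; have [_ degD _] := long_cycle_cyc lcD.
have D0 : D != set0.
  by rewrite -card_gt0; apply: leq_trans (subset_leq_card (subsetIr C D)); apply: ltnW.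
have [u uD uC] : exists2 u, u \in D & u \notin C.
  apply/subsetPn; apply: contra nCD => /subsetP DC; apply/eqP/esym/connC => //.
    exact/subsetP.
  move=> x y xD yC exy.
  have /eqP E : nb e D x == nb e C x.
    rewrite eqEcard degC ?degD ?DC // leqnn andbT; apply/subsetP => z.
    by rewrite !inE => /andP [/DC -> ->].
  by have : y \in nb e D x; [rewrite E inE yC | rewrite inE => /andP []].
(* If [D] contains no entrance, any common vertex may play the role of [t]. *)
have [t tD Ht] : exists2 t, t \in D & t != u /\ forall y, y \in D -> y \in attach C u -> y = t.
  have [/existsP [t /andP [tD tu]]|none] := boolP [exists t, (t \in D) && (t \in attach C u)].
    exists t => //; split=> [|y _ yu]; last exact: attach_uniq lcC uC yu tu.
    by apply: contraNneq uC => <-; have /attachP [] := tu.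
  have [p] : exists p, p \in C :&: D by apply/set0Pn; rewrite -card_gt0 (ltnW CD_gt1).
  rewrite inE => /andP [pC pD]; exists p => //; split=> [|y yD yu].
    by apply: contraNneq uC => <-.
  by case/existsP: none; exists y; rewrite yD.
have [q] : exists q, q \in (C :&: D) :\ t.
  apply/set0Pn; rewrite -card_gt0; move: CD_gt1; rewrite (cardsD1 t).
  by case: (_ \in _) => //= /ltnW.
rewrite !inE => /and3P [qt qC qD]; case: Ht => tu Ht.
have /andP [_ cycD] := lcD.
have uq : linked (D :\ t) u q.
  by apply: (is_cycle_linked cycD tD); rewrite in_setD1 ?qt // eq_sym tu.
pose X := [pred x | (x \notin C) && linked (~: C) u x].
suff : q \in X by rewrite inE qC.
apply: (linked_closed uq) => [|a b]; first by rewrite inE uC; apply: connect0.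
rewrite !inE => /andP [aC ua] /and3P [_ /setD1P [bt bD] eab].
have [bC|bC] := boolP (b \in C); last first.
  by apply: linked_trans ua _; apply: linked1; rewrite ?inE.
by case/eqP: bt; apply: Ht => //; apply/attachP; split=> //; exists a.
Qed.

Lemma clique_maximal x y : e x y -> exists2 W, maximal_clique e W & (x \in W) && (y \in W).
Proof.
move=> exy; have : clique e [set x; y].
  rewrite /clique -card_gt0 cards2 /=; apply/forall_inP => a aV; apply/forall_inP => b bV.
  apply/implyP; rewrite adj_induced /within aV bV /=; move: aV bV.
  by rewrite !inE => /orP [] /eqP -> /orP [] /eqP ->; rewrite ?eqxx // e_sym.
move=> /maxset_exists [W maxW /subsetP sub]; exists W => //.
by rewrite !sub // !inE eqxx ?orbT.
Qed.

Lemma clique_adjeq W x y : clique e W -> x \in W -> y \in W -> adjeq e x y.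
Proof.
move=> /andP [_ complW] xW yW; rewrite /adjeq; have [//|nxy] := eqVneq x y.
have := forall_inP (forall_inP complW x xW) y yW.
by rewrite nxy adj_induced => /and3P [].
Qed.

Lemma sum_long_cycles :
  \sum_(C in long_cycles) (#|C| - 2) <=
  \sum_(4 <= k < #|T|.+1) (k - 2) * num_induced_cycles e k.
Proof.
have -> : \sum_(4 <= k < #|T|.+1) (k - 2) * num_induced_cycles e k =
    \sum_(C : {set T}) \sum_(4 <= k < #|T|.+1 | is_cycle k (induced e C)) (k - 2).
  rewrite (exchange_big_dep predT) //=; apply: eq_bigr => k _.
  rewrite /num_induced_cycles mulnC -sum_nat_const.
  by apply: eq_bigl => C; rewrite inE.
rewrite big_mkcond; apply: leq_sum => C _; case: ifP => // lcC.
move: lcC; rewrite inE => /andP [C_gt3 cycC].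
rewrite (big_rem #|C|) /=; last by rewrite mem_index_iota C_gt3 ltnS max_card.
by rewrite cycC leq_addr.
Qed.

Lemma card_adm (E : {set T * T}) : adm e setT long_cycles E ->
  #|E| <= c' e + \sum_(4 <= k < #|T|.+1) (k - 2) * num_induced_cycles e k.
Proof.
move=> [Eedge dE bound].
pose Ec := \bigcup_(C in long_cycles) inside E C.
have le_Ec : #|Ec| <= \sum_(C in long_cycles) (#|C| - 2).
  rewrite /Ec; elim/big_rec2: _ => [|C k A lcC IH]; first by rewrite cards0.
  apply: leq_trans (leq_card_setU _ _) _; apply: leq_add => //; exact: bound.
have edge_neq h : h \in E -> h.1 != h.2.
  by move=> /Eedge /and3P [_ _]; apply: contraTneq => ->; rewrite e_irr.
have exW (h : T * T) : exists W, h \in E ->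
    [/\ maximal_clique e W, h.1 \in W & h.2 \in W].
  have [hE|nhE] := boolP (h \in E); last by exists set0.
  have /and3P [_ _ /clique_maximal [W maxW /andP [h1 h2]]] := Eedge h hE.
  by exists W.
pose f h := proj1_sig (constructive_indefinite_description _ (exW h)).
have fP h : h \in E -> [/\ maximal_clique e (f h), h.1 \in f h & h.2 \in f h].
  exact: (proj2_sig (constructive_indefinite_description _ (exW h))).
rewrite -(cardsID Ec E) addnC; apply: leq_add; last first.
  apply: leq_trans (subset_leq_card (subsetIr _ _)) _.
  exact: leq_trans le_Ec sum_long_cycles.
have f_inj : {in E :\: Ec &, injective f}.
  move=> h h' /setDP [hE _] /setDP [h'E _] ff.
  have [/maxsetp clf h1 h2] := fP h hE; have [_ h'1 h'2] := fP h' h'E.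
  by rewrite -ff in h'1 h'2; apply: dE => //; apply/and4P; split; apply: clique_adjeq clf _ _.
rewrite -(card_in_imset f_inj); apply: subset_leq_card.
(* If the clique chosen for [h] were an edge of a long cycle, both ends of [h] would lie on that
   cycle and [h] would be in [Ec]. *)
apply/subsetP => _ /imsetP [h /setDP [hE nEc] ->]; rewrite inE.
have [maxf h1 h2] := fP h hE; rewrite maxf /=; apply: contra nEc.
move=> /existsP [U /and3P [U_gt3 cycU /existsP [x /existsP [y /andP [exy /eqP fE]]]]].
apply/bigcupP; exists U; first by rewrite inE /long_cycle U_gt3.
have /and3P [xU yU _] : within U x y by rewrite -adj_induced.
move: h1 h2; rewrite fE !inE hE /=.
by do 2!case/orP=> /eqP ->; rewrite ?xU ?yU.
Qed.

End Blocks.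

Theorem theorem3p2 (K : fieldType) (n : nat) (e : rel 'I_n)
  (e_sym : ssrbool.symmetric e) (e_irr : irreflexive e)
  (blocksG : forall H : subgraph 'I_n, block e H ->
     (exists k : nat, is_cycle k H) \/ is_complete H) :
  (reg_quot (binomial_edge_ideal K e) <=
     (c' e + \sum_(4 <= k < n.+1) (k - 2) * num_induced_cycles e k)%N%:Z)%R.
Proof.
apply: reg_quot_binomial_le => //.
apply: (Greg_marked e_sym e_irr (valid_long_cycles e_sym blocksG)) => E admE.
by have := card_adm e_sym e_irr admE; rewrite card_ord.
Qed.
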